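(* For every $N\ge1$ there is a closed set $E\subset\mathbb{R}^{2^N}$ of Lebesgue measure zero such that the following holds for every $N\times 2$ potential game whose potential payoff vector $u\in\mathbb{R}^{2^N}$ lies outside $E$. There exists $\lambda_0>0$ such that, for every $\lambda\in(0,\lambda_0)$ and every initial action profile $a(0)$, the smooth fictitious play process with parameter $\lambda$ has the following property: with probability 1, the empirical distribution $x(n)$ converges as $n\to\infty$ to a pure-strategy Nash distribution in $\mathrm{ND}(\lambda)$.
   Context: An $N\times 2$ game has players $i=1,\dots,N$, each with action set $A_i=\{a_i^1,a_i^2\}$, and utilities $u_i:A_1\times\cdots\times A_N\to\mathbb{R}$. It is a potential game with potential $u:A_1\times\cdots\times A_N\to\mathbb{R}$ if $u(a_i,a_{-i})-u(a_i',a_{-i})=u_i(a_i,a_{-i})-u_i(a_i',a_{-i})$ for all $i$, all $a_i,a_i'\in A_i$ and all $a_{-i}$. The game is identified with its potential payoff vector $u\in\mathbb{R}^{2\times\cdots\times2}=\mathbb{R}^{2^N}$. A mixed strategy of player $i$ is a number $x_i\in[0,1]$, the probability of playing $a_i^1$. Joint mixed strategies form $\Delta=[0,1]^N$. The multilinear extension of the potential is $$U(x)=\sum_{k_1,\dots,k_N\in\{1,2\}} z_1^{k_1}(x_1)\cdots z_N^{k_N}(x_N)\,u(a_1^{k_1},\dots,a_N^{k_N}),$$ where $z_i^1(x_i)=x_i$ and $z_i^2(x_i)=1-x_i$. We write $U(a_i^k,x_{-i})$ for the value of $U$ when player $i$ plays $a_i^k$ with probability 1 and the others play $x_{-i}$.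 The set of Nash equilibria is $\mathrm{NE}=\{x\in\Delta: U(x_i,x_{-i})\ge U(x_i',x_{-i})\ \text{for all } i \text{ and all } x_i'\in[0,1]\}$. For $\lambda>0$, the logit (smoothed) best response is $$\widehat{BR}^\lambda_i(x)=\frac{\exp(U(a_i^1,x_{-i})/\lambda)}{\sum_{k=1,2}\exp(U(a_i^k,x_{-i})/\lambda)},\qquad \widehat{BR}^\lambda(x)=(\widehat{BR}^\lambda_1(x),\dots,\widehat{BR}^\lambda_N(x)).$$ The set of Nash distributions is $\mathrm{ND}(\lambda)=\{x\in\Delta: x=\widehat{BR}^\lambda(x)\}$. Smooth fictitious play with parameter $\lambda$: - The initial actions $a_i(0)$ are arbitrary. - For $n\ge0$, conditionally on the past, the players independently choose $a_i(n+1)=a_i^1$ with probability $\widehat{BR}^\lambda_i(x(n))$ and $a_i(n+1)=a_i^2$ otherwise. - The empirical distribution is $x_i(n)=\frac1n\sum_{s=1}^n\mathbf{1}\{a_i(s)=a_i^1\}$, equivalently $x_i(n+1)=x_i(n)+\frac{1}{n+1}\big(\mathbf{1}\{a_i(n+1)=a_i^1\}-x_i(n)\big)$. Pure-strategy Nash distribution. For $\lambda$ small, every Nash distribution lies on a continuous branch $\lambda\mapsto x^\lambda\in\mathrm{ND}(\lambda)$ converging to a Nash equilibrium as $\lambda\to0$. A Nash distribution is a pure-strategy Nash distribution if its branch converges to a pure-strategy Nash equilibrium, i.e. a point of $\{0,1\}^N\cap\mathrm{NE}$. *)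

(* Defs.v *)
From Stdlib Require Import Reals Lra Lia Arith.
Open Scope R_scope.

Fixpoint rsum (n : nat) (f : nat -> R) : R :=
  match n with O => 0 | S m => rsum m f + f m end.
Fixpoint rprod (n : nat) (f : nat -> R) : R :=
  match n with O => 1 | S m => rprod m f * f m end.

(* ---------- Vectors in R^d as functions nat -> R (only k < d matter) ---------- *)

Definition depends_on_first (d : nat) (E : (nat -> R) -> Prop) : Prop :=
  forall u v, (forall k, (k < d)%nat -> u k = v k) -> (E u <-> E v).

Definition closed_in (d : nat) (E : (nat -> R) -> Prop) : Prop :=
  forall u, (forall eps, 0 < eps -> exists v, E v /\
                forall k, (k < d)%nat -> Rabs (u k - v k) < eps) -> E u.

Definition box_vol (d : nat) (lo hi : nat -> R) : R :=
  rprod d (fun k => Rmax 0 (hi k - lo k)).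

Definition lebesgue_null (d : nat) (E : (nat -> R) -> Prop) : Prop :=
  forall eps, 0 < eps ->
  exists lo hi : nat -> nat -> R,
    (forall K, rsum K (fun j => box_vol d (lo j) (hi j)) <= eps) /\
    (forall u, E u -> exists j, forall k, (k < d)%nat -> lo j k <= u k <= hi j k).

(* A mixed profile x : nat -> R, x i = prob. that player i (i < N) plays a_i^1.
   The potential u : nat -> R is a vector of R^(2^N): coordinate k < 2^N is the
   potential at the pure profile where player i plays a_i^2 iff bit i of k is set. *)

Definition in_Delta (N : nat) (x : nat -> R) : Prop :=
  forall i, (i < N)%nat -> 0 <= x i <= 1.

Definition U (N : nat) (u : nat -> R) (x : nat -> R) : R :=
  rsum (2 ^ N)%nat (fun k =>
    rprod N (fun i => if Nat.testbit k i then 1 - x i else x i) * u k).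

Definition upd (x : nat -> R) (i : nat) (v : R) : nat -> R :=
  fun j => if Nat.eqb j i then v else x j.

Definition NE (N : nat) (u : nat -> R) (x : nat -> R) : Prop :=
  in_Delta N x /\
  forall i, (i < N)%nat -> forall y, 0 <= y <= 1 -> U N u (upd x i y) <= U N u x.

Definition pure_point (N : nat) (p : nat -> R) : Prop :=
  forall i, (i < N)%nat -> p i = 0 \/ p i = 1.

(* logit best response of player i: U(a_i^1,x_{-i}) = U(upd x i 1), U(a_i^2,x_{-i}) = U(upd x i 0) *)
Definition BR (N : nat) (u : nat -> R) (lam : R) (i : nat) (x : nat -> R) : R :=
  exp (U N u (upd x i 1) / lam) /
  (exp (U N u (upd x i 1) / lam) + exp (U N u (upd x i 0) / lam)).

Definition ND (N : nat) (u : nat -> R) (lam : R) (x : nat -> R) : Prop :=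
  in_Delta N x /\ forall i, (i < N)%nat -> x i = BR N u lam i x.

Definition pure_ND (N : nat) (u : nat -> R) (lam : R) (x : nat -> R) : Prop :=
  exists (b : R -> nat -> R) (p : nat -> R),
    (forall i, (i < N)%nat -> b lam i = x i) /\
    (forall mu, 0 < mu <= lam -> ND N u mu (b mu)) /\
    (forall mu, 0 < mu <= lam -> forall eps, 0 < eps -> exists delta, 0 < delta /\
        forall nu, 0 < nu <= lam -> Rabs (nu - mu) < delta ->
        forall i, (i < N)%nat -> Rabs (b nu i - b mu i) < eps) /\
    (forall eps, 0 < eps -> exists delta, 0 < delta /\
        forall nu, 0 < nu <= lam -> nu < delta ->
        forall i, (i < N)%nat -> Rabs (b nu i - p i) < eps) /\
    pure_point N p /\ NE N u p.

(* A pure profile is a : nat -> bool, a i = true iff player i plays a_i^1.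
   A path is w : nat -> (nat -> bool), w n = a(n) for n >= 1 (w 0 is ignored;
   the initial profile a(0) is the separate parameter a0). *)

Definition ind (b : bool) : R := if b then 1 else 0.

Definition emp (a0 : nat -> bool) (w : nat -> nat -> bool) (n : nat) : nat -> R :=
  fun i => match n with
           | O => ind (a0 i)
           | _ => / INR n * rsum n (fun s => ind (w (S s) i))
           end.

Definition cyl_prob (N : nat) (u : nat -> R) (lam : R) (a0 : nat -> bool)
    (h : nat -> nat -> bool) (m : nat) : R :=
  rprod m (fun n => rprod N (fun i =>
     let p := BR N u lam i (emp a0 h n) in if h (S n) i then p else 1 - p)).

Definition in_cyl (N : nat) (h : nat -> nat -> bool) (m : nat)
    (w : nat -> nat -> bool) : Prop :=
  forall n, (1 <= n <= m)%nat -> forall i, (i < N)%nat -> w n i = h n i.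

(* null event for the law of the process: covered by countably many cylinders of
   arbitrarily small total probability (outer measure zero) *)
Definition sfp_null (N : nat) (u : nat -> R) (lam : R) (a0 : nat -> bool)
    (A : (nat -> nat -> bool) -> Prop) : Prop :=
  forall eps, 0 < eps ->
  exists (hs : nat -> nat -> nat -> bool) (ms : nat -> nat),
    (forall K, rsum K (fun j => cyl_prob N u lam a0 (hs j) (ms j)) <= eps) /\
    (forall w, A w -> exists j, in_cyl N (hs j) (ms j) w).

Definition sfp_as (N : nat) (u : nat -> R) (lam : R) (a0 : nat -> bool)
    (P : (nat -> nat -> bool) -> Prop) : Prop :=
  sfp_null N u lam a0 (fun w => ~ P w).

Definition converges_to (N : nat) (x : nat -> nat -> R) (l : nat -> R) : Prop :=
  forall eps, 0 < eps -> exists M, forall n, (M <= n)%nat ->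
    forall i, (i < N)%nat -> Rabs (x n i - l i) < eps.

(* Main.v *)
From Stdlib Require Import Reals Lra Lia Arith List Classical ClassicalEpsilon FunctionalExtensionality PropExtensionality.
From Coquelicot Require Import Coquelicot.
Require Import Defs.
Open Scope R_scope.

(** Smooth fictitious play is the stochastic approximation
    [x(n+1) = x(n) + (F(x(n)) + noise) / (n+1)] of the field [F = BR - id].

    Convergence. The potential plus an entropy term is a Lyapunov function for [F]: its drift
    dominates [|F|^2], hence [sum |F(x(n))|^2 / n] is finite almost surely, [F(x(n))] tends
    to [0], and [x(n)] converges because the zeros of [F] (the Nash distributions) are isolated.

    Regularity. Outside of a closed null set of potentials, Nash equilibria have strict pure
    players and an invertible Hessian [H] on the mixed players. The null set is treated as in
    the proof of Sard's theorem, counting the cells of a grid. Regularity is stated with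
    a margin [eps], so that it survives rounding a Nash distribution to a face of the cube
    and no compactness argument is needed for small [lambda].

    Instability. At a Nash distribution [z], the linearization of [F] is [P H - 1] with the diagonal
    [P = z (1 - z) / lambda]; it is self-adjoint for the scalar product weighted by [P].
    With [K = H P], regularity forces [K] to have no spectrum near [[1/2, 1]] for small [lambda].
    The quadratic form [Q] of [(K - 1/2)(K + L)], [L] large, increases along [F], so does
    [n Q], and since [H] has zero diagonal its trace [tr(K^2) - N L / 2] is positive as soon as
    some player is mixed. The noise then drives [n Q] to infinity,
    after which [1 / Q] is a supermartingale: [Q(x(n))] cannot tend to [0].

    Only a maximal inequality for supermartingales, proved on the tree of histories, is needed
    to turn these drift estimates into covers by cylinders. *)

(** The quadratic form avoids a splitting into stable and unstable directions. In the coordinates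
    [e = P a], the simpler form of [K - 1/2] already has the right drifts: along the linearized
    field it grows at the rate [2 (K - 1)(K - 1/2)], positive because [K] has no spectrum in
    [[1/2, 1]]; and passing from [n Q] to [(n + 1) Q] adds one more [Q], which gives [2 (K - 1)(K -
    1/2) + (K - 1/2) = 2 (K - 1/2)^2]. This identity is the origin of [1/2]. But the noise enters
    through a trace, and the trace of [K - 1/2] is negative, that of [K] being zero. The positive
    factor [K + L] commutes with [K], so it preserves both signs, and it brings in the trace of
    [K^2]. With a mixed player the latter is of order [1 / lambda^2], while [L], a multiple of a
    bound for [K], is only of order [1 / lambda]. *)

Lemma INR_ge_1 n : (1 <= n)%nat -> 1 <= INR n.
Proof. intros h. change 1 with (INR 1). now apply le_INR. Qed.

Lemma Rabs_sqr x : Rabs x * Rabs x = x * x.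
Proof. rewrite <- Rabs_mult. apply Rabs_pos_eq, Rle_0_sqr. Qed.

(** * Finite sums and products *)

Lemma rsum_ext n f g : (forall i, (i < n)%nat -> f i = g i) -> rsum n f = rsum n g.
Proof.
  induction n as [|n IH]; simpl; intros h; auto.
  rewrite IH, (h n); auto; intros; apply h; lia.
Qed.

Lemma rsum_plus n f g : rsum n (fun i => f i + g i) = rsum n f + rsum n g.
Proof. induction n; simpl; lra. Qed.

Lemma rsum_minus n f g : rsum n (fun i => f i - g i) = rsum n f - rsum n g.
Proof. induction n; simpl; lra. Qed.

Lemma rsum_scal n c f : rsum n (fun i => c * f i) = c * rsum n f.
Proof. induction n; simpl; lra. Qed.

Lemma rsum_const n c : rsum n (fun _ => c) = INR n * c.
Proof. induction n; [simpl; lra|]. rewrite S_INR; simpl; lra. Qed.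

Lemma rsum_0 n f : (forall i, (i < n)%nat -> f i = 0) -> rsum n f = 0.
Proof.
  intros h; rewrite (rsum_ext n f (fun _ => 0)) by exact h.
  rewrite rsum_const; lra.
Qed.

Lemma rsum_le n f g : (forall i, (i < n)%nat -> f i <= g i) -> rsum n f <= rsum n g.
Proof.
  induction n as [|n IH]; simpl; intros h; [lra|].
  apply Rplus_le_compat; auto.
Qed.

Lemma rsum_nonneg n f : (forall i, (i < n)%nat -> 0 <= f i) -> 0 <= rsum n f.
Proof.
  intros h; rewrite <- (rsum_0 n (fun _ => 0)) by auto; now apply rsum_le.
Qed.

Lemma rsum_abs n f : Rabs (rsum n f) <= rsum n (fun i => Rabs (f i)).
Proof.
  induction n; simpl; [rewrite Rabs_R0; lra|].
  eapply Rle_trans; [apply Rabs_triang|lra].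
Qed.

Lemma rsum_swap n m f :
  rsum n (fun i => rsum m (fun j => f i j)) = rsum m (fun j => rsum n (fun i => f i j)).
Proof.
  induction n; simpl; [now rewrite rsum_0|].
  now rewrite IHn, rsum_plus.
Qed.

Lemma rsum_single n k c : (k < n)%nat -> rsum n (fun i => if Nat.eqb i k then c else 0) = c.
Proof.
  induction n; intros h; [lia|]; simpl.
  destruct (Nat.eqb_spec n k) as [->|e].
  - rewrite rsum_0; [lra|]. intros i hi; destruct (Nat.eqb_spec i k); [lia|auto].
  - rewrite IHn by lia; lra.
Qed.

Lemma rsum_ge_term n f k : (forall i, (i < n)%nat -> 0 <= f i) -> (k < n)%nat -> f k <= rsum n f.
Proof.
  intros h hk. rewrite <- (rsum_single n k (f k)) by auto.
  apply rsum_le; intros i hi; destruct (Nat.eqb_spec i k) as [->|]; [lra|auto].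
Qed.

Lemma rsum_le_const n f c : (forall i, (i < n)%nat -> f i <= c) -> rsum n f <= INR n * c.
Proof. intros h; rewrite <- rsum_const; now apply rsum_le. Qed.

Lemma rsum_le_mono n m f : (forall i, 0 <= f i) -> (n <= m)%nat -> rsum n f <= rsum m f.
Proof. intros h; induction 1; simpl; [lra|]. specialize (h m); lra. Qed.

Lemma rsum_split n m f : rsum (n + m) f = rsum n f + rsum m (fun i => f (n + i)%nat).
Proof.
  induction m; simpl; [rewrite Nat.add_0_r; lra|].
  rewrite Nat.add_succ_r; simpl; lra.
Qed.

Lemma rsum_mult n m f g :
  rsum n f * rsum m g = rsum n (fun i => rsum m (fun j => f i * g j)).
Proof.
  rewrite Rmult_comm, <- rsum_scal; apply rsum_ext; intros i _.
  rewrite rsum_scal; ring.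
Qed.

Lemma rsum_shift n f : rsum (S n) f = f O + rsum n (fun i => f (S i)).
Proof. induction n; simpl in *; lra. Qed.

Lemma rprod_ext n f g : (forall i, (i < n)%nat -> f i = g i) -> rprod n f = rprod n g.
Proof.
  induction n as [|n IH]; simpl; intros h; auto.
  rewrite IH, (h n); auto; intros; apply h; lia.
Qed.

Lemma rprod_mult n f g : rprod n (fun i => f i * g i) = rprod n f * rprod n g.
Proof. induction n; simpl; [lra|]. rewrite IHn; ring. Qed.

Lemma rprod_1 n f : (forall i, (i < n)%nat -> f i = 1) -> rprod n f = 1.
Proof. induction n; simpl; intros h; [lra|]. rewrite IHn, h by auto; lra. Qed.

Lemma rprod_const n c : rprod n (fun _ => c) = c ^ n.
Proof. induction n; simpl; [lra|]. rewrite IHn; ring. Qed.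

Lemma rprod_nonneg n f : (forall i, (i < n)%nat -> 0 <= f i) -> 0 <= rprod n f.
Proof. induction n; simpl; intros h; [lra|]. apply Rmult_le_pos; auto. Qed.

Lemma rprod_le n f g : (forall i, (i < n)%nat -> 0 <= f i <= g i) -> rprod n f <= rprod n g.
Proof.
  induction n; simpl; intros h; [lra|].
  apply Rmult_le_compat; auto; try apply h; auto.
  apply rprod_nonneg; intros; apply h; lia.
Qed.

Lemma rprod_swap n m f :
  rprod n (fun i => rprod m (fun j => f i j)) = rprod m (fun j => rprod n (fun i => f i j)).
Proof.
  induction n; simpl; [now rewrite rprod_1|].
  now rewrite IHn, rprod_mult.
Qed.

Lemma rprod_single n k c : (k < n)%nat -> rprod n (fun i => if Nat.eqb i k then c else 1) = c.
Proof.
  induction n; intros h; [lia|]; simpl.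
  destruct (Nat.eqb_spec n k) as [->|e].
  - rewrite rprod_1; [lra|]. intros i hi; destruct (Nat.eqb_spec i k); [lia|auto].
  - rewrite IHn by lia; lra.
Qed.

(** * Multiaffine functions *)

Lemma upd_same x i v : upd x i v i = v.
Proof. unfold upd; now rewrite Nat.eqb_refl. Qed.

Lemma upd_other x i v j : j <> i -> upd x i v j = x j.
Proof. intros h; unfold upd; destruct (Nat.eqb_spec j i); [contradiction|auto]. Qed.

Lemma upd_comm x i v j w : i <> j -> upd (upd x i v) j w = upd (upd x j w) i v.
Proof.
  intros h; extensionality k; unfold upd.
  destruct (Nat.eqb_spec k j), (Nat.eqb_spec k i); auto; lia.
Qed.

Lemma upd_upd x i v w : upd (upd x i v) i w = upd x i w.
Proof. extensionality k; unfold upd; now destruct (Nat.eqb_spec k i). Qed.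

Lemma upd_id x i : upd x i (x i) = x.
Proof. extensionality k; unfold upd; now destruct (Nat.eqb_spec k i) as [->|]. Qed.

Lemma upd_in_Delta N x i v : in_Delta N x -> 0 <= v <= 1 -> in_Delta N (upd x i v).
Proof. intros hx hv j hj; unfold upd; destruct (Nat.eqb j i); auto. Qed.

(** A class closed under [pd]: estimates proved once for it apply to [U], to its gradient and to its
    Hessian, without differential calculus in several variables. *)
Definition multiaffine (N : nat) (g : (nat -> R) -> R) : Prop :=
  (forall x y, (forall i, (i < N)%nat -> x i = y i) -> g x = g y) /\
  (forall i x y, (i < N)%nat -> g (upd x i y) = y * g (upd x i 1) + (1 - y) * g (upd x i 0)).

(** The slope of a multiaffine [g] in coordinate [i] is constant, so this difference is exactly the
    partial derivative. *)
Definition pd (g : (nat -> R) -> R) (i : nat) (x : nat -> R) : R := g (upd x i 1) - g (upd x i 0).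

Definition l1 (N : nat) (e : nat -> R) : R := rsum N (fun i => Rabs (e i)).

Definition sqn (N : nat) (e : nat -> R) : R := rsum N (fun i => e i * e i).

Lemma l1_nonneg N e : 0 <= l1 N e.
Proof. apply rsum_nonneg; intros; apply Rabs_pos. Qed.

Lemma sqn_nonneg N e : 0 <= sqn N e.
Proof. apply rsum_nonneg; intros; nra. Qed.

Lemma l1_sqr N e : l1 N e * l1 N e <= INR N * sqn N e.
Proof.
  unfold l1; rewrite rsum_mult.
  apply Rle_trans with
    (rsum N (fun i => rsum N (fun j => (e i * e i) / 2 + (e j * e j) / 2))).
  - apply rsum_le; intros i _; apply rsum_le; intros j _.
    assert (hi : Rabs (e i) * Rabs (e i) = e i * e i)
      by (rewrite <- Rabs_mult; apply Rabs_pos_eq; nra).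
    assert (hj : Rabs (e j) * Rabs (e j) = e j * e j)
      by (rewrite <- Rabs_mult; apply Rabs_pos_eq; nra).
    pose proof (Rle_0_sqr (Rabs (e i) - Rabs (e j))) as h; unfold Rsqr in h; nra.
  - rewrite (rsum_ext N _ (fun i => INR N * (/ 2 * (e i * e i)) + / 2 * sqn N e)).
    + rewrite rsum_plus, rsum_const, !rsum_scal. fold (sqn N e). lra.
    + intros i _. rewrite rsum_plus, rsum_const.
      rewrite (rsum_ext N (fun j => e j * e j / 2) (fun j => / 2 * (e j * e j)))
        by (intros; lra).
      rewrite rsum_scal; fold (sqn N e); lra.
Qed.

Lemma abs_le_l1 N e i : (i < N)%nat -> Rabs (e i) <= l1 N e.
Proof. intros hi; apply (rsum_ge_term N (fun i => Rabs (e i))); auto; intros; apply Rabs_pos. Qed.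

Lemma sqr_le_sqn N e i : (i < N)%nat -> e i * e i <= sqn N e.
Proof. intros hi; apply (rsum_ge_term N (fun i => e i * e i)); auto; intros; nra. Qed.

Lemma pd_upd g i x v : pd g i (upd x i v) = pd g i x.
Proof. unfold pd; now rewrite !upd_upd. Qed.

Lemma pd_swap g i j x : i <> j -> pd (pd g i) j x = pd (pd g j) i x.
Proof.
  intros h; unfold pd.
  rewrite !(upd_comm x j _ i) by auto. ring.
Qed.

Lemma pd_pd g i x : pd (pd g i) i x = 0.
Proof. unfold pd at 1; rewrite !pd_upd; ring. Qed.

Lemma multiaffine_upd N g i x y z : multiaffine N g -> (i < N)%nat ->
  g (upd x i y) - g (upd x i z) = pd g i x * (y - z).
Proof.
  intros [_ h] hi. rewrite (h i x y hi), (h i x z hi); unfold pd; ring.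
Qed.

Lemma multiaffine_pd N g i : multiaffine N g -> (i < N)%nat -> multiaffine N (pd g i).
Proof.
  intros [h1 h2] hi; split.
  - intros x y e; unfold pd; apply f_equal2; apply h1; intros j hj;
      unfold upd; destruct (Nat.eqb j i); auto.
  - intros j x y hj.
    destruct (Nat.eq_dec j i) as [->|ne].
    + rewrite !pd_upd; ring.
    + unfold pd. rewrite !(upd_comm x j _ i) by auto.
      rewrite (h2 j (upd x i 1) y hj), (h2 j (upd x i 0) y hj); ring.
Qed.

Lemma pd_bound N g B i : (forall x, in_Delta N x -> Rabs (g x) <= B) ->
  forall x, in_Delta N x -> Rabs (pd g i x) <= 2 * B.
Proof.
  intros h x hx; unfold pd.
  assert (h1 := h _ (upd_in_Delta N x i 1 hx ltac:(lra))).
  assert (h0 := h _ (upd_in_Delta N x i 0 hx ltac:(lra))).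
  revert h1 h0; unfold Rabs; repeat destruct Rcase_abs; lra.
Qed.

(** Moves from [x] to [y] one coordinate at a time, staying in the cube. A multiaffine function is
    affine along each move, so its increments are exact products of a partial derivative and a
    displacement. *)
Definition splice (j : nat) (y x : nat -> R) : nat -> R := fun i => if Nat.ltb i j then y i else x i.

Lemma splice_in_Delta N j x y : in_Delta N x -> in_Delta N y -> in_Delta N (splice j y x).
Proof. intros hx hy i hi; unfold splice; destruct (Nat.ltb i j); auto. Qed.

Lemma splice_0 x y : splice 0 y x = x.
Proof. extensionality i; unfold splice; now destruct (Nat.ltb_spec i 0). Qed.

Lemma splice_S j x y : splice (S j) y x = upd (splice j y x) j (y j).
Proof.
  extensionality i; unfold splice, upd.
  destruct (Nat.ltb_spec i (S j)), (Nat.ltb_spec i j), (Nat.eqb_spec i j); subst; auto; lia.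
Qed.

Lemma splice_at j x y : splice j y x j = x j.
Proof. unfold splice; destruct (Nat.ltb_spec j j); [lia|auto]. Qed.

Lemma multiaffine_telescope N g x y : multiaffine N g ->
  g y - g x = rsum N (fun j => pd g j (splice j y x) * (y j - x j)).
Proof.
  intros hg.
  assert (e : forall m, (m <= N)%nat -> g (splice m y x) - g x =
     rsum m (fun j => pd g j (splice j y x) * (y j - x j))).
  { induction m; intros hm; simpl; [rewrite splice_0; ring|].
    rewrite <- IHm by lia. rewrite splice_S.
    rewrite <- (multiaffine_upd N g m (splice m y x) (y m) (x m)) by (auto; lia).
    replace (upd (splice m y x) m (x m)) with (splice m y x); [ring|].
    rewrite <- (splice_at m x y) at 1. now rewrite upd_id. }
  rewrite <- e by lia. f_equal. apply (proj1 hg); intros i hi.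
  unfold splice; destruct (Nat.ltb_spec i N); [auto|lia].
Qed.

Lemma multiaffine_lip N g B x y : multiaffine N g ->
  (forall x, in_Delta N x -> Rabs (g x) <= B) -> in_Delta N x -> in_Delta N y ->
  Rabs (g y - g x) <= 2 * B * l1 N (fun i => y i - x i).
Proof.
  intros hg hB hx hy. rewrite (multiaffine_telescope N g x y hg).
  eapply Rle_trans; [apply rsum_abs|].
  unfold l1; rewrite <- rsum_scal; apply rsum_le; intros j hj.
  rewrite Rabs_mult. apply Rmult_le_compat_r; [apply Rabs_pos|].
  apply (pd_bound N); auto using splice_in_Delta.
Qed.

(** The slopes of the telescoping sum are taken at splices, which are no farther from [x] than [y]
    is; being multiaffine themselves, they are Lipschitz close to the slopes at [x]. *)
Lemma multiaffine_taylor N g B x y : multiaffine N g ->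
  (forall x, in_Delta N x -> Rabs (g x) <= B) -> in_Delta N x -> in_Delta N y ->
  Rabs (g y - g x - rsum N (fun j => pd g j x * (y j - x j)))
    <= 4 * B * (l1 N (fun i => y i - x i) * l1 N (fun i => y i - x i)).
Proof.
  intros hg hB hx hy. rewrite (multiaffine_telescope N g x y hg), <- rsum_minus.
  eapply Rle_trans; [apply rsum_abs|].
  unfold l1 at 2. rewrite <- Rmult_assoc, <- rsum_scal; apply rsum_le; intros j hj.
  replace (_ - _) with ((pd g j (splice j y x) - pd g j x) * (y j - x j)) by ring.
  rewrite Rabs_mult. apply Rmult_le_compat_r; [apply Rabs_pos|].
  eapply Rle_trans.
  { apply (multiaffine_lip N (pd g j) (2 * B)); auto using splice_in_Delta, multiaffine_pd.
    apply pd_bound; auto. }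
  replace (2 * (2 * B)) with (4 * B) by ring.
  assert (0 <= B) by (eapply Rle_trans; [apply Rabs_pos|apply (hB x hx)]).
  apply Rmult_le_compat_l; [lra|].
  apply rsum_le; intros i hi. unfold splice; destruct (Nat.ltb i j); [lra|].
  rewrite Rminus_diag, Rabs_R0; apply Rabs_pos.
Qed.

(** * The multilinear extension *)

Lemma testbit_low_add N k i : (i < N)%nat -> Nat.testbit (2 ^ N + k) i = Nat.testbit k i.
Proof.
  intros h. rewrite !Nat.testbit_eqb.
  replace (2 ^ N)%nat with (2 * 2 ^ (N - S i) * 2 ^ i)%nat.
  - rewrite Nat.div_add_l by (apply Nat.pow_nonzero; lia).
    rewrite Nat.mul_comm, Nat.add_comm, Nat.Div0.mod_add; reflexivity.
  - rewrite <- Nat.pow_succ_r', <- Nat.pow_add_r; f_equal; lia.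
Qed.

Lemma testbit_top_add N k : (k < 2 ^ N)%nat -> Nat.testbit (2 ^ N + k) N = true.
Proof.
  intros h. rewrite Nat.testbit_eqb.
  replace (2 ^ N + k)%nat with (1 * 2 ^ N + k)%nat by lia.
  rewrite Nat.div_add_l by (apply Nat.pow_nonzero; lia).
  rewrite Nat.div_small by lia; reflexivity.
Qed.

Lemma testbit_top N k : (k < 2 ^ N)%nat -> Nat.testbit k N = false.
Proof. intros h. rewrite Nat.testbit_eqb, Nat.div_small by lia; reflexivity. Qed.

(** Bit [N] of the profile index is the action of the last player, and a zero bit is the first
    action, hence the weight [x N] on the lower half. Inductions on the number of players rest on
    this formula. *)
Lemma U_S N u x :
  U (S N) u x = x N * U N u x + (1 - x N) * U N (fun k => u (2 ^ N + k)%nat) x.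
Proof.
  unfold U. replace (2 ^ S N)%nat with (2 ^ N + 2 ^ N)%nat by (simpl; lia).
  rewrite rsum_split, <- !rsum_scal. f_equal; apply rsum_ext; intros k hk; cbn [rprod].
  - rewrite testbit_top by auto. ring.
  - rewrite testbit_top_add by auto.
    rewrite (rprod_ext N _ (fun i => if Nat.testbit k i then 1 - x i else x i)); [ring|].
    intros i hi; now rewrite testbit_low_add.
Qed.

Lemma U_ext_x N u x y : (forall i, (i < N)%nat -> x i = y i) -> U N u x = U N u y.
Proof.
  intros h; apply rsum_ext; intros k _; f_equal; apply rprod_ext; intros i hi; now rewrite h.
Qed.

Lemma U_ext_u N u v x : (forall k, (k < 2 ^ N)%nat -> u k = v k) -> U N u x = U N v x.
Proof. intros h; apply rsum_ext; intros k hk; now rewrite h. Qed.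

Lemma U_multiaffine N u : multiaffine N (U N u).
Proof.
  split; [apply U_ext_x|].
  revert u; induction N; intros u i x y hi; [lia|].
  rewrite !U_S. destruct (Nat.eq_dec i N) as [->|ne].
  - rewrite !upd_same.
    assert (h : forall w v, U N w (upd x N v) = U N w x)
      by (intros; apply U_ext_x; intros; apply upd_other; lia).
    rewrite !h; ring.
  - rewrite !upd_other by auto.
    rewrite (IHN u i x y), (IHN _ i x y) by lia. ring.
Qed.

Lemma U_plus N u v x : U N (fun k => u k + v k) x = U N u x + U N v x.
Proof. unfold U; rewrite <- rsum_plus; apply rsum_ext; intros; ring. Qed.

Lemma U_minus N u v x : U N (fun k => u k - v k) x = U N u x - U N v x.
Proof. unfold U; rewrite <- rsum_minus; apply rsum_ext; intros; ring. Qed.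

Lemma U_scal N c u x : U N (fun k => c * u k) x = c * U N u x.
Proof. unfold U; rewrite <- rsum_scal; apply rsum_ext; intros; ring. Qed.

Lemma U_1 N x : U N (fun _ => 1) x = 1.
Proof.
  induction N; [unfold U; simpl; ring|].
  rewrite U_S, IHN; ring.
Qed.

Lemma U_bit N i x : (i < N)%nat -> U N (fun k => ind (Nat.testbit k i)) x = 1 - x i.
Proof.
  induction N; intros h; [lia|]. rewrite U_S.
  destruct (Nat.eq_dec i N) as [->|ne].
  - rewrite (U_ext_u N _ (fun _ => 0 * 1)), U_scal.
    2:{ intros k hk; rewrite testbit_top by auto; simpl; ring. }
    rewrite (U_ext_u N (fun k => ind (Nat.testbit (2 ^ N + k) N)) (fun _ => 1)), U_1.
    + ring.
    + intros k hk; now rewrite testbit_top_add.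
  - rewrite (U_ext_u N (fun k => ind (Nat.testbit (2 ^ N + k) i)) (fun k => ind (Nat.testbit k i))).
    + rewrite IHN by lia; ring.
    + intros k hk; now rewrite testbit_low_add by lia.
Qed.

(** One constant for all estimates: it bounds [U] on the cube, and each [pd] at most doubles the
    bound. *)
Definition umass (N : nat) (u : nat -> R) : R := l1 (2 ^ N) u.

Lemma umass_nonneg N u : 0 <= umass N u.
Proof. apply l1_nonneg. Qed.

Lemma U_bound N u x : in_Delta N x -> Rabs (U N u x) <= umass N u.
Proof.
  intros hx. eapply Rle_trans; [apply rsum_abs|].
  apply rsum_le; intros k hk. rewrite Rabs_mult.
  rewrite <- (Rmult_1_l (Rabs (u k))) at 2. apply Rmult_le_compat_r; [apply Rabs_pos|].
  assert (h : forall i, (i < N)%nat -> 0 <= (if Nat.testbit k i then 1 - x i else x i) <= 1).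
  { intros i hi; specialize (hx i hi); destruct Nat.testbit; lra. }
  rewrite Rabs_pos_eq by (apply rprod_nonneg; apply h).
  eapply Rle_trans; [apply (rprod_le N _ (fun _ => 1)); apply h|].
  rewrite rprod_1; auto; lra.
Qed.

Definition Dg (N : nat) (u : nat -> R) (i : nat) (x : nat -> R) : R := pd (U N u) i x.

Definition Hs (N : nat) (u : nat -> R) (i j : nat) (x : nat -> R) : R := pd (pd (U N u) i) j x.

Section Gradient.
Context (N : nat) (u : nat -> R).

Lemma Dg_bound i x : in_Delta N x -> Rabs (Dg N u i x) <= 2 * umass N u.
Proof. apply pd_bound; apply U_bound. Qed.

Lemma Hs_bound i j x : in_Delta N x -> Rabs (Hs N u i j x) <= 4 * umass N u.
Proof.
  intros hx; replace (4 * _) with (2 * (2 * umass N u)) by ring.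
  apply (pd_bound N); auto. intros; now apply Dg_bound.
Qed.

Lemma Hs_sym i j x : Hs N u i j x = Hs N u j i x.
Proof.
  unfold Hs. destruct (Nat.eq_dec i j) as [->|]; [auto|now apply pd_swap].
Qed.

Lemma Hs_diag i x : Hs N u i i x = 0.
Proof. apply pd_pd. Qed.

Lemma Dg_multiaffine i : (i < N)%nat -> multiaffine N (Dg N u i).
Proof. intros; apply multiaffine_pd; auto; apply U_multiaffine. Qed.

Lemma Hs_multiaffine i j : (i < N)%nat -> (j < N)%nat -> multiaffine N (Hs N u i j).
Proof. intros; apply multiaffine_pd; auto; now apply Dg_multiaffine. Qed.

Lemma Dg_lip i x y : (i < N)%nat -> in_Delta N x -> in_Delta N y ->
  Rabs (Dg N u i y - Dg N u i x) <= 4 * umass N u * l1 N (fun i => y i - x i).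
Proof.
  intros hi hx hy; replace (4 * _) with (2 * (2 * umass N u)) by ring.
  apply multiaffine_lip; auto using Dg_multiaffine, Dg_bound.
Qed.

Lemma Hs_lip i j x y : (i < N)%nat -> (j < N)%nat -> in_Delta N x -> in_Delta N y ->
  Rabs (Hs N u i j y - Hs N u i j x) <= 8 * umass N u * l1 N (fun i => y i - x i).
Proof.
  intros hi hj hx hy; replace (8 * _) with (2 * (4 * umass N u)) by ring.
  apply multiaffine_lip; auto using Hs_multiaffine, Hs_bound.
Qed.

Lemma U_taylor x y : in_Delta N x -> in_Delta N y ->
  Rabs (U N u y - U N u x - rsum N (fun j => Dg N u j x * (y j - x j)))
    <= 4 * umass N u * (l1 N (fun i => y i - x i) * l1 N (fun i => y i - x i)).
Proof. apply multiaffine_taylor; auto using U_multiaffine, U_bound. Qed.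

Lemma Dg_taylor i x y : (i < N)%nat -> in_Delta N x -> in_Delta N y ->
  Rabs (Dg N u i y - Dg N u i x - rsum N (fun j => Hs N u i j x * (y j - x j)))
    <= 8 * umass N u * (l1 N (fun i => y i - x i) * l1 N (fun i => y i - x i)).
Proof.
  intros hi hx hy; replace (8 * _) with (4 * (2 * umass N u)) by ring.
  apply (multiaffine_taylor N (Dg N u i)); auto using Dg_multiaffine, Dg_bound.
Qed.

End Gradient.

Lemma U_move N u i x y : (i < N)%nat -> U N u (upd x i y) = U N u x + (y - x i) * Dg N u i x.
Proof.
  intros hi. pose proof (multiaffine_upd N (U N u) i x y (x i) (U_multiaffine N u) hi) as h.
  rewrite upd_id in h. unfold Dg; lra.
Qed.

Lemma Dg_minus_u N u v i x : Dg N u i x - Dg N v i x = Dg N (fun k => u k - v k) i x.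
Proof. unfold Dg, pd; rewrite !U_minus; ring. Qed.

Lemma Hs_minus_u N u v i j x : Hs N u i j x - Hs N v i j x = Hs N (fun k => u k - v k) i j x.
Proof. unfold Hs, pd; rewrite !U_minus; ring. Qed.

Lemma umass_le N u c : (forall k, (k < 2 ^ N)%nat -> Rabs (u k) <= c) -> umass N u <= INR (2 ^ N) * c.
Proof. intros h; now apply rsum_le_const. Qed.

(** * The logistic function *)

Definition sigma (t : R) : R := / (1 + exp (- t)).

Lemma sigma_bounds t : 0 < sigma t < 1.
Proof.
  unfold sigma. pose proof (exp_pos (- t)). split.
  - apply Rinv_0_lt_compat; lra.
  - apply Rlt_le_trans with (/ 1); [apply Rinv_lt_contravar|]; lra.
Qed.

Lemma sigma_opp t : sigma (- t) = 1 - sigma t.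
Proof.
  unfold sigma. rewrite Ropp_involutive, exp_Ropp. pose proof (exp_pos t). field; lra.
Qed.

Lemma sigma_incr s t : s <= t -> sigma s <= sigma t.
Proof.
  intros h; unfold sigma. pose proof (exp_pos (- t)).
  apply Rinv_le_contravar; [lra|].
  destruct h as [h| ->]; [|lra]. assert (exp (- t) < exp (- s)) by (apply exp_increasing; lra). lra.
Qed.

Lemma sigma_le_exp t : sigma t <= exp t.
Proof.
  unfold sigma. rewrite exp_Ropp. pose proof (exp_pos t).
  replace (/ (1 + / exp t)) with (exp t * / (1 + exp t)) by (field; lra).
  apply Rle_trans with (exp t * / 1); [|lra]. apply Rmult_le_compat_l; [lra|].
  apply Rinv_le_contravar; lra.
Qed.

Definition dsigma (t : R) : R := sigma t * (1 - sigma t).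

Lemma dsigma_bounds t : 0 < dsigma t <= 1 / 4.
Proof.
  unfold dsigma; pose proof (sigma_bounds t). pose proof (Rle_0_sqr (sigma t - 1 / 2)) as h.
  unfold Rsqr in h; split; nra.
Qed.

Lemma dsigma_opp t : dsigma (- t) = dsigma t.
Proof. unfold dsigma; rewrite sigma_opp; ring. Qed.

(** A player with a clear preference barely reacts: this decay makes pure players negligible in [K],
    and makes the best response a contraction near a strict equilibrium although its slope carries a
    factor [1 / lam]. *)
Lemma dsigma_le_exp t : dsigma t <= exp (- Rabs t).
Proof.
  unfold Rabs; destruct Rcase_abs.
  - rewrite Ropp_involutive. unfold dsigma. pose proof (sigma_bounds t); pose proof (sigma_le_exp t); nra.
  - rewrite <- dsigma_opp. unfold dsigma. pose proof (sigma_bounds (- t)); pose proof (sigma_le_exp (- t)); nra.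
Qed.

Lemma is_derive_sigma t : is_derive sigma t (dsigma t).
Proof.
  unfold dsigma, sigma. pose proof (exp_pos (- t)).
  auto_derive; [lra|]. field; lra.
Qed.

Lemma sigma_mvt s t : exists c, Rmin s t <= c <= Rmax s t /\ sigma t - sigma s = dsigma c * (t - s).
Proof.
  destruct (MVT_gen sigma s t dsigma) as [c hc].
  - intros; apply is_derive_sigma.
  - intros x _; apply continuity_pt_filterlim.
    apply (ex_derive_continuous (V := R_NormedModule) sigma x). eexists; apply is_derive_sigma.
  - exists c; exact hc.
Qed.

Lemma sigma_lip s t : Rabs (sigma t - sigma s) <= Rabs (t - s).
Proof.
  destruct (sigma_mvt s t) as [c [_ ->]]. rewrite Rabs_mult.
  pose proof (dsigma_bounds c). rewrite (Rabs_pos_eq (dsigma c)) by lra.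
  pose proof (Rabs_pos (t - s)); nra.
Qed.

Lemma dsigma_lip s t : Rabs (dsigma t - dsigma s) <= Rabs (t - s).
Proof.
  unfold dsigma.
  replace (_ - _) with ((sigma t - sigma s) * (1 - sigma s - sigma t)) by ring.
  rewrite Rabs_mult. pose proof (sigma_lip s t). pose proof (Rabs_pos (sigma t - sigma s)).
  pose proof (sigma_bounds s); pose proof (sigma_bounds t).
  assert (Rabs (1 - sigma s - sigma t) <= 1) by (apply Rabs_le; lra).
  pose proof (Rabs_pos (1 - sigma s - sigma t)). nra.
Qed.

Lemma sigma_taylor s t : Rabs (sigma t - sigma s - dsigma s * (t - s)) <= (t - s) * (t - s).
Proof.
  destruct (sigma_mvt s t) as [c [hc ->]].
  replace (_ - _) with ((dsigma c - dsigma s) * (t - s)) by ring.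
  rewrite Rabs_mult. pose proof (dsigma_lip s c).
  assert (h : Rabs (c - s) <= Rabs (t - s)).
  { revert hc; unfold Rmin, Rmax, Rabs.
    destruct (Rle_dec s t); repeat destruct Rcase_abs; lra. }
  assert (e : Rabs (t - s) * Rabs (t - s) = (t - s) * (t - s)).
  { rewrite <- Rabs_mult; apply Rabs_pos_eq, Rle_0_sqr. }
  rewrite <- e. apply Rmult_le_compat_r; [apply Rabs_pos|lra].
Qed.

Definition logit (x : R) : R := ln (x / (1 - x)).

Lemma logit_sigma t : logit (sigma t) = t.
Proof.
  unfold logit. pose proof (exp_pos t). pose proof (exp_pos (- t)).
  replace (sigma t / (1 - sigma t)) with (exp t); [apply ln_exp|].
  unfold sigma. rewrite exp_Ropp. field. split; lra.
Qed.

Lemma is_derive_logit x : 0 < x < 1 -> is_derive logit x (/ (x * (1 - x))).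
Proof.
  intros hx; unfold logit. auto_derive.
  - repeat split; try lra. apply Rdiv_lt_0_compat; lra.
  - field. lra.
Qed.

(** * Logit best responses and empirical distributions *)

Lemma BR_sigma N u lam i x : lam <> 0 -> BR N u lam i x = sigma (Dg N u i x / lam).
Proof.
  intros hl. unfold BR, sigma, Dg, pd.
  set (a := U N u (upd x i 1)). set (b := U N u (upd x i 0)).
  replace (- ((a - b) / lam)) with (b / lam + - (a / lam)) by (field; auto).
  rewrite exp_plus, exp_Ropp.
  pose proof (exp_pos (a / lam)). pose proof (exp_pos (b / lam)). field. lra.
Qed.

Lemma BR_ext N u lam i x y : (forall j, (j < N)%nat -> x j = y j) -> BR N u lam i x = BR N u lam i y.
Proof.
  intros h. unfold BR.
  assert (e : forall v, U N u (upd x i v) = U N u (upd y i v)).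
  { intros v; apply U_ext_x; intros j hj; unfold upd; destruct (Nat.eqb j i); auto. }
  now rewrite !e.
Qed.

Lemma BR_bounds N u lam i x : 0 < BR N u lam i x < 1.
Proof.
  unfold BR. set (a := exp _). set (b := exp (U N u (upd x i 0) / lam)).
  assert (0 < a) by apply exp_pos. assert (0 < b) by apply exp_pos. split.
  - apply Rdiv_lt_0_compat; lra.
  - apply Rmult_lt_reg_r with (a + b); [lra|]. unfold Rdiv; rewrite Rmult_assoc, Rinv_l; lra.
Qed.

(** Payoff gaps never exceed [2 * umass N u], so every action keeps a probability of at least
    [1 - BRmax] on the whole cube. *)
Definition BRmax (N : nat) (u : nat -> R) (lam : R) : R := sigma (2 * umass N u / lam).

Lemma BR_in_range N u lam i x : 0 < lam -> in_Delta N x ->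
  1 - BRmax N u lam <= BR N u lam i x <= BRmax N u lam.
Proof.
  intros hl hx. rewrite BR_sigma by lra. unfold BRmax. rewrite <- sigma_opp.
  pose proof (Dg_bound N u i x hx) as h. apply Rabs_le_between in h.
  assert (0 < / lam) by now apply Rinv_0_lt_compat.
  split; apply sigma_incr; unfold Rdiv; nra.
Qed.

Lemma ind_bounds b : 0 <= ind b <= 1.
Proof. destruct b; simpl; lra. Qed.

Lemma emp_in_Delta N a0 w n : in_Delta N (emp a0 w n).
Proof.
  intros i _. destruct n as [|n]; simpl emp; [apply ind_bounds|].
  assert (0 < INR (S n)) by (apply lt_0_INR; lia).
  change (0 <= / INR (S n) * rsum (S n) (fun s => ind (w (S s) i)) <= 1).
  assert (0 < / INR (S n)) by now apply Rinv_0_lt_compat.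
  assert (0 <= rsum (S n) (fun s => ind (w (S s) i)))
    by (apply rsum_nonneg; intros; apply ind_bounds).
  assert (rsum (S n) (fun s => ind (w (S s) i)) <= INR (S n) * 1)
    by (apply rsum_le_const; intros; apply ind_bounds).
  split; [nra|]. apply Rmult_le_reg_l with (INR (S n)); auto.
  rewrite <- Rmult_assoc, Rinv_r; lra.
Qed.

Lemma emp_ext a0 w w' n i : (forall s, (1 <= s <= n)%nat -> w s i = w' s i) ->
  emp a0 w n i = emp a0 w' n i.
Proof.
  intros h. destruct n as [|n]; [reflexivity|]. unfold emp. f_equal.
  apply rsum_ext; intros s hs; rewrite h; auto; lia.
Qed.

Lemma emp_S a0 w n i :
  emp a0 w (S n) i = emp a0 w n i + / INR (S n) * (ind (w (S n) i) - emp a0 w n i).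
Proof.
  destruct n as [|n].
  (* At [n = 0] the step size is 1: the first move discards [a0] entirely. *)
  - unfold emp; simpl. field.
  - unfold emp. cbn [rsum]. rewrite (S_INR (S n)).
    assert (0 < INR (S n)) by (apply lt_0_INR; lia). field. lra.
Qed.

Definition setp {T : Type} (w : nat -> T) (n : nat) (a : T) : nat -> T :=
  fun s => if Nat.eqb s n then a else w s.

Lemma setp_same {T : Type} (w : nat -> T) n a : setp w n a n = a.
Proof. unfold setp; now rewrite Nat.eqb_refl. Qed.

Lemma setp_other {T : Type} (w : nat -> T) n a s : s <> n -> setp w n a s = w s.
Proof. intros h; unfold setp; destruct (Nat.eqb_spec s n); [contradiction|auto]. Qed.

Lemma emp_setp a0 w n m a i : (n < m)%nat -> emp a0 (setp w m a) n i = emp a0 w n i.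
Proof. intros h; apply emp_ext; intros s hs; rewrite setp_other; auto; lia. Qed.

Lemma emp_setp_S a0 w n a i :
  emp a0 (setp w (S n) a) (S n) i = emp a0 w n i + / INR (S n) * (ind (a i) - emp a0 w n i).
Proof. now rewrite emp_S, setp_same, emp_setp by lia. Qed.

(** * Covers by countably many weighted sets *)

Section Covers.
Context {X Y : Type} (wt : X -> R) (mem : Y -> X -> Prop).

Definition wsum (l : list X) : R := fold_right (fun c s => wt c + s) 0 l.

(** Common to the two notions of null set: cells are cylinders weighted by probability, or boxes
    weighted by volume. A sequence of finite lists, rather than of cells, fits covers built in
    stages, such as the first passages at each depth of the tree of histories; [covered_sequence]
    flattens it. *)
Definition covered (A : Y -> Prop) (d : R) : Prop :=
  exists L : nat -> list X,
    (forall J, rsum J (fun j => wsum (L j)) <= d) /\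
    (forall y, A y -> exists j c, In c (L j) /\ mem y c).

Definition negligible (A : Y -> Prop) : Prop := forall eps, 0 < eps -> covered A eps.

Lemma wsum_app l l' : wsum (l ++ l') = wsum l + wsum l'.
Proof. unfold wsum. induction l; simpl; lra. Qed.

Context (wt_nonneg : forall c, 0 <= wt c).

Lemma wsum_nonneg l : 0 <= wsum l.
Proof. unfold wsum. induction l as [|c l IH]; simpl; [lra|]. specialize (wt_nonneg c); lra. Qed.

Lemma covered_mono (A B : Y -> Prop) d d' :
  (forall y, A y -> B y) -> d <= d' -> covered B d -> covered A d'.
Proof.
  intros hAB hd [L [h1 h2]]; exists L; split; auto.
  intros J; specialize (h1 J); lra.
Qed.

Lemma rsum_antidiagonal J (a : nat -> nat -> R) :
  rsum J (fun j => rsum (S j) (fun i => a i (j - i)%nat)) =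
  rsum J (fun i => rsum (J - i) (fun b => a i b)).
Proof.
  induction J; [reflexivity|].
  change (rsum J (fun j => rsum (S j) (fun i => a i (j - i)%nat)) + rsum (S J) (fun i => a i (J - i)%nat) =
    rsum (S J) (fun i => rsum (S J - i) (fun b => a i b))).
  rewrite IHJ.
  change (rsum (S J) (fun i => rsum (S J - i) (fun b => a i b))) with
    (rsum J (fun i => rsum (S J - i) (fun b => a i b)) + rsum (S J - J) (fun b => a J b)).
  replace (S J - J)%nat with 1%nat by lia.
  rewrite (rsum_ext J (fun i => rsum (S J - i) (fun b => a i b))
             (fun i => rsum (J - i) (fun b => a i b) + a i (J - i)%nat)).
  - rewrite rsum_plus. cbn [rsum]. rewrite Nat.sub_diag. ring.
  - intros i hi. replace (S J - i)%nat with (S (J - i)) by lia. reflexivity.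
Qed.

Fixpoint diag_lists (L : nat -> nat -> list X) (j n : nat) : list X :=
  match n with O => nil | S m => diag_lists L j m ++ L m (j - m)%nat end.

Lemma diag_lists_wsum L j n : wsum (diag_lists L j n) = rsum n (fun i => wsum (L i (j - i)%nat)).
Proof. induction n; simpl; [reflexivity|]. rewrite wsum_app; lra. Qed.

Lemma diag_lists_in L j n i c : (i < n)%nat -> In c (L i (j - i)%nat) -> In c (diag_lists L j n).
Proof.
  induction n; intros hi h; [lia|]. simpl. apply in_or_app.
  destruct (Nat.eq_dec i n) as [->|]; [now right|left; apply IHn; auto; lia].
Qed.

(** Countable subadditivity. The covers are merged along antidiagonals, so each stage meets finitely
    many lists, and the weight of the first [J] stages is a sum of partial sums of the given
    covers. *)
Lemma covered_Union (A : nat -> Y -> Prop) (d : nat -> R) s :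
  (forall n, covered (A n) (d n)) -> (forall J, rsum J d <= s) ->
  covered (fun y => exists n, A n y) s.
Proof.
  intros h hs.
  pose (L := fun n => proj1_sig (constructive_indefinite_description _ (h n))).
  assert (hL : forall n, (forall J, rsum J (fun j => wsum (L n j)) <= d n) /\
    (forall y, A n y -> exists j c, In c (L n j) /\ mem y c)).
  { intros n; unfold L; now destruct constructive_indefinite_description. }
  exists (fun j => diag_lists L j (S j)); split.
  - intros J. rewrite (rsum_ext J _ (fun j => rsum (S j) (fun i => wsum (L i (j - i)%nat)))).
    2:{ intros; apply diag_lists_wsum. }
    rewrite (rsum_antidiagonal J (fun i b => wsum (L i b))).
    eapply Rle_trans; [|apply (hs J)]. apply rsum_le; intros i hi. apply (proj1 (hL i)).
  - intros y [n hy]. destruct (proj2 (hL n) y hy) as [j [c [hc hm]]].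
    exists (n + j)%nat, c; split; auto.
    apply (diag_lists_in L _ _ n); [lia|]. now replace (n + j - n)%nat with j by lia.
Qed.

Lemma rsum_geometric eps J : 0 < eps -> rsum J (fun j => eps / 2 ^ S j) <= eps.
Proof.
  intros he. assert (h : rsum J (fun j => eps / 2 ^ S j) = eps - eps / 2 ^ J).
  { induction J; [simpl; field|]. cbn [rsum]. rewrite IHJ. simpl.
    assert (0 < 2 ^ J) by (apply pow_lt; lra). field; lra. }
  rewrite h. assert (0 < eps / 2 ^ J) by (apply Rdiv_lt_0_compat; [lra|apply pow_lt; lra]). lra.
Qed.

Lemma negligible_Union (A : nat -> Y -> Prop) :
  (forall n, negligible (A n)) -> negligible (fun y => exists n, A n y).
Proof.
  intros h eps he. apply covered_Union with (fun n => eps / 2 ^ S n).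
  - intros n; apply h. apply Rdiv_lt_0_compat; [lra|apply pow_lt; lra].
  - intros J; now apply rsum_geometric.
Qed.

Lemma negligible_mono (A B : Y -> Prop) :
  (forall y, A y -> B y) -> negligible B -> negligible A.
Proof. intros h hB eps he; apply covered_mono with B eps; auto; lra. Qed.

Lemma negligible_union (A B : Y -> Prop) :
  negligible A -> negligible B -> negligible (fun y => A y \/ B y).
Proof.
  intros hA hB.
  apply negligible_mono with (fun y => exists n : nat, (match n with O => A | _ => B end) y).
  - intros y [h|h]; [exists O|exists 1%nat]; auto.
  - apply negligible_Union; intros [|n]; auto.
Qed.

Lemma negligible_empty (A : Y -> Prop) : (forall y, ~ A y) -> negligible A.
Proof.
  intros h eps he; exists (fun _ => nil); split.
  - intros J. rewrite rsum_0; [lra|auto].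
  - intros y hy; now destruct (h y).
Qed.

Fixpoint prefix (L : nat -> list X) (J : nat) : list X :=
  match J with O => nil | S j => prefix L j ++ L j end.

Lemma prefix_wsum L J : wsum (prefix L J) = rsum J (fun j => wsum (L j)).
Proof. induction J; simpl; [reflexivity|]. rewrite wsum_app; lra. Qed.

Lemma prefix_length L J : (forall j, L j <> nil) -> (J <= length (prefix L J))%nat.
Proof.
  intros h; induction J; simpl; [lia|]. rewrite length_app.
  specialize (h J); destruct (L J); [contradiction|simpl; lia].
Qed.

Lemma prefix_nth L J K t x : (J <= K)%nat -> (t < length (prefix L J))%nat ->
  nth t (prefix L K) x = nth t (prefix L J) x.
Proof.
  intros hJ ht; induction hJ; auto. simpl.
  rewrite app_nth1; auto.
  clear IHhJ. induction hJ; auto. simpl; rewrite length_app; lia.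
Qed.

Lemma rsum_nth_le l x n : (n <= length l)%nat -> rsum n (fun t => wt (nth t l x)) <= wsum l.
Proof.
  revert n; induction l as [|c l IH]; intros n hn.
  - simpl in hn; replace n with O by lia; simpl; lra.
  - destruct n as [|n]; [simpl rsum; apply wsum_nonneg|].
    rewrite rsum_shift. simpl in *. specialize (IH n ltac:(lia)). unfold wsum in *; lra.
Qed.

(* The lists of a cover are padded with cells of tiny weight, so that their
   concatenation is an infinite sequence. *)
Lemma covered_sequence (small : forall e, 0 < e -> exists c, wt c <= e) A d e :
  0 < e -> covered A d -> exists s : nat -> X,
    (forall K, rsum K (fun t => wt (s t)) <= d + e) /\ (forall y, A y -> exists t, mem y (s t)).
Proof.
  intros he [L [h1 h2]].
  assert (hp : forall j, exists c, wt c <= e / 2 ^ S j).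
  { intros j; apply small, Rdiv_lt_0_compat; [lra|apply pow_lt; lra]. }
  pose (pad := fun j => proj1_sig (constructive_indefinite_description _ (hp j))).
  assert (hpad : forall j, wt (pad j) <= e / 2 ^ S j).
  { intros j; unfold pad; now destruct constructive_indefinite_description. }
  pose (M := fun j => pad j :: L j).
  assert (hM : forall j, M j <> nil) by discriminate.
  exists (fun t => nth t (prefix M (S t)) (pad O)); split.
  - intros K.
    rewrite (rsum_ext K _ (fun t => wt (nth t (prefix M K) (pad O)))).
    + eapply Rle_trans; [apply rsum_nth_le, prefix_length, hM|].
      rewrite prefix_wsum.
      rewrite (rsum_ext K _ (fun j => wt (pad j) + wsum (L j))) by reflexivity.
      rewrite rsum_plus.
      assert (rsum K (fun j => wt (pad j)) <= e).
      { eapply Rle_trans; [|apply (rsum_geometric e K he)]. apply rsum_le; auto. }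
      specialize (h1 K); lra.
    + intros t ht; f_equal; symmetry; apply prefix_nth; [lia|].
      apply Nat.lt_le_trans with (S t); [lia|apply prefix_length, hM].
  - intros y hy. destruct (h2 y hy) as [j [c [hc hm]]].
    assert (hin : In c (prefix M (S j))).
    { simpl; apply in_or_app; right; now right. }
    destruct (In_nth _ _ (pad O) hin) as [t [ht hn]].
    exists t. replace (nth t (prefix M (S t)) (pad O)) with c; auto.
    rewrite <- hn. destruct (Nat.le_ge_cases (S t) (S j)) as [l|l].
    + apply prefix_nth; auto. apply Nat.lt_le_trans with (S t); [lia|apply prefix_length, hM].
    + symmetry; apply prefix_nth; auto.
Qed.

End Covers.

(** * Expectation of a function of independent Bernoulli variables *)

(** Integrating out one player at a time makes moments of independent choices provable by induction;
    [Ex_lsum] gives the sum over profiles, which is what cylinder probabilities require. *)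
Fixpoint Ex (N : nat) (p : nat -> R) (G : (nat -> bool) -> R) : R :=
  match N with
  | O => G (fun _ => false)
  | S n => p n * Ex n p (fun a => G (setp a n true)) + (1 - p n) * Ex n p (fun a => G (setp a n false))
  end.

Fixpoint profiles (N : nat) : list (nat -> bool) :=
  match N with
  | O => (fun _ => false) :: nil
  | S n => map (fun a => setp a n true) (profiles n) ++ map (fun a => setp a n false) (profiles n)
  end.

Definition pwt (N : nat) (p : nat -> R) (a : nat -> bool) : R :=
  rprod N (fun i => if a i then p i else 1 - p i).

Definition lsum {T : Type} (G : T -> R) (l : list T) : R := fold_right (fun c s => G c + s) 0 l.

Lemma lsum_app {T : Type} (G : T -> R) l l' : lsum G (l ++ l') = lsum G l + lsum G l'.
Proof. unfold lsum. induction l; simpl; lra. Qed.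

Lemma lsum_map {T T' : Type} (G : T -> R) (h : T' -> T) l : lsum G (map h l) = lsum (fun c => G (h c)) l.
Proof. unfold lsum. induction l; simpl; lra. Qed.

Lemma lsum_scal {T : Type} (G : T -> R) c l : lsum (fun a => c * G a) l = c * lsum G l.
Proof. unfold lsum. induction l; simpl; lra. Qed.

Lemma lsum_ext {T : Type} (G G' : T -> R) l : (forall a, G a = G' a) -> lsum G l = lsum G' l.
Proof. intros h. unfold lsum. induction l; simpl; rewrite ?h; lra. Qed.

Lemma Ex_lsum N p G : lsum (fun a => pwt N p a * G a) (profiles N) = Ex N p G.
Proof.
  revert G; induction N; intros G; simpl.
  - unfold pwt, lsum; simpl; ring.
  - rewrite lsum_app, !lsum_map, <- !IHN, <- !lsum_scal.
    f_equal; apply lsum_ext; intros a; unfold pwt; simpl; rewrite setp_same;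
      rewrite (rprod_ext N _ (fun i => if a i then p i else 1 - p i)); try ring;
      intros i hi; rewrite setp_other; auto; lia.
Qed.

Lemma profiles_complete N (a : nat -> bool) :
  exists b, In b (profiles N) /\ forall i, (i < N)%nat -> b i = a i.
Proof.
  induction N; simpl.
  - exists (fun _ => false); split; [now left|lia].
  - destruct IHN as [b [hb e]]. exists (setp b N (a N)); split.
    + apply in_or_app. destruct (a N); [left|right]; apply in_map_iff; eauto.
    + intros i hi. destruct (Nat.eq_dec i N) as [->|]; [apply setp_same|].
      rewrite setp_other; auto; apply e; lia.
Qed.

Lemma Ex_ext N p G G' : (forall a, G a = G' a) -> Ex N p G = Ex N p G'.
Proof. intros h; f_equal; now extensionality a. Qed.

Lemma Ex_plus N p G G' : Ex N p (fun a => G a + G' a) = Ex N p G + Ex N p G'.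
Proof. revert G G'; induction N; intros; simpl; [auto|]. rewrite !IHN; ring. Qed.

Lemma Ex_scal N p c G : Ex N p (fun a => c * G a) = c * Ex N p G.
Proof. revert G; induction N; intros; simpl; [auto|]. rewrite !IHN; ring. Qed.

Lemma Ex_const N p c : Ex N p (fun _ => c) = c.
Proof. induction N; simpl; [auto|]. rewrite !IHN; ring. Qed.

Lemma Ex_minus N p G G' : Ex N p (fun a => G a - G' a) = Ex N p G - Ex N p G'.
Proof.
  rewrite (Ex_ext N p _ (fun a => G a + (-1) * G' a)) by (intros; ring).
  rewrite Ex_plus, Ex_scal; ring.
Qed.

Lemma Ex_rsum N p n G : Ex N p (fun a => rsum n (fun i => G i a)) = rsum n (fun i => Ex N p (G i)).
Proof. induction n; simpl; [apply Ex_const|]. rewrite <- IHn, <- Ex_plus; auto. Qed.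

Lemma Ex_le N p G G' : (forall i, (i < N)%nat -> 0 <= p i <= 1) ->
  (forall a, G a <= G' a) -> Ex N p G <= Ex N p G'.
Proof.
  revert G G'; induction N; intros G G' hp h; simpl; [auto|].
  assert (0 <= p N <= 1) by (apply hp; lia).
  apply Rplus_le_compat; apply Rmult_le_compat_l; try lra; apply IHN; auto.
Qed.

Lemma Ex_ind N p i : (i < N)%nat -> Ex N p (fun a => ind (a i)) = p i.
Proof.
  induction N; intros hi; [lia|]. simpl.
  destruct (Nat.eq_dec i N) as [->|ne].
  - rewrite (Ex_ext N p _ (fun _ => 1)), (Ex_ext N p (fun a => ind (setp a N false N)) (fun _ => 0)),
      !Ex_const; [ring| |]; intros; now rewrite setp_same.
  - rewrite (Ex_ext N p _ (fun a => ind (a i))),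
      (Ex_ext N p (fun a => ind (setp a N false i)) (fun a => ind (a i))), IHN;
      [ring|lia| |]; intros; now rewrite setp_other.
Qed.

Lemma Ex_ind2 N p i j : (i < N)%nat -> (j < N)%nat -> i <> j ->
  Ex N p (fun a => ind (a i) * ind (a j)) = p i * p j.
Proof.
  revert i j; assert (h : forall i j, (i < j)%nat -> (j < N)%nat ->
    Ex N p (fun a => ind (a i) * ind (a j)) = p i * p j).
  { induction N; intros i j hij hj; [lia|]. simpl.
    destruct (Nat.eq_dec j N) as [->|ne].
    - rewrite (Ex_ext N p _ (fun a => ind (a i))),
        (Ex_ext N p (fun a => ind (setp a N false i) * _) (fun _ => 0)), Ex_const, Ex_ind;
        [ring|lia| |]; intros; rewrite setp_same, setp_other by lia; simpl; ring.
    - rewrite (Ex_ext N p _ (fun a => ind (a i) * ind (a j))),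
        (Ex_ext N p (fun a => ind (setp a N false i) * _) (fun a => ind (a i) * ind (a j))), IHN;
        try lia; [ring| |]; intros; now rewrite !setp_other by lia. }
  intros i j hi hj ne. destruct (Nat.lt_ge_cases i j); [now apply h|].
  rewrite (Ex_ext N p _ (fun a => ind (a j) * ind (a i))) by (intros; ring).
  rewrite h by lia; ring.
Qed.

Lemma Ex_centered N p x i : (i < N)%nat -> Ex N p (fun a => ind (a i) - x i) = p i - x i.
Proof. intros hi. rewrite Ex_minus, Ex_const, Ex_ind; auto. Qed.

(** Independence removes the covariance of distinct players, and only the diagonal carries a
    variance. Hence the noise acts on a quadratic form through a weighted trace. *)
Lemma Ex_product N p x i j : (i < N)%nat -> (j < N)%nat ->
  Ex N p (fun a => (ind (a i) - x i) * (ind (a j) - x j)) =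
  (p i - x i) * (p j - x j) + (if Nat.eqb i j then p i * (1 - p i) else 0).
Proof.
  intros hi hj.
  rewrite (Ex_ext N p _ (fun a => ind (a i) * ind (a j) + (- x j * ind (a i) + (- x i * ind (a j) + x i * x j))))
    by (intros; ring).
  rewrite !Ex_plus, !Ex_scal, Ex_const, !Ex_ind by auto.
  destruct (Nat.eqb_spec i j) as [->|ne].
  - rewrite (Ex_ext N p _ (fun a => ind (a j))) by (intros a; destruct (a j); simpl; ring).
    rewrite Ex_ind by auto; ring.
  - rewrite Ex_ind2 by auto; ring.
Qed.

(** * The law of the process *)

Section Process.
Context (N : nat) (u : nat -> R) (lam : R) (a0 : nat -> bool).

Definition path := nat -> nat -> bool.

Definition agree (n : nat) (w w' : path) : Prop :=
  forall s, (1 <= s <= n)%nat -> forall i, (i < N)%nat -> w s i = w' s i.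

Definition adapted {T : Type} (f : nat -> path -> T) : Prop :=
  forall n w w', agree n w w' -> f n w = f n w'.

(** For a [G] that depends on the first [S n] profiles only, this is its conditional expectation
    given the first [n]. *)
Definition step (n : nat) (w : path) (G : path -> R) : R :=
  Ex N (fun i => BR N u lam i (emp a0 w n)) (fun a => G (setp w (S n) a)).

Definition cylmem (w : path) (c : path * nat) : Prop := in_cyl N (fst c) (snd c) w.
Definition cylwt (c : path * nat) : R := cyl_prob N u lam a0 (fst c) (snd c).

Lemma emp_agree n w w' i : agree n w w' -> (i < N)%nat -> emp a0 w n i = emp a0 w' n i.
Proof. intros h hi; apply emp_ext; auto. Qed.

Lemma agree_le m n w w' : (m <= n)%nat -> agree n w w' -> agree m w w'.
Proof. intros h1 h2 s hs; apply h2; lia. Qed.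

Lemma cylwt_nonneg c : 0 <= cylwt c.
Proof.
  apply rprod_nonneg; intros n _; apply rprod_nonneg; intros i _; cbv zeta.
  pose proof (BR_bounds N u lam i (emp a0 (fst c) n)). destruct (fst c (S n) i); lra.
Qed.

Lemma cyl_prob_setp w n a : cyl_prob N u lam a0 (setp w (S n) a) (S n) =
  cyl_prob N u lam a0 w n * pwt N (fun i => BR N u lam i (emp a0 w n)) a.
Proof.
  unfold cyl_prob. cbn [rprod]. f_equal.
  - apply rprod_ext; intros k hk; apply rprod_ext; intros i hi; cbv zeta.
    rewrite setp_other by lia.
    rewrite (BR_ext N u lam i (emp a0 (setp w (S n) a) k) (emp a0 w k)); auto.
    intros; apply emp_setp; lia.
  - apply rprod_ext; intros i hi; cbv zeta. rewrite setp_same.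
    rewrite (BR_ext N u lam i (emp a0 (setp w (S n) a) n) (emp a0 w n)); auto.
    intros; apply emp_setp; lia.
Qed.

Lemma step_le n w G G' : (forall a, G (setp w (S n) a) <= G' (setp w (S n) a)) ->
  step n w G <= step n w G'.
Proof.
  intros h; apply Ex_le; auto. intros i _. pose proof (BR_bounds N u lam i (emp a0 w n)); lra.
Qed.

(** * The maximal inequality on the tree of histories *)

Section MaximalInequality.
Context (f : nat -> path -> R) (Alive : nat -> path -> Prop).

(** First passages: the extensions of [w] to length [n + j] at which [f] reaches 1 for the first
    time, all earlier nodes being alive. A node that succeeds or dies has no descendants in the
    lists. *)
Fixpoint hits (j n : nat) (w : path) : list (path * nat) :=
  match j with
  | O => if excluded_middle_informative (1 <= f n w) then (w, n) :: nil else nil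
  | S j =>
      if excluded_middle_informative (1 <= f n w \/ ~ Alive n w) then nil
      else flat_map (fun a => hits j (S n) (setp w (S n) a)) (profiles N)
  end.

Context (f_nonneg : forall n w, 0 <= f n w).
Context (f_step : forall n w, Alive n w -> step n w (f (S n)) <= f n w).

Lemma wsum_flat_map {T : Type} (h : T -> list (path * nat)) l :
  wsum cylwt (flat_map h l) = lsum (fun a => wsum cylwt (h a)) l.
Proof. induction l; simpl; [reflexivity|]. rewrite wsum_app, IHl; reflexivity. Qed.

Lemma rsum_lsum {T : Type} J (h : nat -> T -> R) l :
  rsum J (fun j => lsum (h j) l) = lsum (fun a => rsum J (fun j => h j a)) l.
Proof.
  induction l as [|c l IH]; simpl; [now apply rsum_0|].
  now rewrite rsum_plus, IH.
Qed.

Lemma lsum_le {T : Type} (G G' : T -> R) l : (forall a, G a <= G' a) -> lsum G l <= lsum G' l.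
Proof. intros h; unfold lsum; induction l as [|c l IH]; simpl; [lra|]. specialize (h c); lra. Qed.

(** Optional stopping, by induction on the depth. At a first passage [f] is at least 1 and pays for
    the cylinder; at a live node the bounds of the children add up to the probability of the node
    times [step], which [f] dominates. *)
Lemma hits_weight J n w :
  rsum J (fun j => wsum cylwt (hits j n w)) <= cyl_prob N u lam a0 w n * f n w.
Proof.
  assert (hc : forall n w, 0 <= cyl_prob N u lam a0 w n) by (intros n' w'; apply (cylwt_nonneg (w', n'))).
  revert n w; induction J; intros n w.
  - simpl. apply Rmult_le_pos; auto.
  - rewrite rsum_shift. cbn [hits].
    destruct excluded_middle_informative as [h1|h1];
      destruct excluded_middle_informative as [h2|h2]; try tauto.
    + rewrite (rsum_0 J) by auto. simpl. unfold cylwt; simpl. specialize (hc n w). nra.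
    + rewrite (rsum_0 J) by auto. simpl. specialize (hc n w). specialize (f_nonneg n w). nra.
    + assert (ha : Alive n w) by (destruct (classic (Alive n w)); tauto).
      replace (wsum cylwt nil) with 0 by reflexivity. rewrite Rplus_0_l.
      rewrite (rsum_ext J _ (fun j => lsum (fun a => wsum cylwt (hits j (S n) (setp w (S n) a))) (profiles N)))
        by (intros; apply wsum_flat_map).
      rewrite rsum_lsum.
      eapply Rle_trans.
      { apply lsum_le with (G' := fun a => cyl_prob N u lam a0 w n *
          (pwt N (fun i => BR N u lam i (emp a0 w n)) a * f (S n) (setp w (S n) a))).
        intros a. rewrite <- Rmult_assoc, <- cyl_prob_setp. apply IHJ. }
      rewrite lsum_scal, Ex_lsum. apply Rmult_le_compat_l; auto.
      exact (f_step n w ha).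
Qed.

Context (f_adapted : adapted f) (Alive_adapted : adapted Alive).

Lemma hits_cover m : forall n w w', (n <= m)%nat -> agree n w w' -> 1 <= f m w' ->
  (forall k, (n <= k < m)%nat -> Alive k w') ->
  exists j c, In c (hits j n w) /\ cylmem w' c.
Proof.
  intros n w w' hnm. remember (m - n)%nat as d eqn:hd. revert n w hnm hd.
  induction d; intros n w hnm hd ag h1 hA.
  - replace m with n in * by lia. exists O, (w, n). simpl.
    destruct excluded_middle_informative as [h|h]; [|rewrite (f_adapted n w w' ag) in h; contradiction].
    split; [now left|]. intros s hs i hi; symmetry; apply ag; auto.
  - destruct (classic (1 <= f n w)) as [h|h].
    + exists O, (w, n). simpl. destruct excluded_middle_informative; [|contradiction].
      split; [now left|]. intros s hs i hi; symmetry; apply ag; auto.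
    + destruct (profiles_complete N (w' (S n))) as [b [hb e]].
      destruct (IHd (S n) (setp w (S n) b)) as [j [c [hc hm]]]; try lia; auto.
      { intros s hs i hi. destruct (Nat.eq_dec s (S n)) as [->|]; [rewrite setp_same; auto|].
        rewrite setp_other by auto; apply ag; auto; lia. }
      { intros k hk; apply hA; lia. }
      exists (S j), c; split; auto. cbn [hits].
      destruct excluded_middle_informative as [[h'|h']|_].
      * contradiction.
      * rewrite (Alive_adapted n w w' ag) in h'. destruct h'. apply hA; lia.
      * apply in_flat_map; eauto.
Qed.

End MaximalInequality.

Lemma maximal_inequality (f : nat -> path -> R) (Alive : nat -> path -> Prop) n0 d :
  0 <= d -> adapted f -> adapted Alive -> (forall n w, 0 <= f n w) ->
  (forall n w, (n0 <= n)%nat -> Alive n w -> step n w (f (S n)) <= f n w) ->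
  (forall w, f n0 w <= d) ->
  covered cylwt cylmem (fun w => exists m, (n0 <= m)%nat /\ 1 <= f m w /\
    forall k, (n0 <= k < m)%nat -> Alive k w) d.
Proof.
  intros hd fa Aa f0 fs fd.
  (* Freezing the process at the constant [d] before [n0] allows the tree to be rooted at the empty
     history, whose cylinder has probability 1. *)
  pose (f' := fun n w => if Nat.ltb n n0 then d else f n w).
  pose (A' := fun n w => (n < n0)%nat \/ Alive n w).
  assert (f'0 : forall n w, 0 <= f' n w) by (intros n w; unfold f'; destruct Nat.ltb; auto).
  assert (f'a : adapted f').
  { intros n w w' h; unfold f'; destruct Nat.ltb; [auto|now apply fa]. }
  assert (A'a : adapted A').
  { intros n w w' h; unfold A'. now rewrite (Aa n w w' h). }
  assert (f's : forall n w, A' n w -> step n w (f' (S n)) <= f' n w).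
  { intros n w hA. unfold f'. destruct (Nat.ltb_spec n n0) as [h|h].
    - apply Rle_trans with (step n w (fun _ => d)); [|unfold step; rewrite Ex_const; lra].
      apply step_le. intros a. destruct (Nat.ltb_spec (S n) n0); [lra|].
      replace (S n) with n0 by lia. apply fd.
    - destruct (Nat.ltb_spec (S n) n0); [lia|]. apply fs; auto. destruct hA; [lia|auto]. }
  pose (w0 := (fun _ _ => false) : path).
  exists (fun j => hits f' A' j O w0); split.
  - intros J. eapply Rle_trans; [apply hits_weight; auto|].
    unfold cyl_prob; simpl. unfold f'. destruct (Nat.ltb_spec 0 n0); [lra|].
    replace O with n0 by lia. specialize (fd w0). lra.
  - intros w [m [hm [h1 hA]]]. apply (hits_cover f' A') with m; auto.
    + lia.
    + intros s hs; lia.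
    + unfold f'. destruct (Nat.ltb_spec m n0); [lia|auto].
    + intros k hk. unfold A'. destruct (Nat.lt_ge_cases k n0); [now left|right; apply hA; lia].
Qed.

(** Provides the padding for [covered_sequence]: along the constant profile, a single player already
    multiplies the probability by at most [q < 1] at each step. *)
Lemma cylwt_small : (1 <= N)%nat -> 0 < lam -> forall e, 0 < e -> exists c, cylwt c <= e.
Proof.
  intros hN hl e he. set (q := BRmax N u lam).
  assert (hq : 0 < q < 1) by apply sigma_bounds.
  destruct (pow_lt_1_zero q ltac:(rewrite Rabs_pos_eq; lra) e he) as [m hm].
  exists ((fun _ _ => true), m). unfold cylwt; simpl.
  apply Rle_trans with (q ^ m).
  - rewrite <- rprod_const. apply rprod_le; intros n hn.
    split; [apply rprod_nonneg; intros i _; cbv zeta; apply Rlt_le, BR_bounds|].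
    destruct N as [|N']; [lia|]. cbn [rprod]. cbv zeta.
    rewrite <- (Rmult_1_l q). apply Rmult_le_compat.
    + apply rprod_nonneg; intros; apply Rlt_le, BR_bounds.
    + apply Rlt_le, BR_bounds.
    + rewrite <- (rprod_1 N' (fun _ => 1)) by auto. apply rprod_le; intros i _.
      pose proof (BR_bounds (S N') u lam i (emp a0 (fun _ _ => true) n)); lra.
    + apply (BR_in_range (S N')); auto using emp_in_Delta.
  - specialize (hm m (le_n m)). rewrite Rabs_pos_eq in hm; [lra|]. apply pow_le; lra.
Qed.

Lemma negligible_sfp_null A : (1 <= N)%nat -> 0 < lam ->
  negligible cylwt cylmem A -> sfp_null N u lam a0 A.
Proof.
  intros hN hl h eps he.
  destruct (covered_sequence cylwt cylmem cylwt_nonneg (cylwt_small hN hl) A (eps / 2) (eps / 2)) as [s [h1 h2]].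
  - lra.
  - apply h; lra.
  - exists (fun j => fst (s j)), (fun j => snd (s j)); split; auto.
    intros K; specialize (h1 K). unfold cylwt in h1; lra.
Qed.

End Process.

(** * Linearization of the logit field at a Nash distribution *)

Definition field (N : nat) (u : nat -> R) (lam : R) (x : nat -> R) (i : nat) : R := BR N u lam i x - x i.

(** The differential of [field] at a Nash distribution [z]: there the slope of the logistic function
    is [z i * (1 - z i)], since its value is [z i]. *)
Definition jac (N : nat) (u : nat -> R) (lam : R) (z e : nat -> R) (i : nat) : R :=
  z i * (1 - z i) / lam * rsum N (fun j => Hs N u i j z * e j) - e i.

Definition diff (x z : nat -> R) : nat -> R := fun i => x i - z i.

Lemma ND_interior N u lam z i : ND N u lam z -> (i < N)%nat -> 0 < z i < 1.
Proof. intros [_ h] hi. rewrite (h i hi). apply BR_bounds. Qed.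

Lemma l1_diff_le N x z : in_Delta N x -> in_Delta N z -> l1 N (diff x z) <= INR N.
Proof.
  intros hx hz. rewrite <- (Rmult_1_r (INR N)). apply rsum_le_const; intros i hi.
  specialize (hx i hi); specialize (hz i hi). apply Rabs_le; unfold diff; lra.
Qed.

Section Linearization.
Context (N : nat) (u : nat -> R) (lam : R) (hl : 0 < lam).

Lemma BR_lip i x y : (i < N)%nat -> in_Delta N x -> in_Delta N y ->
  Rabs (BR N u lam i x - BR N u lam i y) <= 4 * umass N u / lam * l1 N (diff x y).
Proof.
  intros hi hx hy. rewrite !BR_sigma by lra.
  eapply Rle_trans; [apply sigma_lip|].
  replace (_ - _) with (/ lam * (Dg N u i x - Dg N u i y)) by (field; lra).
  assert (0 < / lam) by now apply Rinv_0_lt_compat.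
  rewrite Rabs_mult, (Rabs_pos_eq (/ lam)) by lra.
  pose proof (Dg_lip N u i y x hi hy hx). unfold diff, Rdiv.
  apply Rle_trans with (/ lam * (4 * umass N u * l1 N (fun i => x i - y i))); [nra|lra].
Qed.

Lemma field_lip i x y : (i < N)%nat -> in_Delta N x -> in_Delta N y ->
  Rabs (field N u lam x i - field N u lam y i) <= (4 * umass N u / lam + 1) * l1 N (diff x y).
Proof.
  intros hi hx hy. pose proof (BR_lip i x y hi hx hy) as h.
  pose proof (abs_le_l1 N (diff x y) i hi) as h'. unfold diff at 1 in h'.
  unfold field. replace (_ - _) with
    ((BR N u lam i x - BR N u lam i y) + - (x i - y i)) by ring.
  eapply Rle_trans; [apply Rabs_triang|]. rewrite Rabs_Ropp. lra.
Qed.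

Context (z : nat -> R) (hz : ND N u lam z).

Lemma field_ND i : (i < N)%nat -> field N u lam z i = 0.
Proof. intros hi; unfold field. rewrite <- (proj2 hz i hi); ring. Qed.

Lemma field_linearization : exists C, 0 <= C /\ forall i x, (i < N)%nat -> in_Delta N x ->
  Rabs (field N u lam x i - jac N u lam z (diff x z) i) <= C * sqn N (diff x z).
Proof.
  set (m := umass N u). assert (hm : 0 <= m) by apply umass_nonneg.
  exists ((2 * m / lam + (4 * m / lam) * (4 * m / lam)) * INR N).
  assert (hil : 0 < / lam) by now apply Rinv_0_lt_compat.
  assert (h0 : 0 <= 2 * m / lam + 4 * m / lam * (4 * m / lam)).
  { unfold Rdiv. assert (0 <= m * / lam) by nra. nra. }
  split; [apply Rmult_le_pos; auto using pos_INR|].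
  intros i x hi hx.
  pose proof (Dg_taylor N u i z x hi (proj1 hz) hx) as ht.
  pose proof (Dg_lip N u i z x hi (proj1 hz) hx) as hlip.
  fold m in ht, hlip. change (fun i => x i - z i) with (diff x z) in ht, hlip.
  set (s := Dg N u i z / lam). set (t := Dg N u i x / lam).
  pose proof (sigma_taylor s t) as hs.
  assert (ez : dsigma s = z i * (1 - z i)).
  { unfold dsigma, s. rewrite <- BR_sigma by lra. now rewrite <- (proj2 hz i hi). }
  assert (eF : field N u lam x i - jac N u lam z (diff x z) i =
    (sigma t - sigma s - dsigma s * (t - s)) +
    dsigma s * (/ lam * (Dg N u i x - Dg N u i z - rsum N (fun j => Hs N u i j z * (x j - z j))))).
  { unfold field, jac. rewrite BR_sigma by lra. fold t.
    assert (ezi : z i = sigma s) by (unfold s; rewrite <- BR_sigma by lra; apply (proj2 hz i hi)).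
    rewrite ez. unfold diff at 2. rewrite ezi. unfold t, s, diff. field. lra. }
  rewrite eF. clear eF.
  pose proof (dsigma_bounds s) as hd. pose proof (l1_nonneg N (diff x z)) as hl1.
  pose proof (l1_sqr N (diff x z)) as hsq.
  assert (hts : (t - s) * (t - s) <= (4 * m / lam) * (4 * m / lam) * (l1 N (diff x z) * l1 N (diff x z))).
  { assert (Rabs (t - s) <= 4 * m / lam * l1 N (diff x z)).
    { replace (t - s) with (/ lam * (Dg N u i x - Dg N u i z)) by (unfold t, s; field; lra).
      rewrite Rabs_mult, (Rabs_pos_eq (/ lam)) by lra. unfold Rdiv. nra. }
    replace ((t - s) * (t - s)) with (Rabs (t - s) * Rabs (t - s))
      by apply Rabs_sqr.
    pose proof (Rabs_pos (t - s)). nra. }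
  assert (hb : Rabs (dsigma s * (/ lam * (Dg N u i x - Dg N u i z -
      rsum N (fun j => Hs N u i j z * (x j - z j))))) <= 2 * m / lam * (l1 N (diff x z) * l1 N (diff x z))).
  { rewrite !Rabs_mult, (Rabs_pos_eq (/ lam)), (Rabs_pos_eq (dsigma s)) by lra.
    set (r := Rabs (_ - rsum _ _)) in *. assert (0 <= r) by apply Rabs_pos.
    apply Rle_trans with (1 / 4 * (/ lam * (8 * m * (l1 N (diff x z) * l1 N (diff x z)))));
      [|unfold Rdiv; lra].
    apply Rmult_le_compat; try lra; [nra|]. apply Rmult_le_compat_l; lra. }
  eapply Rle_trans; [apply Rabs_triang|].
  apply Rle_trans with ((2 * m / lam + 4 * m / lam * (4 * m / lam)) * (l1 N (diff x z) * l1 N (diff x z)));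
    [lra|].
  rewrite Rmult_assoc. apply Rmult_le_compat_l; auto.
Qed.

End Linearization.

(** * Quadratic forms *)

Section Forms.
Context (N : nat) (B : nat -> nat -> R).

Definition bform (e e' : nat -> R) : R := rsum N (fun i => rsum N (fun j => B i j * (e i * e' j))).

Definition bmass : R := rsum N (fun i => rsum N (fun j => Rabs (B i j))).

Lemma bmass_nonneg : 0 <= bmass.
Proof. apply rsum_nonneg; intros; apply rsum_nonneg; intros; apply Rabs_pos. Qed.

Lemma bform_bound e e' : Rabs (bform e e') <= bmass * (l1 N e * l1 N e').
Proof.
  unfold bmass. rewrite Rmult_comm, <- rsum_scal.
  eapply Rle_trans; [apply rsum_abs|]. apply rsum_le; intros i hi.
  rewrite <- rsum_scal. eapply Rle_trans; [apply rsum_abs|]. apply rsum_le; intros j hj.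
  rewrite !Rabs_mult, Rmult_comm. apply Rmult_le_compat_r; [apply Rabs_pos|].
  apply Rmult_le_compat; try apply Rabs_pos; now apply abs_le_l1.
Qed.

Lemma bform_plus_r e f g : bform e (fun i => f i + g i) = bform e f + bform e g.
Proof.
  unfold bform; rewrite <- rsum_plus; apply rsum_ext; intros i _.
  rewrite <- rsum_plus; apply rsum_ext; intros; ring.
Qed.

Lemma bform_scal_r e c f : bform e (fun i => c * f i) = c * bform e f.
Proof.
  unfold bform; rewrite <- rsum_scal; apply rsum_ext; intros i _.
  rewrite <- rsum_scal; apply rsum_ext; intros; ring.
Qed.

Lemma bform_ext e e' f f' : (forall i, (i < N)%nat -> e i = e' i) ->
  (forall i, (i < N)%nat -> f i = f' i) -> bform e f = bform e' f'.
Proof.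
  intros h h'; apply rsum_ext; intros i hi; apply rsum_ext; intros j hj; now rewrite h, h'.
Qed.

Context (B_sym : forall i j, B i j = B j i).

Lemma bform_sym e e' : bform e e' = bform e' e.
Proof.
  unfold bform; rewrite rsum_swap; apply rsum_ext; intros i _; apply rsum_ext; intros j _.
  rewrite B_sym; ring.
Qed.

Lemma bform_quad e c y : bform (fun i => e i + c * y i) (fun i => e i + c * y i) =
  bform e e + (2 * c) * bform e y + (c * c) * bform y y.
Proof.
  rewrite bform_plus_r, bform_scal_r, !(bform_sym (fun i => e i + c * y i)),
    !bform_plus_r, !bform_scal_r, (bform_sym y e). ring.
Qed.

Lemma Ex_bform_r p e x :
  Ex N p (fun a => bform e (fun i => ind (a i) - x i)) = bform e (fun i => p i - x i).
Proof.
  unfold bform. rewrite Ex_rsum; apply rsum_ext; intros i hi.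
  rewrite Ex_rsum; apply rsum_ext; intros j hj.
  rewrite (Ex_ext N p _ (fun a => (B i j * e i) * (ind (a j) - x j))) by (intros; ring).
  rewrite Ex_scal, Ex_centered by auto; ring.
Qed.

Lemma Ex_bform p x :
  Ex N p (fun a => bform (fun i => ind (a i) - x i) (fun i => ind (a i) - x i)) =
  bform (fun i => p i - x i) (fun i => p i - x i) + rsum N (fun i => B i i * (p i * (1 - p i))).
Proof.
  unfold bform. rewrite Ex_rsum, <- rsum_plus; apply rsum_ext; intros i hi.
  rewrite Ex_rsum.
  rewrite <- (rsum_single N i (B i i * (p i * (1 - p i)))), <- rsum_plus by auto.
  apply rsum_ext; intros j hj. rewrite Ex_scal, Ex_product by auto.
  rewrite (Nat.eqb_sym j i). destruct (Nat.eqb_spec i j) as [->|]; ring.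
Qed.

End Forms.

(** Inverting [exp (- t) >= 1 - t] gives [exp t * (1 - t) <= 1], and the quadratic times [1 - t] is
    at least 1 up to [t = 1 / 2]. *)
Lemma exp_le_quadratic t : t <= 1 / 2 -> exp t <= 1 + t + 2 * (t * t).
Proof.
  intros h. pose proof (exp_ineq1_le (- t)) as h1. pose proof (exp_pos t) as h2.
  assert (h3 : exp t * exp (- t) = 1) by (rewrite <- exp_plus, Rplus_opp_r; apply exp_0).
  assert (h4 : exp t * (1 - t) <= 1) by nra.
  assert (h5 : 1 <= (1 + t + 2 * (t * t)) * (1 - t)).
  { assert (0 <= (t * t) * (1 - 2 * t)) by (apply Rmult_le_pos; [nra|lra]). nra. }
  apply Rmult_le_reg_r with (1 - t); lra.
Qed.

Lemma inv_le_quadratic Q d : 0 < Q -> Rabs d <= Q / 2 ->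
  / (Q + d) <= / Q - / (Q * Q) * d + 2 / (Q * Q * Q) * (d * d).
Proof.
  intros hQ hd. apply Rabs_le_between in hd.
  assert (hp : 0 < Q + d) by lra.
  apply Rmult_le_reg_l with ((Q + d) * (Q * Q * Q)).
  { apply Rmult_lt_0_compat; [lra|]. assert (0 < Q * Q) by nra. nra. }
  replace ((Q + d) * (Q * Q * Q) * / (Q + d)) with (Q * Q * Q) by (field; lra).
  replace ((Q + d) * (Q * Q * Q) * (/ Q - / (Q * Q) * d + 2 / (Q * Q * Q) * (d * d)))
    with (Q * Q * Q + (d * d) * (Q + 2 * d)) by (field; lra).
  assert (0 <= (d * d) * (Q + 2 * d)) by (apply Rmult_le_pos; [nra|lra]). lra.
Qed.

(** * One step of the process *)

Definition move (x : nat -> R) (g : R) (a : nat -> bool) : nat -> R := fun i => x i + g * (ind (a i) - x i).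

Lemma step_move N u lam a0 n w (G : (nat -> R) -> R) :
  (forall x y, (forall i, (i < N)%nat -> x i = y i) -> G x = G y) ->
  step N u lam a0 n w (fun w' => G (emp a0 w' (S n))) =
  Ex N (fun i => BR N u lam i (emp a0 w n)) (fun a => G (move (emp a0 w n) (/ INR (S n)) a)).
Proof.
  intros hG. apply Ex_ext; intros a. apply hG; intros i hi. apply emp_setp_S.
Qed.

Lemma inv_S_bounds n : 0 < / INR (S n) <= 1.
Proof.
  split; [apply Rinv_0_lt_compat, lt_0_INR; lia|].
  rewrite <- Rinv_1. apply Rinv_le_contravar; [lra|]. apply INR_ge_1; lia.
Qed.

(** * Non-convergence to a linearly unstable Nash distribution *)

Section Instability.
Context (N : nat) (u : nat -> R) (lam : R) (a0 : nat -> bool) (hl : 0 < lam).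
Context (z : nat -> R) (hz : ND N u lam z).
Context (B : nat -> nat -> R) (B_sym : forall i j, B i j = B j i).
Context (c0 : R) (hc0 : 0 < c0).
(** Three demands on [B], met below by [Bmat]: [Q] grows along the linearized field; so does [n Q],
    where passing from [n] to [n + 1] contributes one more [Q]; and the noise pushes [Q] upwards on
    average. *)
Context (hdrift : forall e, c0 * sqn N e <= 2 * bform N B e (jac N u lam z e)).
Context (hscaled : forall e, c0 * sqn N e <= 2 * bform N B e (jac N u lam z e) + bform N B e e).
Context (htrace : 0 < rsum N (fun i => B i i * (z i * (1 - z i)))).

Let Q (x : nat -> R) : R := bform N B (diff x z) (diff x z).

Definition near (r : R) (x : nat -> R) : Prop := forall i, (i < N)%nat -> Rabs (x i - z i) <= r.

Lemma near_l1 r x : near r x -> l1 N (diff x z) <= INR N * r.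
Proof. intros h; now apply rsum_le_const. Qed.

Lemma Q_move x g a : Q (move x g a) - Q x =
  2 * g * bform N B (diff x z) (fun i => ind (a i) - x i) +
  g * g * bform N B (fun i => ind (a i) - x i) (fun i => ind (a i) - x i).
Proof.
  unfold Q. rewrite (bform_ext N B (diff (move x g a) z)
    (fun i => diff x z i + g * (ind (a i) - x i)) (diff (move x g a) z)
    (fun i => diff x z i + g * (ind (a i) - x i))); try (intros; unfold diff, move; ring).
  rewrite (bform_quad N B B_sym (diff x z) g (fun i => ind (a i) - x i)). ring.
Qed.

Lemma Q_move_bound : exists C, 0 < C /\ forall x g a, in_Delta N x -> 0 <= g ->
  Rabs (Q (move x g a) - Q x) <= C * (g * (l1 N (diff x z) + g)).
Proof.
  exists (bmass N B * (2 * INR N + INR N * INR N) + 1).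
  pose proof (bmass_nonneg N B) as hb. pose proof (pos_INR N) as hN.
  assert (h0 : 0 <= bmass N B * (2 * INR N + INR N * INR N)) by (apply Rmult_le_pos; nra).
  split; [lra|]. intros x g a hx hg. rewrite Q_move.
  set (y := fun i => ind (a i) - x i).
  assert (hy : l1 N y <= INR N).
  { rewrite <- (Rmult_1_r (INR N)). apply rsum_le_const; intros i hi. unfold y.
    pose proof (ind_bounds (a i)); specialize (hx i hi). apply Rabs_le; lra. }
  pose proof (bform_bound N B (diff x z) y) as h1. pose proof (bform_bound N B y y) as h2.
  pose proof (l1_nonneg N (diff x z)) as h3. pose proof (l1_nonneg N y) as h4.
  set (d := l1 N (diff x z)) in *. set (m := bmass N B) in *. set (n := INR N) in *.
  assert (h1' : Rabs (bform N B (diff x z) y) <= m * (d * n)).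
  { eapply Rle_trans; [apply h1|]. apply Rmult_le_compat_l; [lra|]. nra. }
  assert (h2' : Rabs (bform N B y y) <= m * (n * n)).
  { eapply Rle_trans; [apply h2|]. apply Rmult_le_compat_l; [lra|]. nra. }
  eapply Rle_trans; [apply Rabs_triang|]. rewrite !Rabs_mult.
  rewrite (Rabs_pos_eq g), (Rabs_pos_eq 2) by lra.
  apply Rle_trans with (2 * g * (m * (d * n)) + g * g * (m * (n * n))).
  - apply Rplus_le_compat; apply Rmult_le_compat_l; auto; nra.
  - assert (0 <= g * d) by nra. assert (0 <= g * g) by nra.
    assert (0 <= m * n) by nra. assert (0 <= m * (n * n)) by (apply Rmult_le_pos; nra).
    assert (0 <= (m * n) * (g * g)) by nra.
    assert (0 <= (m * (n * n)) * (g * d)) by (apply Rmult_le_pos; auto).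
    replace ((m * (2 * n + n * n) + 1) * (g * (d + g))) with
      (2 * g * (m * (d * n)) + g * g * (m * (n * n)) + (m * (n * n)) * (g * d)
       + 2 * ((m * n) * (g * g)) + (g * d) + g * g) by ring. lra.
Qed.

Lemma Ex_Q_move x g : Ex N (fun i => BR N u lam i x) (fun a => Q (move x g a) - Q x) =
  2 * g * bform N B (diff x z) (field N u lam x) +
  g * g * (bform N B (field N u lam x) (field N u lam x) +
           rsum N (fun i => B i i * (BR N u lam i x * (1 - BR N u lam i x)))).
Proof.
  rewrite (Ex_ext N _ _ _ (fun a => Q_move x g a)), Ex_plus, !Ex_scal.
  rewrite Ex_bform_r, Ex_bform by auto. reflexivity.
Qed.

Let tau : R := rsum N (fun i => B i i * (z i * (1 - z i))).

(** The first estimate is the drift of [Q] in one step. The second is that of [n Q]: with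
    [n + 1 = / g], the mean of [(n + 1) Q' - n Q] is [Q + / g] times the mean of [Q' - Q]. *)
Lemma local_drift : exists r c, 0 < r /\ 0 < c /\ forall x g, in_Delta N x -> near r x -> 0 < g ->
  g * (c * (sqn N (diff x z) + g)) <= Ex N (fun i => BR N u lam i x) (fun a => Q (move x g a) - Q x) /\
  c * (sqn N (diff x z) + g) <=
    Q x + / g * Ex N (fun i => BR N u lam i x) (fun a => Q (move x g a) - Q x).
Proof.
  destruct (field_linearization N u lam hl z hz) as [C [hC hlin]].
  set (m := bmass N B). assert (hm : 0 <= m) by apply bmass_nonneg.
  set (k := 4 * umass N u / lam + 1).
  assert (hk : 1 <= k).
  { unfold k. assert (0 <= umass N u / lam) by (apply Rdiv_le_0_compat; auto; apply umass_nonneg).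
    unfold Rdiv in *; lra. }
  set (n := INR N). assert (hn : 0 <= n) by apply pos_INR.
  (* The first fraction keeps the linearization error below [c0 / 4 * sqn N e]; the second keeps the
     trace at the current best responses, together with [bform N B F F], within [tau / 2] of
     [tau]. *)
  pose (r := Rmin 1 (Rmin (c0 / (4 * (m * (n * n * C) + 1)))
                     (tau / (2 * (m * (n * k * n * (n * k * n)) + 2 * m * n * k + 1))))).
  assert (hp1 : 0 < 4 * (m * (n * n * C) + 1)).
  { assert (0 <= m * (n * n * C)) by (repeat apply Rmult_le_pos; auto). lra. }
  assert (hp2 : 0 < 2 * (m * (n * k * n * (n * k * n)) + 2 * m * n * k + 1)).
  { assert (0 <= m * (n * k * n * (n * k * n))) by (repeat apply Rmult_le_pos; lra).
    assert (0 <= 2 * m * n * k) by (repeat apply Rmult_le_pos; lra). lra. }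
  assert (hr : 0 < r) by (unfold r; repeat apply Rmin_glb_lt; try lra; now apply Rdiv_lt_0_compat).
  assert (hr1 : r <= 1) by apply Rmin_l.
  assert (hr2 : (m * (n * n * C)) * r <= c0 / 4).
  { assert (r <= c0 / (4 * (m * (n * n * C) + 1))) by (eapply Rle_trans; [apply Rmin_r|apply Rmin_l]).
    apply Rle_trans with ((m * (n * n * C) + 1) * r); [nra|].
    apply Rle_trans with ((m * (n * n * C) + 1) * (c0 / (4 * (m * (n * n * C) + 1)))).
    - apply Rmult_le_compat_l; lra.
    - right; field; lra. }
  assert (hr3 : (m * (n * k * n * (n * k * n)) + 2 * m * n * k) * r <= tau / 2).
  { assert (r <= tau / (2 * (m * (n * k * n * (n * k * n)) + 2 * m * n * k + 1)))
      by (eapply Rle_trans; [apply Rmin_r|apply Rmin_r]).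
    set (A := m * (n * k * n * (n * k * n)) + 2 * m * n * k) in *.
    apply Rle_trans with ((A + 1) * r); [nra|].
    apply Rle_trans with ((A + 1) * (tau / (2 * (A + 1)))).
    - apply Rmult_le_compat_l; lra.
    - right; field; lra. }
  exists r, (Rmin (c0 / 2) (tau / 2)).
  assert (htau : 0 < tau) by exact htrace.
  split; auto. split; [apply Rmin_glb_lt; lra|].
  intros x g hx hnear hg. rewrite Ex_Q_move.
  set (e := diff x z). set (F := field N u lam x).
  pose proof (near_l1 r x hnear) as hl1. fold e n in hl1.
  pose proof (l1_nonneg N e) as hl0. pose proof (sqn_nonneg N e) as hs0.
  assert (h1 : bform N B e F >= bform N B e (jac N u lam z e) - c0 / 4 * sqn N e).
  { rewrite (bform_ext N B e e F (fun i => jac N u lam z e i + (F i - jac N u lam z e i)))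
      by (intros; auto; ring).
    rewrite bform_plus_r.
    pose proof (bform_bound N B e (fun i => F i - jac N u lam z e i)) as hb. fold m in hb.
    assert (hR : l1 N (fun i => F i - jac N u lam z e i) <= n * (C * sqn N e)).
    { apply rsum_le_const; intros i hi; apply hlin; auto. }
    pose proof (l1_nonneg N (fun i => F i - jac N u lam z e i)) as hR0.
    assert (hb' : Rabs (bform N B e (fun i => F i - jac N u lam z e i)) <= c0 / 4 * sqn N e).
    { eapply Rle_trans; [apply hb|].
      apply Rle_trans with (m * ((n * r) * (n * (C * sqn N e)))).
      - apply Rmult_le_compat_l; auto. apply Rmult_le_compat; auto.
      - replace (m * ((n * r) * (n * (C * sqn N e)))) with ((m * (n * n * C)) * r * sqn N e) by ring.
        apply Rmult_le_compat_r; auto. }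
    apply Rabs_le_between in hb'. lra. }
  assert (hF : forall i, (i < N)%nat -> Rabs (F i) <= k * (n * r)).
  { intros i hi. replace (F i) with (field N u lam x i - field N u lam z i)
      by (rewrite (field_ND N u lam z hz i hi); unfold F; ring).
    eapply Rle_trans; [apply field_lip; auto; apply hz|]. fold k e. apply Rmult_le_compat_l; lra. }
  assert (hp : forall i, (i < N)%nat -> Rabs (BR N u lam i x - z i) <= k * (n * r)).
  { intros i hi. rewrite (proj2 hz i hi) at 1.
    eapply Rle_trans; [apply BR_lip; auto; apply hz|]. fold e.
    assert (4 * umass N u / lam <= k) by (unfold k; lra).
    assert (0 <= 4 * umass N u / lam) by (apply Rdiv_le_0_compat; auto; pose proof (umass_nonneg N u); lra).
    apply Rmult_le_compat; auto. }
  assert (h2 : tau / 2 <= bform N B F F + rsum N (fun i => B i i * (BR N u lam i x * (1 - BR N u lam i x)))).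
  { assert (hFF : Rabs (bform N B F F) <= m * (n * k * n * (n * k * n)) * r).
    { assert (l1 N F <= n * (k * (n * r))) by (now apply rsum_le_const).
      pose proof (l1_nonneg N F). eapply Rle_trans; [apply bform_bound|]. fold m.
      apply Rle_trans with (m * ((n * (k * (n * r))) * (n * k * n))).
      - apply Rmult_le_compat_l; auto. apply Rmult_le_compat; auto.
        eapply Rle_trans; [apply H|].
        replace (n * (k * (n * r))) with ((n * k * n) * r) by ring.
        rewrite <- (Rmult_1_r (n * k * n)) at 2. apply Rmult_le_compat_l; auto.
        repeat apply Rmult_le_pos; lra.
      - right; ring. }
    assert (hV : Rabs (rsum N (fun i => B i i * (BR N u lam i x * (1 - BR N u lam i x))) - tau)
                 <= m * (2 * (k * (n * r)))).
    { unfold tau. rewrite <- rsum_minus. eapply Rle_trans; [apply rsum_abs|].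
      unfold m, bmass. rewrite Rmult_comm, <- rsum_scal. apply rsum_le; intros i hi.
      replace (_ - _) with (B i i * ((BR N u lam i x - z i) * (1 - BR N u lam i x - z i))) by ring.
      rewrite !Rabs_mult, Rmult_comm.
      pose proof (BR_bounds N u lam i x). pose proof (proj1 hz i hi).
      apply Rmult_le_compat; try apply Rabs_pos.
      - apply Rmult_le_pos; apply Rabs_pos.
      - assert (Rabs (1 - BR N u lam i x - z i) <= 1) by (apply Rabs_le; lra).
        pose proof (hp i hi). pose proof (Rabs_pos (1 - BR N u lam i x - z i)).
        pose proof (Rabs_pos (BR N u lam i x - z i)). nra.
      - apply (rsum_ge_term N (fun j => Rabs (B i j))); auto; intros; apply Rabs_pos. }
    apply Rabs_le_between in hFF. apply Rabs_le_between in hV.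
    assert (m * (n * k * n * (n * k * n)) * r + m * (2 * (k * (n * r))) <= tau / 2) by lra. lra. }
  pose proof (hdrift e) as hd. pose proof (hscaled e) as hsc.
  set (c := Rmin (c0 / 2) (tau / 2)).
  assert (hc1 : c <= c0 / 2) by apply Rmin_l. assert (hc2 : c <= tau / 2) by apply Rmin_r.
  assert (hcs : c * sqn N e <= c0 / 2 * sqn N e) by (apply Rmult_le_compat_r; lra).
  set (T := bform N B F F + _) in *.
  assert (hgT : g * g * (tau / 2) <= g * g * T) by (apply Rmult_le_compat_l; nra).
  assert (hgc : g * g * c <= g * g * (tau / 2)) by (apply Rmult_le_compat_l; nra).
  split.
  - replace (g * (c * (sqn N e + g))) with (g * (c * sqn N e) + g * g * c) by ring.
    assert (g * (c * sqn N e) <= g * (2 * bform N B e F)) by (apply Rmult_le_compat_l; lra). lra.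
  - replace (/ g * (2 * g * bform N B e F + g * g * T)) with (2 * bform N B e F + g * T)
      by (field; lra).
    unfold Q. fold e. assert (g * c <= g * T) by nra. lra.
Qed.

Lemma sqn_le_N x : in_Delta N x -> sqn N (diff x z) <= INR N.
Proof.
  intros hx. rewrite <- (Rmult_1_r (INR N)). apply rsum_le_const; intros i hi.
  specialize (hx i hi). pose proof (proj1 hz i hi). unfold diff. nra.
Qed.

Lemma Q_bound x : Rabs (Q x) <= bmass N B * (INR N * sqn N (diff x z)).
Proof.
  eapply Rle_trans; [apply bform_bound|].
  apply Rmult_le_compat_l; [apply bmass_nonneg|apply l1_sqr].
Qed.

(** A product of order [n ^ b]. It accumulates the relative gain [b / n] left over at each step in
    [escape_time]; its divergence is that of the harmonic series. *)
Fixpoint growth (b : R) (n : nat) : R :=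
  match n with O => 1 | S m => growth b m * (1 + b * / INR (S m)) end.

Lemma growth_pos b n : 0 < b -> 0 < growth b n.
Proof.
  intros hb; induction n; cbn [growth]; [lra|]. apply Rmult_lt_0_compat; auto.
  assert (0 < / INR (S n)) by (apply Rinv_0_lt_compat, lt_0_INR; lia). nra.
Qed.

Lemma growth_mono b n m : 0 < b -> (n <= m)%nat -> growth b n <= growth b m.
Proof.
  intros hb; induction 1 as [|m h IH]; [lra|]. cbn [growth]. pose proof (growth_pos b m hb).
  assert (0 < / INR (S m)) by (apply Rinv_0_lt_compat, lt_0_INR; lia).
  assert (0 < growth b m * (b * / INR (S m))) by (repeat apply Rmult_lt_0_compat; auto). lra.
Qed.

Lemma harmonic_unbounded A : exists n, A <= rsum n (fun k => / INR (S k)).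
Proof.
  assert (h : forall p, INR p / 2 <= rsum (2 ^ p) (fun k => / INR (S k))).
  { induction p.
    - simpl. lra.
    - replace (2 ^ S p)%nat with (2 ^ p + 2 ^ p)%nat by (simpl; lia).
      rewrite rsum_split, S_INR.
      assert (h : rsum (2 ^ p) (fun _ => / INR (2 ^ p + 2 ^ p)) <=
                  rsum (2 ^ p) (fun i => / INR (S (2 ^ p + i)))).
      { apply rsum_le; intros i hi. apply Rinv_le_contravar; [apply lt_0_INR; lia|apply le_INR; lia]. }
      rewrite rsum_const, plus_INR in h.
      assert (0 < INR (2 ^ p)) by (apply lt_0_INR; assert (2 ^ p <> 0)%nat by (apply Nat.pow_nonzero; lia); lia).
      replace (INR (2 ^ p) * / (INR (2 ^ p) + INR (2 ^ p))) with (/ 2) in h by (field; lra). lra. }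
  destruct (INR_unbounded (2 * A)) as [p hp]. exists (2 ^ p)%nat. specialize (h p). lra.
Qed.

Lemma growth_unbounded b A : 0 < b -> exists n, A <= growth b n.
Proof.
  intros hb.
  assert (h : forall n, 1 + b * rsum n (fun k => / INR (S k)) <= growth b n).
  { induction n; cbn [growth rsum]; [lra|].
    assert (0 < / INR (S n)) by (apply Rinv_0_lt_compat, lt_0_INR; lia).
    assert (0 <= rsum n (fun k => / INR (S k)))
      by (apply rsum_nonneg; intros; apply Rlt_le, Rinv_0_lt_compat, lt_0_INR; lia).
    assert (0 <= b * rsum n (fun k => / INR (S k))) by nra.
    assert (1 * (b * / INR (S n)) <= growth b n * (b * / INR (S n)))
      by (apply Rmult_le_compat_r; nra). lra. }
  destruct (harmonic_unbounded (A / b)) as [n hn]. exists n. specialize (h n).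
  assert (b * (A / b) <= b * rsum n (fun k => / INR (S k))) by (apply Rmult_le_compat_l; lra).
  replace (b * (A / b)) with A in H by (field; lra). lra.
Qed.

Lemma Q_ext x y : (forall i, (i < N)%nat -> x i = y i) -> Q x = Q y.
Proof. intros h; apply bform_ext; intros i hi; unfold diff; now rewrite h. Qed.

Lemma Q_adapted n w w' : agree N n w w' -> Q (emp a0 w n) = Q (emp a0 w' n).
Proof. intros h; apply Q_ext; intros; now apply (emp_agree N). Qed.

Lemma near_adapted r n w w' : agree N n w w' -> near r (emp a0 w n) = near r (emp a0 w' n).
Proof.
  intros h. apply propositional_extensionality. unfold near.
  split; intros h' i hi; specialize (h' i hi);
    [rewrite <- (emp_agree N a0 n w w')|rewrite (emp_agree N a0 n w w')]; auto.
Qed.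

(* [n Q(x(n))] has drift at least of the order of its variance, so an exponential of it,
   multiplied by a slowly growing deterministic factor, is a supermartingale. *)
Lemma escape_time r c n0 C2 : 0 < c ->
  (forall x g, in_Delta N x -> near r x -> 0 < g -> c * (sqn N (diff x z) + g) <=
    Q x + / g * Ex N (fun i => BR N u lam i x) (fun a => Q (move x g a) - Q x)) ->
  negligible (cylwt N u lam a0) (cylmem N)
    (fun w => (forall k, (n0 <= k)%nat -> near r (emp a0 w k)) /\
              forall M, exists m, (M <= m)%nat /\ INR m * Q (emp a0 w m) <= C2).
Proof.
  intros hc hE.
  destruct Q_move_bound as [C [hC hQm]].
  set (m := bmass N B). assert (hm : 0 <= m) by apply bmass_nonneg.
  set (nn := INR N). assert (hnn : 0 <= nn) by apply pos_INR.
  set (K1 := m * (nn * nn) + C * (nn + 1)).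
  assert (hK1 : 0 <= K1).
  { unfold K1. assert (0 <= m * (nn * nn)) by (repeat apply Rmult_le_pos; lra).
    assert (0 <= C * (nn + 1)) by nra. lra. }
  set (K2 := 3 * (m * m * (nn * nn * nn) + C * C * nn + C * C)).
  assert (hK2 : 0 <= K2).
  { unfold K2. assert (0 <= m * m * (nn * nn * nn)) by (repeat apply Rmult_le_pos; lra).
    assert (0 <= C * C * nn) by (repeat apply Rmult_le_pos; lra). nra. }
  (* Two demands on the exponent: [th] times the increment is at most [1 / 2], as [exp_le_quadratic]
     requires, and the second order term costs at most half of the drift. The other half is the rate
     [b]. *)
  pose (th := Rmin (/ (2 * (K1 + 1))) (c / (4 * (K2 + 1)))).
  assert (hth : 0 < th).
  { unfold th; apply Rmin_glb_lt; [apply Rinv_0_lt_compat; lra|apply Rdiv_lt_0_compat; lra]. }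
  assert (hth1 : th * K1 <= 1 / 2).
  { apply Rle_trans with (/ (2 * (K1 + 1)) * (K1 + 1)); [|right; field; lra].
    apply Rmult_le_compat; try lra. apply Rmin_l. }
  assert (hth2 : 2 * (th * th) * K2 <= th * (c / 2)).
  { replace (2 * (th * th) * K2) with (th * (2 * (th * K2))) by ring.
    apply Rmult_le_compat_l; [lra|].
    assert (th * K2 <= c / (4 * (K2 + 1)) * (K2 + 1)).
    { apply Rmult_le_compat; try lra. apply Rmin_r. }
    replace (c / (4 * (K2 + 1)) * (K2 + 1)) with (c / 4) in H by (field; lra). lra. }
  set (b := th * (c / 2)). assert (hb : 0 < b) by (unfold b; nra).
  assert (hstep : forall n x, in_Delta N x -> near r x ->
    Ex N (fun i => BR N u lam i x)
      (fun a => exp (- th * (INR (S n) * Q (move x (/ INR (S n)) a) - C2))) * (1 + b * / INR (S n))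
    <= exp (- th * (INR n * Q x - C2))).
  { intros n x hx hnear. set (g := / INR (S n)).
    assert (hg : 0 < g <= 1) by apply inv_S_bounds.
    assert (hS : INR (S n) = / g) by (unfold g; rewrite Rinv_inv; auto).
    assert (hn : INR n = / g - 1) by (rewrite <- hS, S_INR; ring).
    (* As [n + 1 = / g], this is the increment of [n Q]. Its square is bounded by a multiple of
       [s + g], the very scale of its drift. *)
    set (X := fun a => Q x + / g * (Q (move x g a) - Q x)).
    set (d := l1 N (diff x z)). set (s := sqn N (diff x z)).
    assert (hd0 : 0 <= d) by apply l1_nonneg. assert (hs0 : 0 <= s) by apply sqn_nonneg.
    assert (hdn : d <= nn) by (apply l1_diff_le; auto; apply hz).
    assert (hds : d * d <= nn * s) by apply l1_sqr.
    assert (hsn : s <= nn) by now apply sqn_le_N.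
    assert (hXa : forall a, Rabs (X a) <= m * (nn * s) + C * d + C * g).
    { intros a. unfold X. eapply Rle_trans; [apply Rabs_triang|].
      pose proof (Q_bound x) as h1. fold m nn s in h1.
      rewrite Rabs_mult, (Rabs_pos_eq (/ g)) by (apply Rlt_le, Rinv_0_lt_compat; lra).
      assert (h2 : / g * Rabs (Q (move x g a) - Q x) <= / g * (C * (g * (d + g)))).
      { apply Rmult_le_compat_l; [apply Rlt_le, Rinv_0_lt_compat; lra|]. apply hQm; auto; lra. }
      replace (/ g * (C * (g * (d + g)))) with (C * d + C * g) in h2 by (field; lra). lra. }
    assert (hX1 : forall a, Rabs (X a) <= K1).
    { intros a. eapply Rle_trans; [apply hXa|]. unfold K1.
      assert (m * (nn * s) <= m * (nn * nn)) by (apply Rmult_le_compat_l; auto; nra).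
      assert (C * d <= C * nn) by nra. assert (C * g <= C * 1) by nra. lra. }
    assert (hX2 : forall a, X a * X a <= K2 * (s + g)).
    { intros a. replace (X a * X a) with (Rabs (X a) * Rabs (X a))
        by apply Rabs_sqr.
      set (p := m * (nn * s)). set (q := C * d). set (t := C * g).
      assert (hp : 0 <= p) by (unfold p; repeat apply Rmult_le_pos; lra).
      assert (hq : 0 <= q) by (unfold q; nra). assert (ht : 0 <= t) by (unfold t; nra).
      apply Rle_trans with (3 * (p * p + q * q + t * t)).
      - pose proof (hXa a) as h. fold p q t in h. pose proof (Rabs_pos (X a)).
        apply Rle_trans with ((p + q + t) * (p + q + t)); [nra|].
        pose proof (Rle_0_sqr (p - q)). pose proof (Rle_0_sqr (p - t)). pose proof (Rle_0_sqr (q - t)).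
        unfold Rsqr in *. nra.
      - assert (p * p <= m * m * (nn * nn * nn) * s).
        { unfold p. replace (m * (nn * s) * (m * (nn * s))) with (m * m * (nn * nn) * s * s) by ring.
          replace (m * m * (nn * nn * nn) * s) with (m * m * (nn * nn) * s * nn) by ring.
          apply Rmult_le_compat_l; auto. repeat apply Rmult_le_pos; lra. }
        assert (q * q <= C * C * nn * s).
        { unfold q. replace (C * d * (C * d)) with (C * C * (d * d)) by ring.
          rewrite !Rmult_assoc. apply Rmult_le_compat_l; [lra|]. apply Rmult_le_compat_l; lra. }
        assert (t * t <= C * C * g).
        { unfold t. replace (C * g * (C * g)) with (C * C * g * g) by ring.
          rewrite <- (Rmult_1_r (C * C * g)) at 2. apply Rmult_le_compat_l; [|lra].
          repeat apply Rmult_le_pos; lra. }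
        assert (0 <= m * m * (nn * nn * nn)) by (repeat apply Rmult_le_pos; lra).
        assert (0 <= C * C * nn) by (repeat apply Rmult_le_pos; lra).
        assert (0 <= C * C) by nra.
        unfold K2. nra. }
    set (p := fun i => BR N u lam i x).
    assert (hp : forall i, (i < N)%nat -> 0 <= p i <= 1)
      by (intros i _; pose proof (BR_bounds N u lam i x); unfold p; lra).
    assert (hEX : c * (s + g) <= Ex N p X).
    { unfold X. rewrite Ex_plus, Ex_scal, Ex_const. apply hE; auto; lra. }
    rewrite (Ex_ext N p _ (fun a => exp (- th * (INR n * Q x - C2)) * exp (- th * X a))).
    2:{ intros a. rewrite <- exp_plus. f_equal. unfold X. rewrite hS, hn. ring. }
    rewrite Ex_scal, Rmult_assoc.
    rewrite <- (Rmult_1_r (exp (- th * (INR n * Q x - C2)))) at 2.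
    apply Rmult_le_compat_l; [apply Rlt_le, exp_pos|].
    assert (hexp : Ex N p (fun a => exp (- th * X a)) <= 1 - b * g).
    { eapply Rle_trans.
      { apply Ex_le with (G' := fun a => 1 + (- th) * X a + 2 * (th * th) * (K2 * (s + g))); auto.
        intros a. assert (ha : Rabs (th * X a) <= 1 / 2).
        { rewrite Rabs_mult, (Rabs_pos_eq th) by lra.
          eapply Rle_trans; [apply Rmult_le_compat_l; [lra|apply hX1]|lra]. }
        apply Rabs_le_between in ha.
        eapply Rle_trans; [apply exp_le_quadratic; lra|].
        replace (2 * (- th * X a * (- th * X a))) with (2 * (th * th) * (X a * X a)) by ring.
        assert (2 * (th * th) * (X a * X a) <= 2 * (th * th) * (K2 * (s + g)))
          by (apply Rmult_le_compat_l; [nra|auto]). lra. }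
      rewrite !Ex_plus, !Ex_const, Ex_scal.
      assert (- th * Ex N p X <= - th * (c * (s + g))) by nra.
      assert (2 * (th * th) * (K2 * (s + g)) <= th * (c / 2) * (s + g)).
      { rewrite <- Rmult_assoc. apply Rmult_le_compat_r; lra. }
      assert (0 <= th * (c / 2) * s) by (fold b; nra).
      unfold b. lra. }
    assert (0 <= b * g) by nra. fold p. nra. }
  intros eps heps.
  pose (S0 := exp (th * (INR n0 * (m * (nn * nn)) + C2))).
  assert (hS0 : 0 < S0) by apply exp_pos.
  (* [S0] bounds the exponential at time [n0]. Normalized at [M], the growth factor is at least 1
     from [M] on, and at most [eps / S0] at time [n0]. *)
  destruct (growth_unbounded b (S0 * growth b n0 / eps) hb) as [M' hM'].
  set (M := Nat.max M' n0).
  assert (hM : S0 * growth b n0 / eps <= growth b M).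
  { eapply Rle_trans; [apply hM'|apply growth_mono; auto; apply Nat.le_max_l]. }
  pose proof (growth_pos b M hb) as hgM.
  pose (f := fun n w => exp (- th * (INR n * Q (emp a0 w n) - C2)) * (growth b n / growth b M)).
  pose (Alive := fun (n : nat) (w : path) => near r (emp a0 w n)).
  apply covered_mono with (fun w => exists k, (n0 <= k)%nat /\ 1 <= f k w /\
    forall j, (n0 <= j < k)%nat -> Alive j w) eps.
  { intros w [h1 h2]. destruct (h2 M) as [k [hk hk']]. exists k.
    assert (hn0 : (n0 <= k)%nat) by (unfold M in hk; lia).
    split; auto. split; [|intros j hj; apply h1; lia].
    unfold f. rewrite <- (Rmult_1_r 1). apply Rmult_le_compat; try lra.
    - rewrite <- exp_0. destruct (Rle_lt_or_eq_dec (INR k * Q (emp a0 w k)) C2 hk') as [h|h].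
      + apply Rlt_le, exp_increasing. nra.
      + right; f_equal. rewrite h. ring.
    - apply Rmult_le_reg_r with (growth b M); auto. unfold Rdiv.
      rewrite Rmult_assoc, Rinv_l, Rmult_1_l, Rmult_1_r by lra. now apply growth_mono. }
  { lra. }
  apply (maximal_inequality N u lam a0 f Alive n0 eps); try lra.
  - intros n w w' h. unfold f. now rewrite (Q_adapted n w w' h).
  - intros n w w' h. now apply near_adapted.
  - intros n w. unfold f. apply Rlt_le, Rmult_lt_0_compat; [apply exp_pos|].
    apply Rdiv_lt_0_compat; auto. now apply growth_pos.
  - intros n w hn hA. unfold f.
    eapply Rle_trans.
    { right. apply (step_move N u lam a0 n w (fun x => exp (- th * (INR (S n) * Q x - C2)) * (growth b (S n) / growth b M))).
      intros x y h; now rewrite (Q_ext x y h). }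
    rewrite (Ex_ext N _ _ (fun a => (growth b n / growth b M * (1 + b * / INR (S n))) *
      exp (- th * (INR (S n) * Q (move (emp a0 w n) (/ INR (S n)) a) - C2)))).
    2:{ intros a. change (growth b (S n)) with (growth b n * (1 + b * / INR (S n))).
      unfold Rdiv; ring. }
    rewrite Ex_scal. pose proof (growth_pos b n hb).
    assert (0 < growth b n / growth b M) by now apply Rdiv_lt_0_compat.
    pose proof (hstep n (emp a0 w n) (emp_in_Delta N a0 w n) hA) as h.
    apply Rle_trans with (growth b n / growth b M * exp (- th * (INR n * Q (emp a0 w n) - C2))); [|lra].
    rewrite Rmult_assoc. apply Rmult_le_compat_l; lra.
  - intros w. unfold f.
    apply Rle_trans with (S0 * (growth b n0 / growth b M)).
    + apply Rmult_le_compat_r.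
      { apply Rlt_le, Rdiv_lt_0_compat; auto; now apply growth_pos. }
      unfold S0.
      assert (hq : - (m * (nn * nn)) <= Q (emp a0 w n0)).
      { pose proof (Q_bound (emp a0 w n0)) as h. fold m nn in h.
        pose proof (sqn_le_N (emp a0 w n0) (emp_in_Delta N a0 w n0)) as h'. fold nn in h'.
        assert (m * (nn * sqn N (diff (emp a0 w n0) z)) <= m * (nn * nn)).
        { apply Rmult_le_compat_l; auto. apply Rmult_le_compat_l; auto. }
        apply Rabs_le_between in h. lra. }
      pose proof (pos_INR n0).
      assert (H0 : - th * (INR n0 * Q (emp a0 w n0) - C2) <= th * (INR n0 * (m * (nn * nn)) + C2)).
      { assert (INR n0 * - (m * (nn * nn)) <= INR n0 * Q (emp a0 w n0)) by (apply Rmult_le_compat_l; auto).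
        replace (- th * (INR n0 * Q (emp a0 w n0) - C2)) with (th * (C2 - INR n0 * Q (emp a0 w n0))) by ring.
        apply Rmult_le_compat_l; lra. }
      destruct H0 as [H0| ->]; [apply Rlt_le, exp_increasing; auto|lra].
    + apply Rmult_le_reg_r with (growth b M / eps); [apply Rdiv_lt_0_compat; auto|].
      replace (eps * (growth b M / eps)) with (growth b M) by (field; lra).
      replace (S0 * (growth b n0 / growth b M) * (growth b M / eps)) with (S0 * growth b n0 / eps) by (field; lra).
      auto.
Qed.

(* While [n Q(x(n))] stays above a threshold, [1 / Q(x(n))] is a supermartingale, so [Q(x(n))] cannot tend to 0. *)
Lemma no_return r c : 0 < c ->
  (forall x g, in_Delta N x -> near r x -> 0 < g -> g * (c * (sqn N (diff x z) + g)) <=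
    Ex N (fun i => BR N u lam i x) (fun a => Q (move x g a) - Q x)) ->
  exists C2, 0 < C2 /\ forall M, (1 <= M)%nat ->
  negligible (cylwt N u lam a0) (cylmem N)
    (fun w => (forall k, (M <= k)%nat -> near r (emp a0 w k) /\ C2 <= INR k * Q (emp a0 w k)) /\
              forall q, 0 < q -> exists m, (M <= m)%nat /\ Q (emp a0 w m) <= q).
Proof.
  intros hc hE.
  destruct Q_move_bound as [C [hC hQm]].
  set (nn := INR N). assert (hnn : 0 <= nn) by apply pos_INR.
  set (K := 2 * (C * C) * (nn + 1)). assert (hK : 0 < K) by (unfold K; nra).
  (* The first term makes one step move [Q] by at most half of itself, as [inv_le_quadratic]
     requires; the second makes the drift of [Q] outweigh the quadratic term. *)
  exists (2 * C * (nn + 1) + 2 * K / c).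
  assert (hKc : 0 < 2 * K / c) by (apply Rdiv_lt_0_compat; lra).
  assert (hCn : 0 < 2 * C * (nn + 1)) by nra.
  set (C2 := 2 * C * (nn + 1) + 2 * K / c). split; [unfold C2; lra|].
  assert (hC2 : 0 < C2) by (unfold C2; lra).
  assert (hstep : forall n x, (1 <= n)%nat -> in_Delta N x -> near r x -> C2 <= INR n * Q x ->
    (forall a, 0 < Q (move x (/ INR (S n)) a)) /\
    Ex N (fun i => BR N u lam i x) (fun a => / Q (move x (/ INR (S n)) a)) <= / Q x).
  { intros n x hn1 hx hnear hQ. set (g := / INR (S n)).
    assert (hg : 0 < g <= 1) by apply inv_S_bounds.
    assert (hnp : 0 < INR n) by (apply lt_0_INR; lia).
    assert (hgn : g * INR n <= 1).
    { unfold g. apply Rmult_le_reg_l with (INR (S n)); [apply lt_0_INR; lia|].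
      rewrite <- Rmult_assoc, Rinv_r, S_INR by (apply not_0_INR; lia). lra. }
    assert (hQ0 : 0 < Q x).
    { apply Rmult_lt_reg_l with (INR n); auto. lra. }
    assert (hQg : C2 * g <= Q x).
    { apply Rle_trans with (INR n * Q x * g); [apply Rmult_le_compat_r; lra|].
      replace (INR n * Q x * g) with (Q x * (g * INR n)) by ring. nra. }
    set (d := l1 N (diff x z)). set (s := sqn N (diff x z)).
    assert (hd0 : 0 <= d) by apply l1_nonneg. assert (hs0 : 0 <= s) by apply sqn_nonneg.
    assert (hdn : d <= nn) by (apply l1_diff_le; auto; apply hz).
    assert (hds : d * d <= nn * s) by apply l1_sqr.
    set (D := fun a => Q (move x g a) - Q x).
    assert (hD : forall a, Rabs (D a) <= C * (g * (d + g))) by (intros a; apply hQm; auto; lra).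
    assert (hD1 : forall a, Rabs (D a) <= Q x / 2).
    { intros a. eapply Rle_trans; [apply hD|].
      apply Rle_trans with (C * (g * (nn + 1))).
      - apply Rmult_le_compat_l; [lra|]. apply Rmult_le_compat_l; lra.
      - assert (2 * C * (nn + 1) * g <= C2 * g) by (apply Rmult_le_compat_r; unfold C2; lra). lra. }
    assert (hD2 : forall a, D a * D a <= K * (g * g * (s + g))).
    { intros a. replace (D a * D a) with (Rabs (D a) * Rabs (D a))
        by apply Rabs_sqr.
      pose proof (Rabs_pos (D a)). pose proof (hD a).
      apply Rle_trans with (C * (g * (d + g)) * (C * (g * (d + g)))).
      { apply Rmult_le_compat; auto. }
      replace (C * (g * (d + g)) * (C * (g * (d + g)))) with ((C * C) * (g * g) * ((d + g) * (d + g))) by ring.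
      replace (K * (g * g * (s + g))) with ((C * C) * (g * g) * (2 * (nn + 1) * (s + g))) by (unfold K; ring).
      apply Rmult_le_compat_l; [nra|].
      pose proof (Rle_0_sqr (d - g)) as h; unfold Rsqr in h. nra. }
    split.
    - intros a. specialize (hD1 a). apply Rabs_le_between in hD1. unfold D in hD1. lra.
    - set (p := fun i => BR N u lam i x).
      assert (hp : forall i, (i < N)%nat -> 0 <= p i <= 1)
        by (intros i _; pose proof (BR_bounds N u lam i x); unfold p; lra).
      assert (hED : g * (c * (s + g)) <= Ex N p D) by (apply hE; auto; lra).
      eapply Rle_trans.
      { apply Ex_le with (G' := fun a => / Q x + (- / (Q x * Q x)) * D a
          + 2 / (Q x * Q x * Q x) * (K * (g * g * (s + g)))); auto.
        intros a. replace (Q (move x g a)) with (Q x + D a) by (unfold D; ring).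
        eapply Rle_trans; [apply inv_le_quadratic; auto|].
        assert (0 < 2 / (Q x * Q x * Q x)) by (apply Rdiv_lt_0_compat; [lra|repeat apply Rmult_lt_0_compat; auto]).
        assert (2 / (Q x * Q x * Q x) * (D a * D a) <= 2 / (Q x * Q x * Q x) * (K * (g * g * (s + g))))
          by (apply Rmult_le_compat_l; auto; lra). lra. }
      rewrite !Ex_plus, !Ex_const, Ex_scal.
      assert (hi : 0 < / (Q x * Q x * Q x)) by (apply Rinv_0_lt_compat; repeat apply Rmult_lt_0_compat; auto).
      assert (hmain : 2 * (K * (g * g * (s + g))) <= Q x * Ex N p D).
      { apply Rle_trans with ((2 * K / c * g) * (g * (c * (s + g)))).
        - right; field; lra.
        - apply Rmult_le_compat; auto.
          + apply Rmult_le_pos; lra.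
          + repeat apply Rmult_le_pos; lra.
          + apply Rle_trans with (C2 * g); auto. apply Rmult_le_compat_r; unfold C2; lra. }
      replace (/ Q x + - / (Q x * Q x) * Ex N p D + 2 / (Q x * Q x * Q x) * (K * (g * g * (s + g))))
        with (/ Q x + / (Q x * Q x * Q x) * (2 * (K * (g * g * (s + g))) - Q x * Ex N p D)) by (field; lra).
      nra. }
  intros M hM eps heps.
  assert (hMp : 0 < INR M) by (apply lt_0_INR; lia).
  pose (q := eps * C2 / (2 * INR M)). assert (hq : 0 < q) by (apply Rdiv_lt_0_compat; [nra|lra]).
  (* The floor keeps [f] positive where [Q] is not. On live histories [Q] is at least [C2 / n],
     above the floor, so [f] is [q / Q] there. At time [M] the floor is [C2 / (2 M)], and [q] is
     chosen to make [f] at most [eps]. *)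
  pose (f := fun n w => q / Rmax (Q (emp a0 w n)) (C2 / (INR n + INR M))).
  pose (Alive := fun (n : nat) (w : path) => near r (emp a0 w n) /\ C2 <= INR n * Q (emp a0 w n)).
  assert (hden : forall n y, 0 < Rmax y (C2 / (INR n + INR M))).
  { intros n y. eapply Rlt_le_trans; [|apply Rmax_r]. apply Rdiv_lt_0_compat; auto.
    pose proof (pos_INR n); lra. }
  assert (hAQ : forall n w, (1 <= n)%nat -> Alive n w -> Rmax (Q (emp a0 w n)) (C2 / (INR n + INR M)) = Q (emp a0 w n)).
  { intros n w hn [_ h]. apply Rmax_left.
    assert (0 < INR n) by (apply lt_0_INR; lia).
    apply Rle_trans with (C2 / INR n).
    - apply Rmult_le_compat_l; [lra|]. apply Rinv_le_contravar; lra.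
    - apply Rmult_le_reg_l with (INR n); auto. replace (INR n * (C2 / INR n)) with C2 by (field; lra). auto. }
  apply covered_mono with (fun w => exists k, (M <= k)%nat /\ 1 <= f k w /\
    forall j, (M <= j < k)%nat -> Alive j w) eps; [| lra |].
  { intros w [h1 h2]. destruct (h2 q hq) as [k [hk hk']]. exists k. split; auto.
    split; [|intros j hj; apply h1; lia].
    unfold f. rewrite hAQ; [|lia|apply h1; auto].
    assert (hQp : 0 < Q (emp a0 w k)).
    { destruct (h1 k hk) as [_ h]. assert (0 < INR k) by (apply lt_0_INR; lia).
      apply Rmult_lt_reg_l with (INR k); auto. lra. }
    apply Rmult_le_reg_r with (Q (emp a0 w k)); auto.
    unfold Rdiv; rewrite Rmult_assoc, Rinv_l; lra. }
  apply (maximal_inequality N u lam a0 f Alive M eps); try lra.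
  - intros n w w' h. unfold f. now rewrite (Q_adapted n w w' h).
  - intros n w w' h. unfold Alive. now rewrite (near_adapted r n w w' h), (Q_adapted n w w' h).
  - intros n w. unfold f. apply Rlt_le, Rdiv_lt_0_compat; auto.
  - intros n w hn hA. unfold f.
    rewrite (hAQ n w) by (auto; lia).
    eapply Rle_trans.
    { right. apply (step_move N u lam a0 n w (fun x => q / Rmax (Q x) (C2 / (INR (S n) + INR M)))).
      intros x y h; now rewrite (Q_ext x y h). }
    destruct hA as [hA1 hA2].
    destruct (hstep n (emp a0 w n) ltac:(lia) (emp_in_Delta N a0 w n) hA1 hA2) as [hpos hE1].
    apply Rle_trans with (q * / Q (emp a0 w n)); [|unfold Rdiv; lra].
    eapply Rle_trans; [|apply Rmult_le_compat_l; [lra|apply hE1]].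
    rewrite <- Ex_scal. apply Ex_le.
    + intros i _. pose proof (BR_bounds N u lam i (emp a0 w n)); lra.
    + intros a. apply Rmult_le_compat_l; [lra|]. apply Rinv_le_contravar; [apply hpos|apply Rmax_l].
  - intros w. unfold f. apply Rle_trans with (q / (C2 / (INR M + INR M))).
    + apply Rmult_le_compat_l; [lra|]. apply Rinv_le_contravar; [|apply Rmax_r].
      apply Rdiv_lt_0_compat; lra.
    + right; unfold q; field; lra.
Qed.

(** A path converging to [z] either has [n Q] below the threshold infinitely often, against
    [escape_time], or has it eventually above while [Q] tends to 0, against [no_return]. *)
Lemma unstable_not_limit :
  negligible (cylwt N u lam a0) (cylmem N) (fun w => converges_to N (emp a0 w) z).
Proof.
  destruct local_drift as [r [c [hr [hc hE]]]].
  destruct (no_return r c hc) as [C2 [hC2 hno]].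
  { intros x g hx hn hg; now apply hE. }
  apply negligible_mono with (fun w =>
    (exists n0, (forall k, (n0 <= k)%nat -> near r (emp a0 w k)) /\
              forall M, exists m, (M <= m)%nat /\ INR m * Q (emp a0 w m) <= C2) \/
    (exists M, (forall k, (S M <= k)%nat -> near r (emp a0 w k) /\ C2 <= INR k * Q (emp a0 w k)) /\
              forall q, 0 < q -> exists m, (S M <= m)%nat /\ Q (emp a0 w m) <= q)).
  - intros w hw. destruct (hw r hr) as [n0 hn0].
    assert (hnear : forall k, (n0 <= k)%nat -> near r (emp a0 w k)).
    { intros k hk i hi. apply Rlt_le, hn0; auto. }
    destruct (classic (forall M, exists m, (M <= m)%nat /\ INR m * Q (emp a0 w m) <= C2)) as [h|h].
    + left. exists n0; auto.
    + right. apply not_all_ex_not in h. destruct h as [M hM].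
      exists (Nat.max M n0). split.
      * intros k hk. split; [apply hnear; lia|].
        apply Rnot_lt_le. intros hlt. apply hM. exists k. split; [lia|lra].
      * intros q hq.
        set (K := bmass N B * (INR N * INR N) + 1).
        assert (hK : 0 < K).
        { pose proof (bmass_nonneg N B). pose proof (pos_INR N). unfold K.
          assert (0 <= bmass N B * (INR N * INR N)) by (repeat apply Rmult_le_pos; auto). lra. }
        set (e := Rmin 1 (q / K)).
        assert (he : 0 < e) by (unfold e; apply Rmin_glb_lt; [lra|now apply Rdiv_lt_0_compat]).
        destruct (hw e he) as [n1 hn1].
        exists (Nat.max n1 (S (Nat.max M n0))). split; [lia|].
        set (x := emp a0 w (Nat.max n1 (S (Nat.max M n0)))).
        assert (hx : forall i, (i < N)%nat -> Rabs (x i - z i) <= e).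
        { intros i hi. apply Rlt_le, hn1; auto; lia. }
        eapply Rle_trans; [apply Rle_abs|]. eapply Rle_trans; [apply Q_bound|].
        assert (hs : sqn N (diff x z) <= INR N * e).
        { apply rsum_le_const; intros i hi. specialize (hx i hi). unfold diff.
          assert (e <= 1) by apply Rmin_l. apply Rabs_le_between in hx. nra. }
        apply Rle_trans with (K * e).
        { unfold K. rewrite Rmult_plus_distr_r.
          apply Rle_trans with (bmass N B * (INR N * (INR N * e))).
          - apply Rmult_le_compat_l; [apply bmass_nonneg|]. apply Rmult_le_compat_l; [apply pos_INR|auto].
          - lra. }
        apply Rle_trans with (K * (q / K)); [apply Rmult_le_compat_l; [lra|apply Rmin_r]|].
        right; field; lra.
  - apply negligible_union; apply negligible_Union.
    + intros n0. apply (escape_time r c n0 C2 hc). intros x g hx hn hg; now apply hE.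
    + intros M. apply hno; lia.
Qed.

End Instability.

(** * The spectrum of the linearization *)

Lemma rsum_sqr N v : rsum N v * rsum N v <= INR N * sqn N v.
Proof.
  eapply Rle_trans; [|apply l1_sqr].
  replace (rsum N v * rsum N v) with (Rabs (rsum N v) * Rabs (rsum N v))
    by apply Rabs_sqr.
  pose proof (rsum_abs N v). pose proof (Rabs_pos (rsum N v)).
  apply Rmult_le_compat; auto.
Qed.

Lemma positive_lower_bound N f : (forall i, (i < N)%nat -> 0 < f i) ->
  exists c, 0 < c /\ forall i, (i < N)%nat -> c <= f i.
Proof.
  induction N; intros h; [exists 1; split; [lra|lia]|].
  destruct IHN as [c [hc h']]; [auto|].
  exists (Rmin c (f N)); split; [apply Rmin_glb_lt; auto|].
  intros i hi. destruct (Nat.eq_dec i N) as [->|]; [apply Rmin_r|].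
  eapply Rle_trans; [apply Rmin_l|apply h'; lia].
Qed.

Lemma argmax N (S : nat -> bool) (f : nat -> R) : (exists j, (j < N)%nat /\ S j = true) ->
  exists j, (j < N)%nat /\ S j = true /\ forall i, (i < N)%nat -> S i = true -> f i <= f j.
Proof.
  induction N; intros [j [hj hS]]; [lia|].
  destruct (classic (exists j, (j < N)%nat /\ S j = true)) as [h|h].
  - destruct (IHN h) as [k [hk [hSk hm]]].
    destruct (S N) eqn:eN; [destruct (Rle_dec (f N) (f k))|].
    + exists k; repeat split; auto. intros i hi hSi.
      destruct (Nat.eq_dec i N) as [->|]; auto; apply hm; auto; lia.
    + exists N; repeat split; auto. intros i hi hSi.
      destruct (Nat.eq_dec i N) as [->|]; [lra|]. specialize (hm i ltac:(lia) hSi); lra.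
    + exists k; repeat split; auto. intros i hi hSi.
      destruct (Nat.eq_dec i N) as [->|]; [congruence|]. apply hm; auto; lia.
  - assert (j = N) by (destruct (Nat.eq_dec j N); auto; destruct h; exists j; split; auto; lia).
    subst j. exists N; repeat split; auto. intros i hi hSi.
    destruct (Nat.eq_dec i N) as [->|]; [lra|]. destruct h; exists i; split; auto; lia.
Qed.

(** A quantitative isolation: a small field forces a small distance to [z], which is what traps a
    path, and a second zero within [r] must coincide with [z]. *)
Definition isolated_zero (N : nat) (u : nat -> R) (lam : R) (z : nat -> R) : Prop :=
  exists r c, 0 < r /\ 0 < c /\ forall x, in_Delta N x ->
    (forall i, (i < N)%nat -> Rabs (x i - z i) <= r) ->
    c * sqn N (diff x z) <= sqn N (field N u lam x).

Section Spectrum.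
Context (N : nat) (u : nat -> R) (lam : R) (hl : 0 < lam) (hN : (1 <= N)%nat).
Context (z : nat -> R) (hz : ND N u lam z).

Let P (i : nat) : R := z i * (1 - z i) / lam.
Let H (i j : nat) : R := Hs N u i j z.
Let m : R := umass N u.

(** Under the substitution [e = P a] the linearization becomes [a |-> P (K - 1) a], and the scalar
    product [ip] makes [K] symmetric without square roots of [P]. *)
Definition Kop (a : nat -> R) (i : nat) : R := rsum N (fun j => H i j * (P j * a j)).
Definition ip (a b : nat -> R) : R := rsum N (fun i => P i * (a i * b i)).

Lemma P_bounds i : (i < N)%nat -> 0 < P i <= / (4 * lam).
Proof.
  intros hi. pose proof (ND_interior N u lam z i hz hi) as h. unfold P.
  split; [apply Rdiv_lt_0_compat; nra|].
  replace (/ (4 * lam)) with (1 / 4 / lam) by (field; lra).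
  apply Rmult_le_compat_r; [apply Rlt_le, Rinv_0_lt_compat; lra|].
  pose proof (Rle_0_sqr (z i - 1 / 2)) as h'; unfold Rsqr in h'; nra.
Qed.

Lemma H_bound i j : Rabs (H i j) <= 4 * m.
Proof. apply Hs_bound, hz. Qed.

Lemma H_sym i j : H i j = H j i.
Proof. apply Hs_sym. Qed.

Lemma m_nonneg : 0 <= m.
Proof. apply umass_nonneg. Qed.

Lemma ip_sym a b : ip a b = ip b a.
Proof. apply rsum_ext; intros; ring. Qed.

Lemma ip_lin a b c d : ip (fun i => a i + c * b i) d = ip a d + c * ip b d.
Proof. unfold ip. rewrite <- rsum_scal, <- rsum_plus; apply rsum_ext; intros; ring. Qed.

Lemma ip_nonneg a : 0 <= ip a a.
Proof. apply rsum_nonneg; intros i hi. pose proof (P_bounds i hi). nra. Qed.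

Lemma Kop_lin a b c i : Kop (fun i => a i + c * b i) i = Kop a i + c * Kop b i.
Proof. unfold Kop. rewrite <- rsum_scal, <- rsum_plus; apply rsum_ext; intros; ring. Qed.

Lemma ip_Kop a b : ip a (Kop b) = ip (Kop a) b.
Proof.
  unfold ip, Kop.
  rewrite (rsum_ext N _ (fun i => rsum N (fun j => P i * a i * (H i j * (P j * b j))))).
  2:{ intros i hi. rewrite rsum_scal. ring. }
  rewrite rsum_swap. apply rsum_ext; intros j hj.
  rewrite (rsum_ext N _ (fun i => (P j * b j) * (H j i * (P i * a i)))).
  2:{ intros i hi. rewrite (H_sym j i). ring. }
  rewrite rsum_scal. ring.
Qed.

(** An upper bound for the norm of [K]; [m + 1] instead of [m] keeps it positive for the zero
    potential. *)
Definition Lam : R := (m + 1) * INR N / lam.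

Lemma Lam_pos : 0 < Lam.
Proof.
  pose proof m_nonneg. apply Rdiv_lt_0_compat; auto. apply Rmult_lt_0_compat; [lra|].
  apply lt_0_INR; lia.
Qed.

Lemma ip_Kop_bound a : Rabs (ip a (Kop a)) <= Lam * ip a a.
Proof.
  pose proof m_nonneg as hm. pose proof (ip_nonneg a) as h0.
  apply Rle_trans with (INR N * / (4 * lam) * (4 * m) * ip a a).
  2:{ apply Rmult_le_compat_r; auto. unfold Lam.
      replace (INR N * / (4 * lam) * (4 * m)) with (m * INR N / lam) by (field; lra).
      apply Rmult_le_compat_r; [apply Rlt_le, Rinv_0_lt_compat; lra|].
      apply Rmult_le_compat_r; [apply pos_INR|lra]. }
  unfold ip at 1, Kop.
  eapply Rle_trans; [apply rsum_abs|].
  apply Rle_trans with (rsum N (fun i => rsum N (fun j =>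
     / (4 * lam) * (4 * m) * ((P i * (a i * a i)) / 2 + (P j * (a j * a j)) / 2)))).
  - apply rsum_le; intros i hi. pose proof (P_bounds i hi) as hPi.
    rewrite <- !rsum_scal.
    eapply Rle_trans; [apply rsum_abs|]. apply rsum_le; intros j hj.
    pose proof (P_bounds j hj) as hPj.
    rewrite !Rabs_mult, (Rabs_pos_eq (P i)), (Rabs_pos_eq (P j)) by lra.
    pose proof (H_bound i j) as hH. pose proof (Rabs_pos (H i j)) as hH0.
    set (x := Rabs (a i)). set (y := Rabs (a j)).
    assert (hx : 0 <= x) by apply Rabs_pos. assert (hy : 0 <= y) by apply Rabs_pos.
    assert (ex : a i * a i = x * x)
      by (symmetry; apply Rabs_sqr).
    assert (ey : a j * a j = y * y)
      by (symmetry; apply Rabs_sqr).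
    rewrite ex, ey.
    assert (h1 : P i * P j * (x * y) <= / (4 * lam) * ((P i * (x * x)) / 2 + (P j * (y * y)) / 2)).
    { apply Rle_trans with (P i * P j * ((x * x) / 2 + (y * y) / 2)).
      - apply Rmult_le_compat_l; [nra|]. pose proof (Rle_0_sqr (x - y)) as h; unfold Rsqr in h. nra.
      - assert (P j * (P i * (x * x)) <= / (4 * lam) * (P i * (x * x))) by (apply Rmult_le_compat_r; nra).
        assert (P i * (P j * (y * y)) <= / (4 * lam) * (P j * (y * y))) by (apply Rmult_le_compat_r; nra).
        lra. }
    replace (P i * (x * (Rabs (H i j) * (P j * y)))) with (Rabs (H i j) * (P i * P j * (x * y))) by ring.
    replace (/ (4 * lam) * (4 * m) * (P i * (x * x) / 2 + P j * (y * y) / 2)) with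
      ((4 * m) * (/ (4 * lam) * ((P i * (x * x)) / 2 + (P j * (y * y)) / 2))) by ring.
    apply Rmult_le_compat; auto. apply Rmult_le_pos; nra.
  - right.
    rewrite (rsum_ext N _ (fun i => / (4 * lam) * (4 * m) * (INR N / 2 * (P i * (a i * a i)) + ip a a / 2))).
    + rewrite rsum_scal, rsum_plus, rsum_scal, rsum_const. fold (ip a a). field. lra.
    + intros i hi. rewrite rsum_scal, rsum_plus, rsum_const. f_equal.
      rewrite (rsum_ext N (fun j => P j * (a j * a j) / 2) (fun j => / 2 * (P j * (a j * a j))))
        by (intros; field).
      rewrite rsum_scal. fold (ip a a). field.
Qed.

(** Centred at the midpoint of [[1/2, 1]]. The hypothesis [hyperbolic] below says that [K - 3/4]
    expands by at least [1/2]: the spectrum of [K] avoids the interval from [1/4] to [5/4], with a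
    margin around both [1/2] and [1]. *)
Definition shifted (a : nat -> R) (i : nat) : R := Kop a i - 3 / 4 * a i.

Context (hyperbolic : forall a, / 4 * ip a a <= ip (shifted a) (shifted a)).

(** Puts [K + L] between [2 * Lam] and [4 * Lam]: a positive factor whose bounds are close enough
    for the negative term of [hyperbolic_drift] to be absorbed. *)
Let L : R := 3 * Lam.

(* The matrix of [a |-> <a, (K - 1/2)(K + L) a>_P] in the coordinates [e = P a]. *)
Definition Bmat (i j : nat) : R :=
  rsum N (fun k => H i k * (P k * H k j)) + (L - 1 / 2) * H i j -
  (if Nat.eqb i j then L / 2 * / P i else 0).

Lemma Bmat_sym i j : Bmat i j = Bmat j i.
Proof.
  unfold Bmat. rewrite (H_sym i j), (Nat.eqb_sym j i). f_equal; [f_equal|].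
  - apply rsum_ext; intros k _. rewrite (H_sym i k), (H_sym k j). ring.
  - destruct (Nat.eqb_spec i j) as [->|]; auto.
Qed.

Let scaled (e : nat -> R) : nat -> R := fun i => e i / P i.
Let half (a : nat -> R) : nat -> R := fun i => Kop a i + (- (1 / 2)) * a i.
Let Top (a : nat -> R) : nat -> R := fun i => Kop (half a) i + L * half a i.

Lemma Kop_scaled e i : Kop (scaled e) i = rsum N (fun j => H i j * e j).
Proof.
  apply rsum_ext; intros j hj. unfold scaled. pose proof (P_bounds j hj). f_equal. field. lra.
Qed.

Lemma bform_Top e e' : bform N Bmat e e' = rsum N (fun i => e i * Top (scaled e') i).
Proof.
  apply rsum_ext; intros i hi.
  rewrite (rsum_ext N _ (fun j => e i * (Bmat i j * e' j))) by (intros; ring).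
  rewrite rsum_scal. f_equal. unfold Top, half. rewrite Kop_lin, Kop_scaled.
  unfold Bmat.
  rewrite (rsum_ext N _ (fun j => rsum N (fun k => (H i k * P k) * (H k j * e' j)) +
     ((L - 1 / 2) * (H i j * e' j) - (if Nat.eqb j i then L / 2 * / P i * e' i else 0)))).
  2:{ intros j hj.
      rewrite (rsum_ext N (fun k => H i k * P k * (H k j * e' j)) (fun k => e' j * (H i k * (P k * H k j))))
        by (intros; ring).
      rewrite rsum_scal, (Nat.eqb_sym j i). destruct (Nat.eqb_spec i j) as [->|]; ring. }
  rewrite rsum_plus, rsum_minus, rsum_single, rsum_scal, rsum_swap by auto.
  assert (e1 : Kop (Kop (scaled e')) i = rsum N (fun k => rsum N (fun j => H i k * P k * (H k j * e' j)))).
  { apply rsum_ext; intros k hk. rewrite Kop_scaled, rsum_scal. ring. }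
  rewrite e1. unfold scaled, Rdiv. ring.
Qed.

Lemma jac_scaled e i : (i < N)%nat ->
  jac N u lam z e i = P i * (Kop (scaled e) i + (- (1)) * scaled e i).
Proof.
  intros hi. rewrite Kop_scaled.
  change (P i * rsum N (fun j => H i j * e j) - e i =
          P i * (rsum N (fun j => H i j * e j) + - (1) * (e i / P i))).
  pose proof (P_bounds i hi). field. lra.
Qed.

Lemma ip_scaled e b : ip (scaled e) b = rsum N (fun i => e i * b i).
Proof.
  apply rsum_ext; intros i hi. unfold scaled. pose proof (P_bounds i hi). field. lra.
Qed.

Lemma ip_scaled_lower e : 4 * lam * sqn N e <= ip (scaled e) (scaled e).
Proof.
  rewrite ip_scaled. unfold sqn. rewrite <- rsum_scal. apply rsum_le; intros i hi.
  pose proof (P_bounds i hi) as h. unfold scaled.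
  replace (e i * (e i / P i)) with (/ P i * (e i * e i)) by (unfold Rdiv; ring).
  apply Rmult_le_compat_r; [nra|].
  rewrite <- (Rinv_inv (4 * lam)). apply Rinv_le_contravar; lra.
Qed.

(** Parallelogram identity for [K - 3/4] and [K - 1/4], whose mean is [K - 1/2]. The same identity
    with [5/4] in place of [1/4] yields the margin at [1] in [jac_lower_bound]. *)
Lemma ip_half a : / 16 * ip a a <= ip (half a) (half a).
Proof.
  pose proof (hyperbolic a) as h.
  assert (e : ip (shifted a) (shifted a) <= 2 * ip (half a) (half a) + / 8 * ip a a).
  { unfold ip. rewrite <- !rsum_scal, <- rsum_plus. apply rsum_le; intros i hi.
    unfold shifted, half. pose proof (P_bounds i hi).
    set (k := Kop a i). set (x := a i).
    pose proof (Rle_0_sqr (k - x / 4)) as hs; unfold Rsqr in hs.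
    assert (0 <= P i * ((k - x / 4) * (k - x / 4))) by (apply Rmult_le_pos; lra).
    replace (2 * (P i * ((k + - (1 / 2) * x) * (k + - (1 / 2) * x))) + / 8 * (P i * (x * x)))
      with (P i * ((k - 3 / 4 * x) * (k - 3 / 4 * x)) + P i * ((k - x / 4) * (k - x / 4))) by field.
    lra. }
  lra.
Qed.

Lemma Kop_ext a b i : (forall j, (j < N)%nat -> a j = b j) -> Kop a i = Kop b i.
Proof. intros h; apply rsum_ext; intros j hj; now rewrite h. Qed.

(** [(K - 1)(K - 1/2) = (K - 3/4)^2 - 1/16]. With [g = (K - 3/4) a], the form is that of [K + L] at
    [g] minus [1/16] of that at [a], at least [Lam / 2 - Lam / 4] times the square norm of [a]. *)
Lemma hyperbolic_drift e : Lam * lam * sqn N e <= 2 * bform N Bmat e (jac N u lam z e).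
Proof.
  rewrite (bform_sym N Bmat Bmat_sym), bform_Top.
  set (a := scaled e). set (g := shifted a).
  assert (E : rsum N (fun i => jac N u lam z e i * Top a i) =
    ip g (Kop g) + L * ip g g - / 16 * ip a (Kop a) - L / 16 * ip a a).
  { assert (e1 : rsum N (fun i => jac N u lam z e i * Top a i) =
      ip (fun i => g i + (- / 4) * a i) (fun i => Kop g i + / 4 * Kop a i + L * (g i + / 4 * a i))).
    { apply rsum_ext; intros i hi. rewrite jac_scaled by auto. fold a. unfold Top.
      rewrite (Kop_ext (half a) (fun i => g i + / 4 * a i)) by (intros; unfold half, g, shifted; field).
      rewrite Kop_lin. unfold half, g, shifted. field. }
    rewrite e1, ip_lin.
    assert (e2 : forall x, ip x (fun i => Kop g i + / 4 * Kop a i + L * (g i + / 4 * a i)) =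
      ip x (Kop g) + / 4 * ip x (Kop a) + L * ip x g + L / 4 * ip x a).
    { intros x. unfold ip. rewrite <- !rsum_scal, <- !rsum_plus. apply rsum_ext; intros; field. }
    rewrite !e2, (ip_Kop a g), (ip_sym (Kop a) g), (ip_sym a g). field. }
  rewrite E. pose proof (hyperbolic a) as h. fold g in h.
  pose proof (ip_Kop_bound g) as hg. pose proof (ip_Kop_bound a) as ha.
  apply Rabs_le_between in hg. apply Rabs_le_between in ha.
  pose proof (ip_scaled_lower e) as hs. fold a in hs. pose proof Lam_pos as hL.
  assert (Lam * (4 * lam * sqn N e) <= Lam * ip a a) by (apply Rmult_le_compat_l; lra).
  assert (Lam * (/ 4 * ip a a) <= Lam * ip g g) by (apply Rmult_le_compat_l; lra).
  assert (0 <= Lam * (lam * sqn N e)).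
  { pose proof (sqn_nonneg N e). apply Rmult_le_pos; [lra|]. apply Rmult_le_pos; lra. }
  unfold L in *. lra.
Qed.

(** Since [2 (K - 1) + 1 = 2 (K - 1/2)], the sum is twice the form of [K + L] at
    [h = (K - 1/2) a]. *)
Lemma hyperbolic_scaled_drift e :
  Lam * lam * sqn N e <= 2 * bform N Bmat e (jac N u lam z e) + bform N Bmat e e.
Proof.
  rewrite (bform_sym N Bmat Bmat_sym e (jac N u lam z e)), !bform_Top.
  set (a := scaled e). set (h := half a).
  assert (E : 2 * rsum N (fun i => jac N u lam z e i * Top a i) + rsum N (fun i => e i * Top a i) =
    2 * (ip h (Kop h) + L * ip h h)).
  { unfold ip. rewrite <- !rsum_scal, <- !rsum_plus, <- rsum_scal. apply rsum_ext; intros i hi.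
    rewrite jac_scaled by auto. fold a. unfold Top. fold h.
    replace (e i) with (P i * a i) by (unfold a, scaled; pose proof (P_bounds i hi); field; lra).
    replace (Kop a i) with (h i + / 2 * a i) by (unfold h, half; field). field. }
  rewrite E. pose proof (ip_half a) as hh. fold h in hh.
  pose proof (ip_Kop_bound h) as hk. apply Rabs_le_between in hk.
  pose proof (ip_scaled_lower e) as hs. fold a in hs. pose proof Lam_pos as hL.
  assert (Lam * (4 * lam * sqn N e) <= Lam * ip a a) by (apply Rmult_le_compat_l; lra).
  assert (Lam * (/ 16 * ip a a) <= Lam * ip h h) by (apply Rmult_le_compat_l; lra).
  unfold L. lra.
Qed.

Lemma jac_lower_bound : exists c, 0 < c /\ forall e, c * sqn N e <= sqn N (jac N u lam z e).
Proof.
  destruct (positive_lower_bound N P) as [p [hp hpi]]; [intros; now apply P_bounds|].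
  exists (p * (lam / 4)). split; [nra|]. intros e.
  set (a := scaled e). set (b := fun i => Kop a i + (- (1)) * a i).
  assert (h1 : / 16 * ip a a <= ip b b).
  { pose proof (hyperbolic a) as h.
    assert (h' : ip (shifted a) (shifted a) <= 2 * ip b b + / 8 * ip a a).
    { unfold ip. rewrite <- !rsum_scal, <- rsum_plus. apply rsum_le; intros i hi.
      unfold shifted, b. pose proof (P_bounds i hi).
      set (k := Kop a i). set (x := a i).
      pose proof (Rle_0_sqr (k - 5 / 4 * x)) as hs; unfold Rsqr in hs.
      assert (0 <= P i * ((k - 5 / 4 * x) * (k - 5 / 4 * x))) by (apply Rmult_le_pos; lra).
      replace (2 * (P i * ((k + - (1) * x) * (k + - (1) * x))) + / 8 * (P i * (x * x)))
        with (P i * ((k - 3 / 4 * x) * (k - 3 / 4 * x)) + P i * ((k - 5 / 4 * x) * (k - 5 / 4 * x))) by field.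
      lra. }
    lra. }
  assert (h2 : p * ip b b <= sqn N (jac N u lam z e)).
  { unfold ip, sqn. rewrite <- rsum_scal. apply rsum_le; intros i hi.
    rewrite jac_scaled by auto. fold a. fold (b i). pose proof (P_bounds i hi). pose proof (hpi i hi).
    replace (P i * b i * (P i * b i)) with (P i * (P i * (b i * b i))) by ring.
    apply Rmult_le_compat_r; auto. apply Rmult_le_pos; [lra|nra]. }
  pose proof (ip_scaled_lower e) as hs. fold a in hs. nra.
Qed.

Lemma hyperbolic_isolated : isolated_zero N u lam z.
Proof.
  destruct jac_lower_bound as [c [hc hj]].
  destruct (field_linearization N u lam hl z hz) as [C [hC hlin]].
  set (n := INR N). pose proof (INR_ge_1 N hN : 1 <= n) as hn.
  set (A := n * n * (C * C) + 1).
  assert (hA : 1 <= A) by (unfold A; assert (0 <= n * n * (C * C)) by (repeat apply Rmult_le_pos; lra); lra).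
  exists (Rmin 1 (c / (4 * A))), (c / 4).
  split; [apply Rmin_glb_lt; [lra|apply Rdiv_lt_0_compat; lra]|]. split; [lra|].
  intros x hx hr. set (r := Rmin 1 (c / (4 * A))) in *.
  assert (hr1 : r <= 1) by apply Rmin_l.
  assert (hr0 : 0 <= r).
  { specialize (hr O ltac:(lia)). eapply Rle_trans; [apply Rabs_pos|apply hr]. }
  set (e := diff x z). set (s := sqn N e). assert (hs : 0 <= s) by apply sqn_nonneg.
  assert (hsr : s <= n * r).
  { apply rsum_le_const; intros i hi. unfold e, diff. specialize (hr i hi).
    replace ((x i - z i) * (x i - z i)) with (Rabs (x i - z i) * Rabs (x i - z i))
      by apply Rabs_sqr.
    pose proof (Rabs_pos (x i - z i)). nra. }
  assert (hR : sqn N (fun i => field N u lam x i - jac N u lam z e i) <= n * ((C * s) * (C * s))).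
  { apply rsum_le_const; intros i hi. specialize (hlin i x hi hx). fold e s in hlin.
    set (y := field N u lam x i - jac N u lam z e i) in *.
    replace (y * y) with (Rabs y * Rabs y) by apply Rabs_sqr.
    pose proof (Rabs_pos y). apply Rmult_le_compat; auto. }
  assert (hJ : sqn N (jac N u lam z e) <=
    2 * sqn N (field N u lam x) + 2 * sqn N (fun i => field N u lam x i - jac N u lam z e i)).
  { unfold sqn. rewrite <- !rsum_scal, <- rsum_plus. apply rsum_le; intros i hi.
    pose proof (Rle_0_sqr (2 * field N u lam x i - jac N u lam z e i)) as h; unfold Rsqr in h. nra. }
  assert (hfin : n * ((C * s) * (C * s)) <= c / 4 * s).
  { replace (n * ((C * s) * (C * s))) with ((n * (C * C) * s) * s) by ring.
    apply Rmult_le_compat_r; auto.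
    apply Rle_trans with (A * r).
    - unfold A. apply Rle_trans with (n * n * (C * C) * r); [|nra].
      replace (n * n * (C * C) * r) with (n * (C * C) * (n * r)) by ring.
      apply Rmult_le_compat_l; auto. repeat apply Rmult_le_pos; lra.
    - apply Rle_trans with (A * (c / (4 * A))).
      + apply Rmult_le_compat_l; [lra|apply Rmin_r].
      + right; field; lra. }
  specialize (hj e). fold s in hj. lra.
Qed.

Lemma trace_formula : rsum N (fun i => Bmat i i * (z i * (1 - z i))) =
  lam * (rsum N (fun i => rsum N (fun k => P i * P k * (H i k * H i k))) - INR N * (L / 2)).
Proof.
  rewrite <- rsum_const, <- rsum_minus, <- rsum_scal. apply rsum_ext; intros i hi.
  pose proof (P_bounds i hi). unfold Bmat. rewrite Nat.eqb_refl.
  replace (z i * (1 - z i)) with (lam * P i) by (unfold P; field; lra).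
  (* The contribution of [(L - 1/2) H] vanishes: the own strategy of a player does not affect the
     slope of its payoff. *)
  unfold H at 3. rewrite Hs_diag.
  rewrite (rsum_ext N (fun k => P i * P k * (H i k * H i k)) (fun k => P i * (H i k * (P k * H k i)))).
  2:{ intros k hk. rewrite (H_sym k i). ring. }
  rewrite rsum_scal. field. lra.
Qed.

End Spectrum.

(** * Nash distributions close to regular equilibria *)

Section MixedPlayers.
Context (N : nat) (u : nat -> R) (lam : R) (hl : 0 < lam) (hN : (1 <= N)%nat).
Context (z : nat -> R) (hz : ND N u lam z).
(** [S] are the mixed players. In the application [p] is of order [1 / lam] and [q] is exponentially
    small in [1 / lam]. *)
Context (S : nat -> bool) (p q eps : R) (hp : 0 < p) (hq : 0 <= q) (heps : 0 < eps).

Let P (i : nat) : R := z i * (1 - z i) / lam.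
Let H (i j : nat) : R := Hs N u i j z.
Let m : R := umass N u.
Let n : R := INR N.

Context (hS : forall i, (i < N)%nat -> S i = true -> p <= P i).
Context (hS' : forall i, (i < N)%nat -> S i = false -> P i <= q).
Context (hreg : forall f j, (j < N)%nat -> S j = true -> f j = 1 ->
  (forall i, (i < N)%nat -> S i = false -> f i = 0) -> (forall i, (i < N)%nat -> Rabs (f i) <= 1) ->
  exists i, (i < N)%nat /\ S i = true /\ eps < Rabs (rsum N (fun l => H i l * f l))).
Context (hmix : 3 * n <= (p * eps) * (p * eps)) (hpure : 128 * (m * m) * (n * n) * q <= lam).

Let msk (i : nat) : R := if S i then 1 else 0.

Let P_range i (hi : (i < N)%nat) : 0 < P i <= / (4 * lam) := P_bounds N u lam hl z hz i hi.
Let H_range i j : Rabs (H i j) <= 4 * m := H_bound N u lam z hz i j.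

(** The weight [t] selects players: the pure ones, with [r = q], for the cross terms of the mixed
    rows, or all of them, with [r = / (4 * lam)], for the full rows. *)
Lemma masked_row_bound (t : nat -> R) r a i : (forall j, (j < N)%nat -> 0 <= t j <= 1) ->
  (forall j, (j < N)%nat -> P j * t j <= r) ->
  rsum N (fun j => H i j * (P j * (a j * t j))) * rsum N (fun j => H i j * (P j * (a j * t j)))
    <= n * (16 * (m * m) * r * ip N lam z a a).
Proof.
  intros ht hr. eapply Rle_trans; [apply rsum_sqr|]. fold n.
  apply Rmult_le_compat_l; [apply pos_INR|].
  unfold sqn, ip. rewrite <- rsum_scal. apply rsum_le; intros j hj. fold (P j).
  pose proof (P_range j hj) as hPj.
  pose proof (H_range i j) as hH.
  specialize (ht j hj). specialize (hr j hj).
  assert (hH2 : H i j * H i j <= 16 * (m * m)).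
  { replace (H i j * H i j) with (Rabs (H i j) * Rabs (H i j))
      by apply Rabs_sqr.
    pose proof (Rabs_pos (H i j)).
    apply Rle_trans with ((4 * m) * (4 * m)); [apply Rmult_le_compat; auto|right; ring]. }
  replace (H i j * (P j * (a j * t j)) * (H i j * (P j * (a j * t j)))) with
    ((H i j * H i j) * ((P j * t j) * (P j * (a j * a j) * t j))) by ring.
  rewrite (Rmult_assoc (16 * (m * m))).
  assert (haa : 0 <= P j * (a j * a j)) by (apply Rmult_le_pos; [lra|apply Rle_0_sqr]).
  assert (hPt : 0 <= P j * t j) by (apply Rmult_le_pos; lra).
  assert (hPat : 0 <= P j * (a j * a j) * t j <= P j * (a j * a j)) by (split; nra).
  apply Rmult_le_compat; auto; [apply Rle_0_sqr|apply Rmult_le_pos; lra|].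
  apply Rmult_le_compat; lra.
Qed.

(** Dividing [v] by its entry of largest modulus yields a vector to which [hreg] applies; the factor
    [/ n] compares that entry with the Euclidean norm. *)
Lemma mixed_block_lower_bound v : (forall i, (i < N)%nat -> S i = false -> v i = 0) ->
  eps * eps / n * sqn N v <= rsum N (fun i => msk i * (rsum N (fun j => H i j * v j) * rsum N (fun j => H i j * v j))).
Proof.
  intros hv.
  pose proof (INR_ge_1 N hN : 1 <= n) as hn.
  assert (hpos : forall i, (i < N)%nat -> 0 <= msk i * (rsum N (fun j => H i j * v j) * rsum N (fun j => H i j * v j))).
  { intros i hi. apply Rmult_le_pos; [unfold msk; destruct (S i); lra|apply Rle_0_sqr]. }
  destruct (classic (exists j, (j < N)%nat /\ S j = true)) as [hj|hj].
  - destruct (argmax N S (fun i => Rabs (v i)) hj) as [j [hjN [hSj hmax]]].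
    assert (hall : forall i, (i < N)%nat -> Rabs (v i) <= Rabs (v j)).
    { intros i hi. destruct (S i) eqn:e; auto. rewrite (hv i hi e), Rabs_R0. apply Rabs_pos. }
    assert (hsq : sqn N v <= n * (v j * v j)).
    { apply rsum_le_const; intros i hi. specialize (hall i hi).
      rewrite <- (Rabs_pos_eq (v i * v i)), <- (Rabs_pos_eq (v j * v j)) by apply Rle_0_sqr.
      rewrite !Rabs_mult. pose proof (Rabs_pos (v i)). nra. }
    destruct (Req_dec (v j) 0) as [h0|h0].
    + rewrite h0 in hsq. pose proof (sqn_nonneg N v).
      replace (sqn N v) with 0 by lra. rewrite Rmult_0_r. now apply rsum_nonneg.
    + destruct (hreg (fun i => v i / v j) j hjN hSj) as [i [hi [hSi hi']]].
      * field; auto.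
      * intros i hi e. rewrite (hv i hi e). unfold Rdiv; ring.
      * intros i hi. unfold Rdiv. rewrite Rabs_mult, Rabs_inv.
        apply Rmult_le_reg_r with (Rabs (v j)); [now apply Rabs_pos_lt|].
        rewrite Rmult_assoc, Rinv_l by (now apply Rabs_no_R0). specialize (hall i hi). lra.
      * set (y := rsum N (fun l => H i l * v l)) in *.
        assert (ey : rsum N (fun l => H i l * (v l / v j)) = / v j * y).
        { unfold y. rewrite <- rsum_scal. apply rsum_ext; intros; unfold Rdiv; ring. }
        rewrite ey, Rabs_mult, Rabs_inv in hi'.
        assert (hvj : 0 < Rabs (v j)) by now apply Rabs_pos_lt.
        assert (hy : eps * Rabs (v j) <= Rabs y).
        { apply Rmult_le_reg_l with (/ Rabs (v j)); [now apply Rinv_0_lt_compat|].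
          replace (/ Rabs (v j) * (eps * Rabs (v j))) with eps by (field; lra). lra. }
        assert (hyy : eps * eps * (v j * v j) <= y * y).
        { rewrite <- (Rabs_pos_eq (v j * v j)), <- (Rabs_pos_eq (y * y)) by apply Rle_0_sqr.
          rewrite !Rabs_mult. assert (0 <= eps * Rabs (v j)) by nra.
          replace (eps * eps * (Rabs (v j) * Rabs (v j))) with ((eps * Rabs (v j)) * (eps * Rabs (v j))) by ring.
          apply Rmult_le_compat; auto. }
        apply Rle_trans with (y * y).
        -- eapply Rle_trans; [|apply hyy].
           replace (eps * eps * (v j * v j)) with (eps * eps / n * (n * (v j * v j))) by (field; lra).
           apply Rmult_le_compat_l; auto. apply Rdiv_le_0_compat; [nra|lra].
        -- pose proof (rsum_ge_term N (fun i => msk i * (rsum N (fun j => H i j * v j) * rsum N (fun j => H i j * v j))) i hpos hi) as h.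
           cbv beta in h. unfold msk at 1 in h. rewrite hSi in h. fold y in h. lra.
  - replace (sqn N v) with 0; [rewrite Rmult_0_r; now apply rsum_nonneg|].
    symmetry. apply rsum_0; intros i hi. rewrite hv; auto; [ring|].
    destruct (S i) eqn:e; auto. destruct hj; eauto.
Qed.

(** On the mixed players [K] expands so much that its spectrum is far from [3/4]; on the pure ones
    it nearly vanishes. Both parts keep the factor [3/8], as [3/2 - 9/8 = 3/8], and the cross terms
    cost [1/16] in all, which leaves [5/16]. *)
Lemma hyperbolic_of_regular a :
  / 4 * ip N lam z a a <= ip N lam z (shifted N u lam z a) (shifted N u lam z a).
Proof.
  pose proof (INR_ge_1 N hN : 1 <= n) as hn.
  assert (hm : 0 <= m) by apply umass_nonneg.
  set (al := ip N lam z a a). assert (hal : 0 <= al) by now apply (ip_nonneg N u).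
  set (A := fun i => rsum N (fun j => H i j * (P j * (a j * msk j)))).
  set (R0 := fun i => rsum N (fun j => H i j * (P j * (a j * (1 - msk j))))).
  assert (hK : forall i, Kop N u lam z a i = A i + R0 i).
  { intros i. unfold A, R0, Kop. rewrite <- rsum_plus. apply rsum_ext; intros j hj.
    unfold H, P. ring. }
  assert (hmsk : forall i, 0 <= msk i <= 1) by (intros i; unfold msk; destruct (S i); lra).
  assert (hR : forall i, (i < N)%nat -> R0 i * R0 i <= n * (16 * (m * m) * q * al)).
  { intros i hi. apply masked_row_bound.
    - intros j hj. specialize (hmsk j); lra.
    - intros j hj. unfold msk. destruct (S j) eqn:e; [nra|]. specialize (hS' j hj e). lra. }
  assert (hKb : forall i, (i < N)%nat ->
    Kop N u lam z a i * Kop N u lam z a i <= n * (16 * (m * m) * / (4 * lam) * al)).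
  { intros i hi. assert (e : Kop N u lam z a i = rsum N (fun j => H i j * (P j * (a j * 1)))).
    { unfold Kop. apply rsum_ext; intros; unfold H, P; ring. }
    rewrite e. apply masked_row_bound.
    - intros; lra.
    - intros j hj. pose proof (P_range j hj) as h. lra. }
  set (c := n * (16 * (m * m) * q * / (4 * lam) * al)).
  assert (hc : 0 <= c).
  { unfold c. assert (0 < / (4 * lam)) by (apply Rinv_0_lt_compat; lra).
    repeat apply Rmult_le_pos; lra. }
  (* Per player: the mixed block dominates on [S], the term [-3/4 a] off [S]. *)
  assert (hi : forall i, (i < N)%nat ->
    / 2 * p * (msk i * (A i * A i)) - 9 / 8 * (P i * (msk i * (a i * a i)))
    + 3 / 8 * (P i * ((1 - msk i) * (a i * a i))) - 2 * c
    <= P i * (shifted N u lam z a i * shifted N u lam z a i)).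
  { intros i hi. pose proof (P_range i hi) as hPi.
    unfold shifted. unfold msk. destruct (S i) eqn:e.
    - specialize (hS i hi e). rewrite hK. specialize (hR i hi).
      set (x := A i) in *. set (r := R0 i) in *. set (y := a i).
      assert (h1 : / 2 * (x * x) - 2 * (r * r) - 9 / 8 * (y * y) <= (x + r - 3 / 4 * y) * (x + r - 3 / 4 * y)).
      { pose proof (Rle_0_sqr (x + 2 * (r - 3 / 4 * y))) as h.
        pose proof (Rle_0_sqr (r + 3 / 4 * y)) as h'. unfold Rsqr in *. nra. }
      assert (h2 : P i * (r * r) <= c).
      { unfold c. apply Rle_trans with (/ (4 * lam) * (n * (16 * (m * m) * q * al))).
        - apply Rmult_le_compat; try lra. apply Rle_0_sqr.
        - right; ring. }
      assert (h3 : p * (x * x) <= P i * (x * x)) by (apply Rmult_le_compat_r; [nra|lra]).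
      assert (h4 : P i * (/ 2 * (x * x) - 2 * (r * r) - 9 / 8 * (y * y)) <=
                   P i * ((x + r - 3 / 4 * y) * (x + r - 3 / 4 * y))) by (apply Rmult_le_compat_l; lra).
      lra.
    - specialize (hS' i hi e). specialize (hKb i hi).
      set (k := Kop N u lam z a i) in *. set (y := a i).
      assert (h1 : 3 / 8 * (y * y) - 2 * (k * k) <= (k - 3 / 4 * y) * (k - 3 / 4 * y)).
      { pose proof (Rle_0_sqr (3 * k - 3 / 4 * y)) as h. unfold Rsqr in h. nra. }
      assert (h2 : P i * (k * k) <= c).
      { unfold c. apply Rle_trans with (q * (n * (16 * (m * m) * / (4 * lam) * al))).
        - apply Rmult_le_compat; try lra. apply Rle_0_sqr.
        - right; ring. }
      assert (h4 : P i * (3 / 8 * (y * y) - 2 * (k * k)) <= P i * ((k - 3 / 4 * y) * (k - 3 / 4 * y)))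
        by (apply Rmult_le_compat_l; lra).
      lra. }
  pose proof (rsum_le N _ _ hi) as hsum. clear hi.
  rewrite rsum_minus, rsum_plus, rsum_minus, !rsum_scal, rsum_const in hsum. fold n in hsum.
  change (rsum N (fun i => P i * (shifted N u lam z a i * shifted N u lam z a i))) with
    (ip N lam z (shifted N u lam z a) (shifted N u lam z a)) in hsum.
  set (aS := rsum N (fun i => P i * (msk i * (a i * a i)))) in *.
  set (aO := rsum N (fun i => P i * ((1 - msk i) * (a i * a i)))) in *.
  assert (hsplit : al = aS + aO).
  { unfold al, aS, aO, ip. rewrite <- rsum_plus. apply rsum_ext; intros; unfold P; ring. }
  assert (haS : 0 <= aS).
  { apply rsum_nonneg; intros i hi. pose proof (P_range i hi) as h.
    apply Rmult_le_pos; [lra|]. apply Rmult_le_pos; [apply hmsk|nra]. }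
  assert (haO : 0 <= aO).
  { apply rsum_nonneg; intros i hi. pose proof (P_range i hi) as h.
    apply Rmult_le_pos; [lra|]. apply Rmult_le_pos; [|nra]. specialize (hmsk i); lra. }
  pose proof (mixed_block_lower_bound (fun j => P j * (a j * msk j))) as hblock.
  cbv beta in hblock. fold A in hblock.
  assert (hb : p * aS <= sqn N (fun j => P j * (a j * msk j))).
  { unfold aS, sqn. rewrite <- rsum_scal. apply rsum_le; intros i hi.
    pose proof (P_range i hi) as h.
    unfold msk. destruct (S i) eqn:e; [|lra]. specialize (hS i hi e).
    replace (P i * (a i * 1) * (P i * (a i * 1))) with (P i * (P i * (1 * (a i * a i)))) by ring.
    apply Rmult_le_compat_r; auto. apply Rmult_le_pos; [lra|nra]. }
  assert (hmain : 3 * aS <= p * rsum N (fun i => msk i * (A i * A i))).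
  { apply Rle_trans with (p * (eps * eps / n * (p * aS))).
    - replace (p * (eps * eps / n * (p * aS))) with ((p * eps) * (p * eps) / n * aS) by (field; lra).
      apply Rmult_le_compat_r; auto. apply Rmult_le_reg_r with n; [lra|].
      replace ((p * eps) * (p * eps) / n * n) with ((p * eps) * (p * eps)) by (field; lra). lra.
    - apply Rmult_le_compat_l; [lra|]. eapply Rle_trans; [|apply hblock].
      + apply Rmult_le_compat_l; auto. apply Rdiv_le_0_compat; [nra|lra].
      + intros i hi e. unfold msk; rewrite e; ring. }
  assert (hcn : n * c <= / 32 * al).
  { unfold c. replace (n * (n * (16 * (m * m) * q * / (4 * lam) * al))) with
      ((128 * (m * m) * (n * n) * q) * (/ 32 * / lam) * al) by (field; lra).
    apply Rmult_le_compat_r; auto.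
    apply Rle_trans with (lam * (/ 32 * / lam)); [|right; field; lra].
    apply Rmult_le_compat_r; auto. apply Rmult_le_pos; [lra|apply Rlt_le, Rinv_0_lt_compat; lra]. }
  lra.
Qed.

(** Applied to a basis vector, [hreg] provides one entry of the mixed Hessian larger than [eps].
    That entry alone makes the trace of [K^2] at least [(p * eps)^2], which beats [N L / 2] by
    assumption. *)
Lemma trace_pos_of_regular : (exists j, (j < N)%nat /\ S j = true) ->
  3 * (n * n) * (m + 1) < 2 * lam * ((p * eps) * (p * eps)) ->
  0 < rsum N (fun i => Bmat N u lam z i i * (z i * (1 - z i))).
Proof.
  intros [j [hj hSj]] hbig.
  rewrite (trace_formula N u lam hl z hz).
  pose proof (INR_ge_1 N hN : 1 <= n) as hn.
  apply Rmult_lt_0_compat; auto.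
  destruct (hreg (fun i => if Nat.eqb i j then 1 else 0) j hj hSj) as [i [hi [hSi h]]].
  - now rewrite Nat.eqb_refl.
  - intros i hi e. destruct (Nat.eqb_spec i j); [congruence|auto].
  - intros i hi. destruct (Nat.eqb i j); rewrite ?Rabs_R1, ?Rabs_R0; lra.
  - rewrite (rsum_ext N _ (fun l => if Nat.eqb l j then H i j else 0)) in h.
    2:{ intros l hl'. destruct (Nat.eqb_spec l j) as [->|]; ring. }
    rewrite rsum_single in h by auto.
    assert (hHH : eps * eps <= H i j * H i j).
    { rewrite <- (Rabs_pos_eq (H i j * H i j)), Rabs_mult by apply Rle_0_sqr. nra. }
    assert (hpos : forall i k, (i < N)%nat -> (k < N)%nat -> 0 <= P i * P k * (H i k * H i k)).
    { intros i' k hi' hk. pose proof (P_range i' hi') as h1.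
      pose proof (P_range k hk) as h2. fold (P k) in h2.
      apply Rmult_le_pos; [nra|apply Rle_0_sqr]. }
    assert (hT : (p * eps) * (p * eps) <= rsum N (fun i => rsum N (fun k => P i * P k * (H i k * H i k)))).
    { apply Rle_trans with (P i * P j * (H i j * H i j)).
      - pose proof (hS i hi hSi). pose proof (hS j hj hSj).
        replace (p * eps * (p * eps)) with (p * p * (eps * eps)) by ring.
        apply Rmult_le_compat; try nra.
      - eapply Rle_trans; [|apply (rsum_ge_term N (fun i => rsum N (fun k => P i * P k * (H i k * H i k))) i)].
        + apply (rsum_ge_term N (fun k => P i * P k * (H i k * H i k)) j); auto.
        + intros; apply rsum_nonneg; auto.
        + auto. }
    unfold P, H in hT.
    apply Rlt_le_trans with ((p * eps) * (p * eps) - INR N * (3 * Lam N u lam / 2)); [|lra].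
    unfold Lam. fold m n.
    replace (n * (3 * ((m + 1) * n / lam) / 2)) with (3 * (n * n) * (m + 1) / (2 * lam)) by (field; lra).
    apply Rlt_0_minus. apply Rmult_lt_reg_r with (2 * lam); [lra|].
    replace (3 * (n * n) * (m + 1) / (2 * lam) * (2 * lam)) with (3 * (n * n) * (m + 1)) by (field; lra). lra.
Qed.

End MixedPlayers.

(** * A Lyapunov function *)

Section ClippedLogit.
Context (k0 : R) (hk : 0 < k0 <= 1 / 4).

(** The logit is singular at 0 and 1, which empirical distributions can reach. Best responses keep a
    distance [2 * k0] from both, so truncation leaves the logit unchanged where it represents a
    payoff gap. *)
Definition clip (x : R) : R := Rmax k0 (Rmin (1 - k0) x).

Lemma clip_range x : k0 <= clip x <= 1 - k0.
Proof. unfold clip, Rmax, Rmin; repeat destruct Rle_dec; lra. Qed.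

Lemma clip_id x : k0 <= x <= 1 - k0 -> clip x = x.
Proof. intros h; unfold clip, Rmax, Rmin; repeat destruct Rle_dec; lra. Qed.

Lemma clip_lip x y : Rabs (clip y - clip x) <= Rabs (y - x).
Proof. unfold clip, Rmax, Rmin, Rabs; repeat destruct Rle_dec; repeat destruct Rcase_abs; lra. Qed.

Lemma logit_mvt x y : k0 <= x <= 1 - k0 -> k0 <= y <= 1 - k0 ->
  exists d, 1 <= d <= / (k0 * k0) /\ logit y - logit x = d * (y - x).
Proof.
  intros hx hy.
  assert (hr : forall c, Rmin x y <= c <= Rmax x y -> k0 <= c <= 1 - k0).
  { intros c; unfold Rmin, Rmax; destruct Rle_dec; lra. }
  destruct (MVT_gen logit x y (fun c => / (c * (1 - c)))) as [c [hc e]].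
  - intros c hc. apply is_derive_logit. specialize (hr c ltac:(lra)). lra.
  - intros c hc. apply continuity_pt_filterlim.
    apply (ex_derive_continuous (V := R_NormedModule) logit c). eexists; apply is_derive_logit.
    specialize (hr c ltac:(lra)). lra.
  - exists (/ (c * (1 - c))). split; auto. specialize (hr c hc).
    assert (k0 * k0 <= c * (1 - c)) by (apply Rmult_le_compat; lra).
    assert (0 < k0 * k0) by nra. split.
    + rewrite <- Rinv_1. apply Rinv_le_contravar; nra.
    + apply Rinv_le_contravar; auto.
Qed.

Definition clogit (x : R) : R := logit (clip x).

Lemma clogit_lip x y : Rabs (clogit y - clogit x) <= / (k0 * k0) * Rabs (y - x).
Proof.
  destruct (logit_mvt (clip x) (clip y)) as [d [hd e]]; try apply clip_range.
  unfold clogit. rewrite e, Rabs_mult, (Rabs_pos_eq d) by lra.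
  apply Rmult_le_compat; try apply Rabs_pos; try lra. apply clip_lip.
Qed.

(* Outside of the range of the best responses the logit is replaced by a constant;
   monotonicity between a best response [b] and an arbitrary [x] survives. *)
Lemma clogit_monotone b x : 2 * k0 <= b <= 1 - 2 * k0 -> 0 <= x <= 1 ->
  k0 * ((b - x) * (b - x)) <= (clogit b - clogit x) * (b - x).
Proof.
  intros hb hx. unfold clogit. rewrite (clip_id b) by lra.
  destruct (logit_mvt (clip x) b) as [d [hd e]]; [apply clip_range|lra|].
  rewrite e.
  assert (h : k0 * ((b - x) * (b - x)) <= (b - clip x) * (b - x)).
  { destruct (Rlt_le_dec x k0) as [h1|h1]; [|destruct (Rlt_le_dec (1 - k0) x) as [h2|h2]].
    - replace (clip x) with k0 by (unfold clip, Rmax, Rmin; repeat destruct Rle_dec; lra).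
      rewrite <- Rmult_assoc. apply Rmult_le_compat_r; [lra|]. nra.
    - replace (clip x) with (1 - k0) by (unfold clip, Rmax, Rmin; repeat destruct Rle_dec; lra).
      replace (k0 * ((b - x) * (b - x))) with ((k0 * (x - b)) * (x - b)) by ring.
      replace ((b - (1 - k0)) * (b - x)) with ((1 - k0 - b) * (x - b)) by ring.
      apply Rmult_le_compat_r; [lra|]. nra.
    - rewrite clip_id by lra. pose proof (Rle_0_sqr (b - x)) as h; unfold Rsqr in h. nra. }
  assert (0 <= k0 * ((b - x) * (b - x))) by (apply Rmult_le_pos; [lra|apply Rle_0_sqr]).
  nra.
Qed.

Lemma clogit_continuous x : continuous clogit x.
Proof.
  assert (h0 : 0 < / (k0 * k0)) by (apply Rinv_0_lt_compat; nra).
  apply continuity_pt_filterlim. intros eps he.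
  exists (eps * (k0 * k0)). split; [apply Rmult_gt_0_compat; auto; nra|].
  intros y [_ hy]. simpl in *. unfold R_dist in *.
  eapply Rle_lt_trans; [apply clogit_lip|].
  apply Rmult_lt_reg_l with (k0 * k0); [nra|].
  rewrite <- Rmult_assoc, Rinv_r; nra.
Qed.

(** On [[k0, 1 - k0]] this is, up to a constant, the entropy [- x ln x - (1 - x) ln (1 - x)];
    outside it continues affinely. *)
Definition entropy (x : R) : R := - RInt clogit 0 x.

Lemma entropy_derive x : is_derive entropy x (- clogit x).
Proof.
  apply (is_derive_opp (fun x => RInt clogit 0 x)).
  apply (is_derive_RInt clogit (fun x => RInt clogit 0 x) 0).
  - exists (mkposreal 1 Rlt_0_1). intros y _.
    apply (RInt_correct (V := R_CompleteNormedModule)).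
    apply (ex_RInt_continuous (V := R_CompleteNormedModule)); intros; apply clogit_continuous.
  - apply clogit_continuous.
Qed.

Lemma entropy_taylor x y :
  Rabs (entropy y - entropy x + clogit x * (y - x)) <= / (k0 * k0) * ((y - x) * (y - x)).
Proof.
  destruct (MVT_gen entropy x y (fun c => - clogit c)) as [c [hc e]].
  - intros; apply entropy_derive.
  - intros c _. apply continuity_pt_filterlim.
    apply (ex_derive_continuous (V := R_NormedModule) entropy c). eexists; apply entropy_derive.
  - rewrite e. replace (- clogit c * (y - x) + clogit x * (y - x)) with
      (- ((clogit c - clogit x) * (y - x))) by ring.
    rewrite Rabs_Ropp, Rabs_mult. pose proof (clogit_lip x c) as h.
    assert (h0 : 0 < / (k0 * k0)) by (apply Rinv_0_lt_compat; nra).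
    assert (h1 : Rabs (c - x) <= Rabs (y - x)).
    { revert hc; unfold Rmin, Rmax, Rabs; destruct (Rle_dec x y); repeat destruct Rcase_abs; lra. }
    rewrite <- (Rabs_pos_eq ((y - x) * (y - x))) by apply Rle_0_sqr.
    rewrite Rabs_mult, <- Rmult_assoc. apply Rmult_le_compat_r; [apply Rabs_pos|].
    eapply Rle_trans; [apply h|]. apply Rmult_le_compat_l; lra.
Qed.

Lemma entropy_bounded : exists c, forall x, 0 <= x <= 1 -> Rabs (entropy x) <= c.
Proof.
  exists (Rabs (entropy 0) + Rabs (clogit 0) + / (k0 * k0)). intros x hx.
  pose proof (entropy_taylor 0 x) as h. rewrite Rminus_0_r in h.
  assert (h0 : 0 < / (k0 * k0)) by (apply Rinv_0_lt_compat; nra).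
  assert (h1 : / (k0 * k0) * (x * x) <= / (k0 * k0) * 1) by (apply Rmult_le_compat_l; nra).
  assert (h2 : Rabs (clogit 0 * x) <= Rabs (clogit 0)).
  { rewrite Rabs_mult, (Rabs_pos_eq x) by lra. pose proof (Rabs_pos (clogit 0)). nra. }
  replace (entropy x) with ((entropy x - entropy 0 + clogit 0 * x) + entropy 0 + - (clogit 0 * x)) by ring.
  eapply Rle_trans; [apply Rabs_triang|]. rewrite Rabs_Ropp.
  pose proof (Rabs_triang (entropy x - entropy 0 + clogit 0 * x) (entropy 0)). lra.
Qed.

End ClippedLogit.

Section AlmostSureConvergence.
Context (N : nat) (u : nat -> R) (lam : R) (a0 : nat -> bool) (hl : 0 < lam) (hN : (1 <= N)%nat).

Let k0 : R := (1 - BRmax N u lam) / 2.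

Lemma k0_range : 0 < k0 <= 1 / 4.
Proof.
  pose proof (sigma_bounds (2 * umass N u / lam)) as h. unfold k0, BRmax.
  assert (hx : in_Delta N (fun _ => 0)) by (intros i _; lra).
  pose proof (BR_in_range N u lam 0 (fun _ => 0) hl hx) as h'. unfold BRmax in h'. lra.
Qed.

Lemma BR_k0 i x : in_Delta N x -> 2 * k0 <= BR N u lam i x <= 1 - 2 * k0.
Proof. intros hx. pose proof (BR_in_range N u lam i x hl hx). unfold k0. lra. Qed.

Definition lyapunov (x : nat -> R) : R := U N u x + lam * rsum N (fun i => entropy k0 (x i)).

Lemma lyapunov_bounded : exists c, forall x, in_Delta N x -> Rabs (lyapunov x) <= c.
Proof.
  destruct (entropy_bounded k0 k0_range) as [c hc].
  exists (umass N u + lam * (INR N * c)). intros x hx. unfold lyapunov.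
  eapply Rle_trans; [apply Rabs_triang|]. apply Rplus_le_compat; [now apply U_bound|].
  rewrite Rabs_mult, (Rabs_pos_eq lam) by lra. apply Rmult_le_compat_l; [lra|].
  eapply Rle_trans; [apply rsum_abs|]. apply rsum_le_const; auto.
Qed.

Lemma lyapunov_ext x y : (forall i, (i < N)%nat -> x i = y i) -> lyapunov x = lyapunov y.
Proof.
  intros h. unfold lyapunov. rewrite (U_ext_x N u x y h). do 2 f_equal.
  apply rsum_ext; intros i hi; now rewrite h.
Qed.

Lemma move_in_Delta x g a : in_Delta N x -> 0 <= g <= 1 -> in_Delta N (move x g a).
Proof.
  intros hx hg i hi. specialize (hx i hi). pose proof (ind_bounds (a i)). unfold move. nra.
Qed.

(** As [Dg] is [lam] times the logit of the best response, the partial derivatives of [lyapunov] are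
    [lam * (clogit (BR) - clogit (x))], and [clogit_monotone] bounds their product with [BR - x]
    from below. The second order terms give [C * g^2]. *)
Lemma lyapunov_drift : exists C, 0 <= C /\ forall x g, in_Delta N x -> 0 <= g <= 1 ->
  lyapunov x + g * (lam * k0 * sqn N (field N u lam x)) - C * (g * g) <=
  Ex N (fun i => BR N u lam i x) (fun a => lyapunov (move x g a)).
Proof.
  pose proof k0_range as hk.
  set (M := / (k0 * k0)). assert (hM : 0 < M) by (apply Rinv_0_lt_compat; nra).
  set (m := umass N u). assert (hm : 0 <= m) by apply umass_nonneg.
  set (n := INR N). assert (hn : 0 <= n) by apply pos_INR.
  exists (4 * m * (n * n) + lam * (n * M)). split.
  { apply Rplus_le_le_0_compat; repeat apply Rmult_le_pos; lra. }
  intros x g hx hg.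
  set (G := fun i => Dg N u i x - lam * clogit k0 (x i)).
  assert (hone : forall a, lyapunov x + g * rsum N (fun i => G i * (ind (a i) - x i)) -
     (4 * m * (n * n) + lam * (n * M)) * (g * g) <= lyapunov (move x g a)).
  { intros a. pose proof (move_in_Delta x g a hx hg) as hy.
    pose proof (U_taylor N u x (move x g a) hx hy) as hU. fold m in hU.
    assert (hd : forall i, (i < N)%nat -> Rabs (move x g a i - x i) <= g).
    { intros i hi. specialize (hx i hi). pose proof (ind_bounds (a i)). unfold move.
      replace (x i + g * (ind (a i) - x i) - x i) with (g * (ind (a i) - x i)) by ring.
      rewrite Rabs_mult, (Rabs_pos_eq g) by lra.
      assert (Rabs (ind (a i) - x i) <= 1) by (apply Rabs_le; lra). nra. }
    set (dl := l1 N (fun i => move x g a i - x i)) in *.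
    assert (hl1 : 0 <= dl <= n * g) by (split; [apply l1_nonneg|now apply rsum_le_const]).
    assert (hdd : 4 * m * (dl * dl) <= 4 * m * (n * n) * (g * g)).
    { replace (4 * m * (n * n) * (g * g)) with (4 * m * ((n * g) * (n * g))) by ring.
      apply Rmult_le_compat_l; [lra|]. apply Rmult_le_compat; lra. }
    assert (hE : Rabs (rsum N (fun i => entropy k0 (move x g a i)) - rsum N (fun i => entropy k0 (x i))
       + rsum N (fun i => clogit k0 (x i) * (move x g a i - x i))) <= n * (M * (g * g))).
    { rewrite <- rsum_minus, <- rsum_plus. eapply Rle_trans; [apply rsum_abs|].
      apply rsum_le_const; intros i hi.
      eapply Rle_trans; [apply (entropy_taylor k0 hk)|]. fold M. apply Rmult_le_compat_l; [lra|].
      specialize (hd i hi). rewrite <- (Rabs_pos_eq (_ * _)) by apply Rle_0_sqr.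
      rewrite Rabs_mult. pose proof (Rabs_pos (move x g a i - x i)). apply Rmult_le_compat; auto. }
    apply Rabs_le_between in hU. apply Rabs_le_between in hE.
    assert (hG : g * rsum N (fun i => G i * (ind (a i) - x i)) =
      rsum N (fun j => Dg N u j x * (move x g a j - x j)) -
      lam * rsum N (fun i => clogit k0 (x i) * (move x g a i - x i))).
    { rewrite <- !rsum_scal, <- rsum_minus. apply rsum_ext; intros i hi. unfold G, move. ring. }
    rewrite hG. unfold lyapunov.
    set (A := rsum N (fun i => entropy k0 (move x g a i))) in *.
    set (B := rsum N (fun i => entropy k0 (x i))) in *.
    set (D := rsum N (fun i => clogit k0 (x i) * (move x g a i - x i))) in *.
    assert (lam * (A - B + D) >= lam * - (n * (M * (g * g)))) by (apply Rle_ge, Rmult_le_compat_l; lra).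
    lra. }
  eapply Rle_trans; [|apply Ex_le with (G := fun a => lyapunov x +
    g * rsum N (fun i => G i * (ind (a i) - x i)) - (4 * m * (n * n) + lam * (n * M)) * (g * g)); auto].
  2:{ intros i _. pose proof (BR_bounds N u lam i x); lra. }
  rewrite Ex_minus, Ex_plus, Ex_scal, !Ex_const, Ex_rsum.
  apply Rplus_le_compat_r, Rplus_le_compat_l, Rmult_le_compat_l; [lra|].
  unfold sqn. rewrite <- rsum_scal. apply rsum_le; intros i hi.
  rewrite Ex_scal, Ex_centered by auto. fold (field N u lam x i).
  assert (hGi : G i = lam * (clogit k0 (BR N u lam i x) - clogit k0 (x i))).
  { unfold G. pose proof (BR_k0 i x hx). unfold clogit at 2. rewrite clip_id by (auto; lra).
    rewrite BR_sigma, logit_sigma by lra. field. lra. }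
  rewrite hGi. unfold field.
  pose proof (clogit_monotone k0 hk (BR N u lam i x) (x i) (BR_k0 i x hx) (hx i hi)) as h.
  replace (lam * k0 * ((BR N u lam i x - x i) * (BR N u lam i x - x i))) with
    (lam * (k0 * ((BR N u lam i x - x i) * (BR N u lam i x - x i)))) by ring.
  rewrite Rmult_assoc. apply Rmult_le_compat_l; lra.
Qed.

(** * Almost sure finiteness of the energy and convergence of the noise *)

Definition energy (n : nat) (w : path) : R :=
  rsum n (fun k => / INR (S k) * sqn N (field N u lam (emp a0 w k))).

Lemma field_ext x y i : (forall j, (j < N)%nat -> x j = y j) -> (i < N)%nat ->
  field N u lam x i = field N u lam y i.
Proof. intros h hi. unfold field. now rewrite (BR_ext N u lam i x y h), h. Qed.

Lemma sqn_field_ext x y : (forall j, (j < N)%nat -> x j = y j) ->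
  sqn N (field N u lam x) = sqn N (field N u lam y).
Proof. intros h. apply rsum_ext; intros i hi. now rewrite (field_ext x y i h hi). Qed.

Lemma energy_adapted : adapted N energy.
Proof.
  intros n w w' h. apply rsum_ext; intros k hk. f_equal. apply sqn_field_ext; intros j hj.
  apply (emp_agree N); auto. apply (agree_le N k n); auto; lia.
Qed.

(** A telescoping majorant of squared steps: adding a multiple of [2 / (n + 1)] to a process
    compensates an upward drift of order [1 / (n + 1)^2]. *)
Lemma tail_step n : / INR (S n) * / INR (S n) <= 2 * / INR (S n) - 2 * / INR (S (S n)).
Proof.
  assert (h : 1 <= INR (S n)) by (apply INR_ge_1; lia).
  rewrite (S_INR (S n)). set (t := INR (S n)) in *.
  apply Rmult_le_reg_r with (t * t * (t + 1)); [apply Rmult_lt_0_compat; nra|].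
  replace (/ t * / t * (t * t * (t + 1))) with (t + 1) by (field; lra).
  replace ((2 * / t - 2 * / (t + 1)) * (t * t * (t + 1))) with (2 * t) by (field; lra). lra.
Qed.

(** The gap [c - lyapunov], plus a multiple of the energy, plus the compensator of [tail_step], is a
    nonnegative supermartingale with initial value at most [K]; it reaches [K / eps] with
    probability at most [eps]. *)
Lemma energy_unbounded_negligible :
  negligible (cylwt N u lam a0) (cylmem N) (fun w => forall A, exists m, A <= energy m w).
Proof.
  destruct lyapunov_drift as [C [hC hdrift]]. destruct lyapunov_bounded as [c hc].
  pose proof k0_range as hk. set (k := lam * k0) in *. assert (hkp : 0 < k) by (unfold k; nra).
  intros eps heps.
  assert (hc0 : 0 <= c).
  { eapply Rle_trans; [apply Rabs_pos|apply (hc (fun _ => 0))]. intros i _; lra. }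
  pose (K := 2 * c + 2 * C + 1). assert (hK : 0 < K) by (unfold K; lra).
  pose (A := K / eps). assert (hA : 0 < A) by (now apply Rdiv_lt_0_compat).
  pose (f := fun n w => (c - lyapunov (emp a0 w n) + k * energy n w + C * (2 * / INR (S n))) / A).
  assert (hen : forall n w, 0 <= energy n w).
  { intros n w. apply rsum_nonneg; intros i hi. pose proof (inv_S_bounds i).
    apply Rmult_le_pos; [lra|apply sqn_nonneg]. }
  assert (hcl : forall n w, 0 <= c - lyapunov (emp a0 w n)).
  { intros n w. pose proof (hc _ (emp_in_Delta N a0 w n)) as h. apply Rabs_le_between in h. lra. }
  apply covered_mono with (fun w => exists n, (0 <= n)%nat /\ 1 <= f n w /\
    forall j, (0 <= j < n)%nat -> True) eps; [| lra |].
  { intros w h. destruct (h (A / k)) as [n hn]. exists n. repeat split; auto; [lia|].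
    unfold f. apply Rmult_le_reg_r with A; auto. unfold Rdiv at 1. rewrite Rmult_assoc, Rinv_l, Rmult_1_l, Rmult_1_r by lra.
    assert (A <= k * energy n w).
    { replace A with (k * (A / k)) by (field; lra). apply Rmult_le_compat_l; lra. }
    pose proof (hcl n w). pose proof (inv_S_bounds n). nra. }
  apply (maximal_inequality N u lam a0 f (fun _ _ => True) 0 eps); try lra.
  - intros n w w' h. unfold f. rewrite (energy_adapted n w w' h).
    rewrite (lyapunov_ext (emp a0 w n) (emp a0 w' n)); auto. intros; now apply (emp_agree N).
  - intros n w w' h; auto.
  - intros n w. unfold f. apply Rdiv_le_0_compat; auto.
    pose proof (hcl n w). pose proof (hen n w). pose proof (inv_S_bounds n).
    assert (0 <= k * energy n w) by nra. assert (0 <= C * (2 * / INR (S n))) by nra. lra.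
  - intros n w _ _. set (x := emp a0 w n). set (g := / INR (S n)).
    assert (hg : 0 < g <= 1) by apply inv_S_bounds.
    unfold step. fold x.
    rewrite (Ex_ext N _ _ (fun a => / A * ((c + k * (energy n w + g * sqn N (field N u lam x)) +
       C * (2 * / INR (S (S n)))) - lyapunov (move x g a)))).
    2:{ intros a. unfold f.
        assert (e : energy (S n) (setp w (S n) a) = energy n w + g * sqn N (field N u lam x)).
        { unfold energy. cbn [rsum]. f_equal.
          - apply rsum_ext; intros j hj. f_equal. apply sqn_field_ext; intros; apply emp_setp; lia.
          - unfold g. f_equal. apply sqn_field_ext; intros; apply emp_setp; lia. }
        rewrite e. rewrite (lyapunov_ext (emp a0 (setp w (S n) a) (S n)) (move x g a)).
        - unfold Rdiv. ring.
        - intros; apply emp_setp_S. }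
    rewrite Ex_scal, Ex_minus, Ex_const. unfold f. fold x g. unfold Rdiv. rewrite Rmult_comm.
    apply Rmult_le_compat_r; [apply Rlt_le, Rinv_0_lt_compat; auto|].
    pose proof (hdrift x g (emp_in_Delta N a0 w n) ltac:(lra)) as hd.
    pose proof (tail_step n) as ht. fold g in ht.
    assert (C * (g * g) <= C * (2 * g - 2 * / INR (S (S n)))) by (apply Rmult_le_compat_l; auto).
    lra.
  - intros w. unfold f. apply Rmult_le_reg_r with A; auto. unfold Rdiv at 1.
    rewrite Rmult_assoc, Rinv_l, Rmult_1_r by lra. unfold A.
    replace (eps * (K / eps)) with K by (field; lra).
    pose proof (hc _ (emp_in_Delta N a0 w 0)) as h. apply Rabs_le_between in h.
    replace (energy 0 w) with 0 by reflexivity. replace (/ INR 1) with 1 by (simpl; field).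
    unfold K. lra.
Qed.

(** The martingale part of the recursion restarted at [n0]: dropping earlier terms makes it start
    from 0 at that time. *)
Definition noise (i n0 n : nat) (w : path) : R :=
  rsum n (fun k => if Nat.ltb k n0 then 0 else / INR (S k) * (ind (w (S k) i) - BR N u lam i (emp a0 w k))).

Lemma noise_start i n0 w : noise i n0 n0 w = 0.
Proof. apply rsum_0; intros k hk. destruct (Nat.ltb_spec k n0); [auto|lia]. Qed.

Lemma noise_S i n0 n w : (n0 <= n)%nat -> noise i n0 (S n) w =
  noise i n0 n w + / INR (S n) * (ind (w (S n) i) - BR N u lam i (emp a0 w n)).
Proof. intros h. unfold noise; cbn [rsum]. destruct (Nat.ltb_spec n n0); [lia|auto]. Qed.

Lemma noise_adapted i n0 : (i < N)%nat -> adapted N (noise i n0).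
Proof.
  intros hi n w w' h. apply rsum_ext; intros k hk. destruct (Nat.ltb k n0); auto.
  rewrite (h (S k)) by (auto; lia).
  rewrite (BR_ext N u lam i (emp a0 w k) (emp a0 w' k)); auto.
  intros j hj. apply (emp_agree N); auto. apply (agree_le N k n); auto; lia.
Qed.

(** Kolmogorov's inequality: the square of the noise, plus [2 / (n + 1)] for its future variance, is
    a supermartingale that starts at [2 / (n0 + 1)], arbitrarily small for large [n0]. *)
Lemma noise_oscillation_negligible i eta : (i < N)%nat -> 0 < eta ->
  negligible (cylwt N u lam a0) (cylmem N)
    (fun w => forall n0, exists m, (n0 <= m)%nat /\ eta <= Rabs (noise i n0 m w)).
Proof.
  intros hi heta eps heps.
  destruct (INR_unbounded (2 / (eps * (eta * eta)))) as [n0 hn0].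
  assert (hee : 0 < eta * eta) by nra. assert (hee' : 0 < eps * (eta * eta)) by nra.
  pose (f := fun n w => (noise i n0 n w * noise i n0 n w + 2 * / INR (S n)) / (eta * eta)).
  apply covered_mono with (fun w => exists n, (n0 <= n)%nat /\ 1 <= f n w /\
    forall j, (n0 <= j < n)%nat -> True) eps; [| lra |].
  { intros w h. destruct (h n0) as [n [hn hn']]. exists n. repeat split; auto.
    unfold f. apply Rmult_le_reg_r with (eta * eta); auto.
    unfold Rdiv. rewrite Rmult_assoc, Rinv_l, Rmult_1_l, Rmult_1_r by lra.
    pose proof (inv_S_bounds n). rewrite <- (Rabs_pos_eq (noise i n0 n w * _)), Rabs_mult by apply Rle_0_sqr.
    nra. }
  apply (maximal_inequality N u lam a0 f (fun _ _ => True) n0 eps); try lra.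
  - intros n w w' h. unfold f. now rewrite (noise_adapted i n0 hi n w w' h).
  - intros n w w' h; auto.
  - intros n w. unfold f. apply Rdiv_le_0_compat; auto. pose proof (inv_S_bounds n).
    pose proof (Rle_0_sqr (noise i n0 n w)) as h; unfold Rsqr in h. lra.
  - intros n w hn _. set (x := emp a0 w n). set (g := / INR (S n)).
    assert (hg : 0 < g <= 1) by apply inv_S_bounds.
    unfold step. fold x. set (p := fun i => BR N u lam i x). set (W := noise i n0 n w).
    rewrite (Ex_ext N _ _ (fun a => / (eta * eta) * (((W * W + 2 * / INR (S (S n))) +
       (2 * W * g) * (ind (a i) - p i)) + (g * g) * ((ind (a i) - p i) * (ind (a i) - p i))))).
    2:{ intros a. unfold f.
        assert (e : noise i n0 (S n) (setp w (S n) a) = W + g * (ind (a i) - p i)).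
        { rewrite noise_S, setp_same by auto.
          rewrite (noise_adapted i n0 hi n (setp w (S n) a) w).
          2:{ intros s hs j hj. rewrite setp_other by lia; auto. }
          rewrite (BR_ext N u lam i (emp a0 (setp w (S n) a) n) x); [reflexivity|].
          intros; apply emp_setp; lia. }
        rewrite e. unfold Rdiv. ring. }
    rewrite Ex_scal, !Ex_plus, !Ex_scal, Ex_const, Ex_centered, Ex_product, Nat.eqb_refl by auto.
    unfold f, Rdiv. fold W g. rewrite Rmult_comm.
    apply Rmult_le_compat_r; [apply Rlt_le, Rinv_0_lt_compat; auto|].
    pose proof (tail_step n) as ht. fold g in ht.
    pose proof (BR_bounds N u lam i x) as hp. fold (p i) in hp.
    assert (p i * (1 - p i) <= 1) by nra.
    assert (g * g * (p i * (1 - p i)) <= g * g * 1) by (apply Rmult_le_compat_l; nra).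
    rewrite Ex_const. lra.
  - intros w. unfold f. rewrite noise_start, S_INR.
    assert (h0 : 0 <= INR n0) by apply pos_INR.
    apply Rmult_le_reg_r with ((eta * eta) * (INR n0 + 1)); [nra|].
    replace ((0 * 0 + 2 * / (INR n0 + 1)) / (eta * eta) * (eta * eta * (INR n0 + 1))) with 2 by (field; lra).
    replace 2 with (2 / (eps * (eta * eta)) * (eps * (eta * eta))) by (field; lra).
    replace (eps * (eta * eta * (INR n0 + 1))) with ((INR n0 + 1) * (eps * (eta * eta))) by ring.
    apply Rmult_le_compat_r; lra.
Qed.

End AlmostSureConvergence.

(** * Convergence of paths with finite energy and convergent noise *)

Lemma bounded_increasing_cauchy (s : nat -> R) A : (forall n, s n <= s (S n)) -> (forall n, s n <= A) ->
  forall e, 0 < e -> exists n0, forall n m, (n0 <= n)%nat -> (n <= m)%nat -> s m - s n < e.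
Proof.
  intros hs hA e he.
  assert (hmono : forall n m, (n <= m)%nat -> s n <= s m).
  { induction 1; [lra|]. specialize (hs m); lra. }
  apply NNPP; intros hn.
  assert (h : forall k : nat, exists n, s O + INR k * e <= s n).
  { induction k as [|k [n IH]]; [exists O; simpl; lra|].
    apply not_ex_all_not with (n := n) in hn. apply not_all_ex_not in hn. destruct hn as [n1 hn].
    apply not_all_ex_not in hn. destruct hn as [m hn].
    apply imply_to_and in hn. destruct hn as [h1 hn]. apply imply_to_and in hn. destruct hn as [h2 hn].
    exists m. rewrite S_INR. specialize (hmono n n1 h1). lra. }
  destruct (INR_unbounded ((A - s O) / e)) as [k hk]. destruct (h k) as [n hkn].
  specialize (hA n).
  assert ((A - s O) / e * e < INR k * e) by (apply Rmult_lt_compat_r; auto).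
  replace ((A - s O) / e * e) with (A - s O) in H by (field; lra). lra.
Qed.

Lemma intermediate_index (s : nat -> R) d T J : 0 < T -> s O = 0 -> (forall j, s (S j) <= s j + d) -> d <= T ->
  T <= s J -> exists j, T <= s j <= 2 * T.
Proof.
  intros hT h0 hs hd. induction J; intros hJ; [lra|].
  destruct (Rle_dec T (s J)); auto. exists (S J). specialize (hs J). lra.
Qed.

(** Extraction coordinate by coordinate. Domination of the identity is the property that composes: a
    later extraction keeps the earlier limits because [psi n] is at least [n]. *)
Lemma bolzano_weierstrass_cube N (y : nat -> nat -> R) : (forall n, in_Delta N (y n)) ->
  exists (phi : nat -> nat) z, (forall n, (n <= phi n)%nat) /\
    forall e, 0 < e -> exists M, forall n, (M <= n)%nat -> forall i, (i < N)%nat -> Rabs (y (phi n) i - z i) < e.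
Proof.
  induction N; intros hy.
  - exists (fun n => n), (fun _ => 0). split; [lia|]. intros; exists O; intros; lia.
  - destruct IHN as [phi [z [hphi hz]]]; [intros n i hi; apply hy; lia|].
    destruct (Bolzano_Weierstrass (fun n => y (phi n) N) (fun x => 0 <= x <= 1)) as [l hl].
    + apply compact_P3.
    + intros n; apply (hy (phi n) N); lia.
    + assert (hsel : forall n, exists p, (n <= p)%nat /\ Rabs (y (phi p) N - l) < / INR (S n)).
      { intros n. destruct (inv_S_bounds n) as [hpos _].
        apply (hl (fun x => Rabs (x - l) < / INR (S n)) n).
        exists (mkposreal _ hpos). intros x hx. exact hx. }
      pose (psi := fun n => proj1_sig (constructive_indefinite_description _ (hsel n))).
      assert (hpsi : forall n, (n <= psi n)%nat /\ Rabs (y (phi (psi n)) N - l) < / INR (S n)).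
      { intros n; unfold psi; now destruct constructive_indefinite_description. }
      exists (fun n => phi (psi n)), (upd z N l). split.
      * intros n. destruct (hpsi n). specialize (hphi (psi n)). lia.
      * intros e he. destruct (hz e he) as [M hM]. destruct (INR_unbounded (/ e)) as [K hK].
        exists (Nat.max M K). intros n hn i hi. destruct (hpsi n) as [h1 h2].
        destruct (Nat.eq_dec i N) as [->|ne].
        -- rewrite upd_same. eapply Rlt_trans; [apply h2|].
           rewrite <- (Rinv_inv e). apply Rinv_lt_contravar.
           ++ apply Rmult_lt_0_compat; [apply Rinv_0_lt_compat; auto|apply lt_0_INR; lia].
           ++ apply Rlt_le_trans with (INR K); auto. apply le_INR; lia.
        -- rewrite upd_other by auto. apply hM; lia.
Qed.

Section Deterministic.
Context (N : nat) (u : nat -> R) (lam : R) (a0 : nat -> bool) (hl : 0 < lam) (hN : (1 <= N)%nat).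
Context (w : path).

Let x (n : nat) : nat -> R := emp a0 w n.

Context (A : R) (h_energy : forall m, energy N u lam a0 m w <= A).
Context (h_noise : forall i eta, (i < N)%nat -> 0 < eta ->
  exists n0, forall m, (n0 <= m)%nat -> Rabs (noise N u lam a0 i n0 m w) < eta).

Lemma noise_uniform eta : 0 < eta -> exists n0, forall i n m, (i < N)%nat -> (n0 <= n)%nat -> (n <= m)%nat ->
  Rabs (rsum (m - n) (fun k => / INR (S (n + k)) * (ind (w (S (n + k)) i) - BR N u lam i (x (n + k)))))  < eta.
Proof.
  intros heta.
  assert (h : forall K, (K <= N)%nat -> exists n0, forall i n m, (i < K)%nat -> (n0 <= n)%nat -> (n <= m)%nat ->
    Rabs (rsum (m - n) (fun k => / INR (S (n + k)) * (ind (w (S (n + k)) i) - BR N u lam i (x (n + k)))))  < eta).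
  { induction K; intros hK; [exists O; intros; lia|].
    destruct IHK as [n0 hn0]; [lia|]. destruct (h_noise K (eta / 2)) as [n1 hn1]; [lia|lra|].
    exists (Nat.max n0 n1). intros i n m hi hn hm.
    destruct (Nat.eq_dec i K) as [->|ne]; [|apply hn0; auto; lia].
    assert (e : rsum (m - n) (fun k => / INR (S (n + k)) * (ind (w (S (n + k)) K) - BR N u lam K (x (n + k)))) =
      noise N u lam a0 K n1 m w - noise N u lam a0 K n1 n w).
    { unfold noise. replace m with (n + (m - n))%nat at 2 by lia. rewrite rsum_split.
      replace (rsum n _ + _ - rsum n _) with (rsum (m - n) (fun i => if Nat.ltb (n + i) n1 then 0 else
        / INR (S (n + i)) * (ind (w (S (n + i)) K) - BR N u lam K (emp a0 w (n + i))))) by ring.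
      apply rsum_ext; intros k hk. destruct (Nat.ltb_spec (n + k) n1); [lia|reflexivity]. }
    rewrite e.
    pose proof (hn1 m ltac:(lia)). pose proof (hn1 n ltac:(lia)).
    unfold Rminus. eapply Rle_lt_trans; [apply Rabs_triang|]. rewrite Rabs_Ropp. lra. }
  destruct (h N (le_n N)) as [n0 hn0]. exists n0; auto.
Qed.

Lemma x_increment n j i : x (n + j) i - x n i =
  rsum j (fun k => / INR (S (n + k)) * field N u lam (x (n + k)) i) +
  rsum j (fun k => / INR (S (n + k)) * (ind (w (S (n + k)) i) - BR N u lam i (x (n + k)))).
Proof.
  induction j; [rewrite Nat.add_0_r; simpl; ring|].
  cbn [rsum]. rewrite Nat.add_succ_r. unfold x at 1. rewrite emp_S. fold (x (n + j)).
  replace (x (n + j) i + / INR (S (n + j)) * (ind (w (S (n + j)) i) - x (n + j) i) - x n i) with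
    ((x (n + j) i - x n i) + / INR (S (n + j)) * (ind (w (S (n + j)) i) - x (n + j) i)) by ring.
  rewrite IHj. unfold field. ring.
Qed.

Lemma x_in_Delta n : in_Delta N (x n).
Proof. apply emp_in_Delta. Qed.

Lemma field_abs_le_1 y i : (i < N)%nat -> in_Delta N y -> Rabs (field N u lam y i) <= 1.
Proof.
  intros hi hy. pose proof (BR_bounds N u lam i y). specialize (hy i hi). unfold field. apply Rabs_le; lra.
Qed.

Lemma x_move_le eta n0 : (forall i n m, (i < N)%nat -> (n0 <= n)%nat -> (n <= m)%nat ->
  Rabs (rsum (m - n) (fun k => / INR (S (n + k)) * (ind (w (S (n + k)) i) - BR N u lam i (x (n + k)))))  < eta) ->
  forall n j i, (n0 <= n)%nat -> (i < N)%nat ->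
  Rabs (x (n + j) i - x n i) <= rsum j (fun k => / INR (S (n + k))) + eta.
Proof.
  intros h n j i hn hi. rewrite x_increment.
  eapply Rle_trans; [apply Rabs_triang|]. apply Rplus_le_compat.
  - eapply Rle_trans; [apply rsum_abs|]. apply rsum_le; intros k hk.
    pose proof (inv_S_bounds (n + k)). rewrite Rabs_mult, Rabs_pos_eq by lra.
    pose proof (field_abs_le_1 (x (n + k)) i hi (x_in_Delta _)). nra.
  - specialize (h i n (n + j)%nat hi hn ltac:(lia)). replace (n + j - n)%nat with j in h by lia. lra.
Qed.

Lemma harmonic_tail_unbounded n B : exists j, B <= rsum j (fun k => / INR (S (n + k))).
Proof.
  destruct (harmonic_unbounded (B + rsum n (fun k => / INR (S k)))) as [m hm].
  exists m. rewrite <- (Nat.add_sub m n) in hm.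
  assert (h : rsum m (fun k => / INR (S k)) <= rsum (n + m) (fun k => / INR (S k))).
  { apply rsum_le_mono; [|lia]. intros i; pose proof (inv_S_bounds i); lra. }
  rewrite rsum_split in h. rewrite Nat.add_sub in hm. lra.
Qed.

(** If a component of the field is at least [b] at time [n], it stays above [b / 2] during a time
    window of length between [T] and [2 T], in which [x] hardly moves. This consumes energy
    [T * b^2 / 4], which is impossible late. *)
Lemma field_tends_to_0 b : 0 < b -> exists n1, forall n i, (n1 <= n)%nat -> (i < N)%nat ->
  Rabs (field N u lam (x n) i) < b.
Proof.
  intros hb.
  set (k := 4 * umass N u / lam + 1).
  assert (hk : 1 <= k).
  { unfold k. assert (0 <= umass N u / lam) by (apply Rdiv_le_0_compat; auto; apply umass_nonneg).
    unfold Rdiv in *; lra. }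
  set (nn := INR N). pose proof (INR_ge_1 N hN : 1 <= nn) as hnn.
  (* During the window [x] moves by at most [3 T]: [2 T] from the field, bounded by 1, and [T] from
     the noise. With this [T] the field changes by at most [b / 2]. *)
  set (T := b / (6 * (k * nn))).
  assert (hkn : 1 <= k * nn) by nra.
  assert (hT : 0 < T) by (apply Rdiv_lt_0_compat; lra).
  destruct (noise_uniform T hT) as [n0 hn0].
  destruct (bounded_increasing_cauchy (fun m => energy N u lam a0 m w) A) with (e := T * (b * b / 4)) as [n1 hn1].
  - intros n. unfold energy; cbn [rsum]. pose proof (inv_S_bounds n). pose proof (sqn_nonneg N (field N u lam (emp a0 w n))). nra.
  - auto.
  - apply Rmult_lt_0_compat; nra.
  - destruct (INR_unbounded (/ T)) as [n2 hn2].
    exists (Nat.max n0 (Nat.max n1 n2)). intros n i hn hi.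
    apply Rnot_le_lt. intros hbig.
    assert (hstep : forall j, / INR (S (n + j)) <= T).
    { intros j. rewrite <- (Rinv_inv T). apply Rinv_le_contravar; [now apply Rinv_0_lt_compat|].
      apply Rle_trans with (INR n2); [lra|]. apply le_INR; lia. }
    destruct (harmonic_tail_unbounded n T) as [J hJ].
    destruct (intermediate_index (fun j => rsum j (fun k => / INR (S (n + k)))) T T J) as [j hj]; auto.
    + intros j; cbn [rsum]. specialize (hstep j). lra.
    + lra.
    + assert (hF : forall q, (q < j)%nat -> b / 2 <= Rabs (field N u lam (x (n + q)) i)).
      { intros q hq.
        assert (hx : forall l, (l < N)%nat -> Rabs (x n l - x (n + q) l) <= 3 * T).
        { intros l hl'. rewrite Rabs_minus_sym.
          eapply Rle_trans; [apply (x_move_le T n0 hn0 n q l); auto; lia|].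
          assert (rsum q (fun k => / INR (S (n + k))) <= rsum j (fun k => / INR (S (n + k)))).
          { apply rsum_le_mono; [|lia]. intros a; pose proof (inv_S_bounds (n + a)); lra. }
          lra. }
        assert (hl1 : l1 N (diff (x n) (x (n + q))) <= nn * (3 * T)) by (now apply rsum_le_const).
        pose proof (field_lip N u lam hl i (x n) (x (n + q)) hi (x_in_Delta n) (x_in_Delta (n + q))) as hlip.
        fold k in hlip.
        assert (k * l1 N (diff (x n) (x (n + q))) <= b / 2).
        { apply Rle_trans with (k * (nn * (3 * T))); [apply Rmult_le_compat_l; lra|].
          right; unfold T; field. lra. }
        pose proof (Rabs_triang_inv (field N u lam (x n) i) (field N u lam (x (n + q)) i)).
        pose proof (Rabs_triang_inv (field N u lam (x n) i) (field N u lam (x n) i - field N u lam (x (n + q)) i)) as h2.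
        replace (field N u lam (x n) i - (field N u lam (x n) i - field N u lam (x (n + q)) i)) with
          (field N u lam (x (n + q)) i) in h2 by ring. lra. }
      assert (hen : T * (b * b / 4) <= energy N u lam a0 (n + j) w - energy N u lam a0 n w).
      { unfold energy. rewrite rsum_split.
        replace (rsum n _ + _ - rsum n _) with (rsum j (fun q => / INR (S (n + q)) *
          sqn N (field N u lam (emp a0 w (n + q))))) by ring.
        apply Rle_trans with (rsum j (fun q => (b * b / 4) * / INR (S (n + q)))).
        - rewrite rsum_scal, Rmult_comm. apply Rmult_le_compat_l; [nra|apply hj].
        - apply rsum_le; intros q hq. rewrite Rmult_comm. apply Rmult_le_compat_l.
          + pose proof (inv_S_bounds (n + q)); lra.
          + eapply Rle_trans; [|apply (sqr_le_sqn N _ i hi)]. specialize (hF q hq). unfold x in hF.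
            rewrite <- (Rabs_pos_eq (field _ _ _ _ _ * _)), Rabs_mult by apply Rle_0_sqr. nra. }
      specialize (hn1 n (n + j)%nat ltac:(lia) ltac:(lia)). lra.
Qed.

Context (h_isolated : forall z, ND N u lam z -> isolated_zero N u lam z).

(** A cluster point is a zero of the field by continuity. Isolation then separates the visited
    points near it from all others by a gap wider than the late steps, so the path cannot leave. *)
Lemma converges_to_ND : exists z, ND N u lam z /\ converges_to N x z.
Proof.
  destruct (bolzano_weierstrass_cube N x x_in_Delta) as [phi [z [hphi hcl]]].
  set (k := 4 * umass N u / lam + 1).
  assert (hk : 1 <= k).
  { unfold k. assert (0 <= umass N u / lam) by (apply Rdiv_le_0_compat; auto; apply umass_nonneg).
    unfold Rdiv in *; lra. }
  set (nn := INR N). pose proof (INR_ge_1 N hN : 1 <= nn) as hnn.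
  assert (hzD : in_Delta N z).
  { intros i hi. split; apply Rnot_lt_le; intros hlt.
    - destruct (hcl (- z i)) as [M hM]; [lra|]. specialize (hM M (le_n M) i hi).
      pose proof (x_in_Delta (phi M) i hi). apply Rabs_lt_between in hM. lra.
    - destruct (hcl (z i - 1)) as [M hM]; [lra|]. specialize (hM M (le_n M) i hi).
      pose proof (x_in_Delta (phi M) i hi). apply Rabs_lt_between in hM. lra. }
  assert (hz : ND N u lam z).
  { split; auto. intros i hi.
    assert (h0 : Rabs (field N u lam z i) <= 0).
    { apply le_epsilon; intros e he. rewrite Rplus_0_l.
      destruct (field_tends_to_0 (e / 2)) as [n1 hn1]; [lra|].
      destruct (hcl (e / (2 * (k * nn)))) as [M hM].
      { apply Rdiv_lt_0_compat; [lra|]. nra. }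
      set (n := Nat.max M n1). set (y := x (phi n)).
      pose proof (hphi n) as hpn.
      assert (h1 : Rabs (field N u lam y i) < e / 2) by (apply hn1; auto; unfold n in *; lia).
      assert (h2 : l1 N (diff z y) <= nn * (e / (2 * (k * nn)))).
      { apply rsum_le_const; intros j hj. unfold diff. rewrite Rabs_minus_sym.
        apply Rlt_le. apply hM; auto. unfold n; lia. }
      pose proof (field_lip N u lam hl i z y hi hzD (x_in_Delta (phi n))) as h3. fold k in h3.
      assert (h4 : k * l1 N (diff z y) <= e / 2).
      { apply Rle_trans with (k * (nn * (e / (2 * (k * nn))))); [apply Rmult_le_compat_l; lra|].
        right; field; lra. }
      replace (field N u lam z i) with ((field N u lam z i - field N u lam y i) + field N u lam y i) by ring.
      eapply Rle_trans; [apply Rabs_triang|]. lra. }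
    pose proof (Rabs_pos (field N u lam z i)).
    assert (h : field N u lam z i = 0).
    { destruct (Req_dec (field N u lam z i) 0); auto. pose proof (Rabs_pos_lt _ H0). lra. }
    unfold field in h. lra. }
  exists z; split; auto.
  destruct (h_isolated z hz) as [r [c [hr [hc hloc]]]].
  intros eps heps.
  set (r1 := Rmin r eps / 2).
  assert (hr1 : 0 < r1) by (unfold r1; assert (0 < Rmin r eps) by (now apply Rmin_glb_lt); lra).
  assert (hr1r : 2 * r1 <= r) by (unfold r1; pose proof (Rmin_l r eps); lra).
  assert (hr1e : 2 * r1 <= eps) by (unfold r1; pose proof (Rmin_r r eps); lra).
  set (b := Rmin 1 (c * (r1 * r1) / nn)).
  assert (hb : 0 < b).
  { unfold b; apply Rmin_glb_lt; [lra|]. apply Rdiv_lt_0_compat; [|lra]. apply Rmult_lt_0_compat; nra. }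
  destruct (field_tends_to_0 b hb) as [n1 hn1].
  destruct (INR_unbounded (/ r1)) as [n2 hn2].
  (* Once the field is small, being within [r] of [z] improves to being within [r1]. Steps are
     eventually at most [r1] and [2 * r1 <= r], so the path stays trapped. *)
  assert (hkey : forall n, (n1 <= n)%nat -> (forall i, (i < N)%nat -> Rabs (x n i - z i) <= r) ->
    forall i, (i < N)%nat -> Rabs (x n i - z i) <= r1).
  { intros n hn hnear i hi. specialize (hloc (x n) (x_in_Delta n) hnear).
    assert (h1 : sqn N (field N u lam (x n)) <= nn * b).
    { apply rsum_le_const; intros j hj. specialize (hn1 n j hn hj).
      set (f := field N u lam (x n) j) in *. rewrite <- (Rabs_pos_eq (f * f)), Rabs_mult by apply Rle_0_sqr.
      assert (b <= 1) by apply Rmin_l. pose proof (Rabs_pos f). nra. }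
    assert (h2 : nn * b <= c * (r1 * r1)).
    { apply Rle_trans with (nn * (c * (r1 * r1) / nn)); [|right; field; lra].
      apply Rmult_le_compat_l; [lra|apply Rmin_r]. }
    pose proof (sqr_le_sqn N (diff (x n) z) i hi) as h3. unfold diff at 1 2 in h3.
    set (d := x n i - z i) in *. rewrite <- (Rabs_pos_eq (d * d)), Rabs_mult in h3 by apply Rle_0_sqr.
    pose proof (Rabs_pos d).
    assert (c * (Rabs d * Rabs d) <= c * (r1 * r1)).
    { eapply Rle_trans; [apply Rmult_le_compat_l; [lra|apply h3]|]. lra. }
    assert (Rabs d * Rabs d <= r1 * r1) by (apply Rmult_le_reg_l with c; auto).
    apply Rnot_lt_le; intros hlt. nra. }
  destruct (hcl r1 hr1) as [M hM].
  set (K := Nat.max M (Nat.max n1 n2)).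
  exists (phi K). intros n hn. pose proof (hphi K) as hpK.
  assert (hall : forall i, (i < N)%nat -> Rabs (x n i - z i) <= r1).
  { induction hn as [|n hn IH].
    - intros i hi. apply Rlt_le, hM; auto; unfold K; lia.
    - apply hkey; [unfold K in *; lia|]. intros i hi. specialize (IH i hi).
      unfold x. rewrite emp_S. fold (x n).
      assert (hg : / INR (S n) <= r1).
      { rewrite <- (Rinv_inv r1). apply Rinv_le_contravar; [now apply Rinv_0_lt_compat|].
        apply Rle_trans with (INR n2); [lra|]. apply le_INR; unfold K in *; lia. }
      pose proof (inv_S_bounds n) as hg'. pose proof (x_in_Delta n i hi). pose proof (ind_bounds (w (S n) i)).
      replace (x n i + / INR (S n) * (ind (w (S n) i) - x n i) - z i) with
        ((x n i - z i) + / INR (S n) * (ind (w (S n) i) - x n i)) by ring.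
      eapply Rle_trans; [apply Rabs_triang|]. rewrite Rabs_mult, (Rabs_pos_eq (/ _)) by lra.
      assert (Rabs (ind (w (S n) i) - x n i) <= 1) by (apply Rabs_le; lra).
      pose proof (Rabs_pos (ind (w (S n) i) - x n i)). nra. }
  intros i hi. specialize (hall i hi). lra.
Qed.

End Deterministic.

Lemma convergence_almost_sure N u lam a0 : 0 < lam -> (1 <= N)%nat ->
  (forall z, ND N u lam z -> isolated_zero N u lam z) ->
  negligible (cylwt N u lam a0) (cylmem N)
    (fun w => ~ exists z, ND N u lam z /\ converges_to N (emp a0 w) z).
Proof.
  intros hl hN hiso.
  apply negligible_mono with (fun w => (forall A, exists m, A <= energy N u lam a0 m w) \/
    exists i, (exists k, (i < N)%nat /\ forall n0, exists m, (n0 <= m)%nat /\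
      / INR (S k) <= Rabs (noise N u lam a0 i n0 m w))).
  - intros w hw. apply NNPP; intros hn. apply hw.
    apply not_or_and in hn. destruct hn as [h1 h2].
    apply not_all_ex_not in h1. destruct h1 as [A hA].
    apply (converges_to_ND N u lam a0 hl hN w A); auto.
    + intros m. apply Rnot_lt_le; intros hlt. apply hA. exists m; lra.
    + intros i eta hi heta. apply NNPP; intros hno. apply h2.
      destruct (INR_unbounded (/ eta)) as [k hk]. exists i, k. split; auto.
      intros n0. apply not_ex_all_not with (n := n0) in hno. apply not_all_ex_not in hno.
      destruct hno as [m hm]. apply imply_to_and in hm. destruct hm as [hm1 hm2].
      exists m; split; auto. apply Rnot_lt_le in hm2. eapply Rle_trans; [|apply hm2].
      rewrite <- (Rinv_inv eta). apply Rinv_le_contravar; [now apply Rinv_0_lt_compat|].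
      rewrite S_INR; lra.
  - apply negligible_union; [now apply energy_unbounded_negligible|].
    apply negligible_Union; intros i. apply negligible_Union; intros k.
    destruct (Nat.lt_ge_cases i N) as [hi|hi].
    + eapply negligible_mono; [|apply (noise_oscillation_negligible N u lam a0 hN i (/ INR (S k)) hi)].
      * intros w [_ h]; exact h.
      * apply inv_S_bounds.
    + apply negligible_empty. intros w [h _]; lia.
Qed.

(** * Regular potentials *)

(* [S] is the set of mixed players; the second clause is a quantitative form of
   the invertibility of the Hessian restricted to [S]. *)
Definition regular (N : nat) (eps : R) (u : nat -> R) : Prop :=
  forall (S : nat -> bool) x, in_Delta N x ->
  (forall i, (i < N)%nat -> S i = false -> x i = 0 \/ x i = 1) ->
  (forall i, (i < N)%nat -> S i = true -> Rabs (Dg N u i x) <= eps) ->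
  (forall j, (j < N)%nat -> S j = false -> eps < Rabs (Dg N u j x)) /\
  (forall f j, (j < N)%nat -> S j = true -> f j = 1 ->
    (forall i, (i < N)%nat -> S i = false -> f i = 0) -> (forall i, (i < N)%nat -> Rabs (f i) <= 1) ->
    exists i, (i < N)%nat /\ S i = true /\ eps < Rabs (rsum N (fun l => Hs N u i l x * f l))).

Definition irregular (N : nat) (u : nat -> R) : Prop := forall eps, 0 < eps -> ~ regular N eps u.

(** Openness of regularity at the price of half the margin. It yields both the closedness of the
    exceptional set and its dependence on the first [2 ^ N] coordinates only. *)
Lemma regular_perturb N eps u v : regular N eps u ->
  (4 * INR N + 2) * umass N (fun k => u k - v k) <= eps / 2 -> regular N (eps / 2) v.
Proof.
  intros hreg hd S x hx hpure hS.
  set (dm := umass N (fun k => u k - v k)) in *.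
  assert (hdm : 0 <= dm) by apply umass_nonneg. pose proof (pos_INR N) as hN0.
  assert (h2 : 2 * dm <= eps / 2) by nra.
  assert (hD : forall i, Rabs (Dg N u i x - Dg N v i x) <= 2 * dm).
  { intros i. rewrite Dg_minus_u. now apply Dg_bound. }
  assert (hDu : forall i, Rabs (Dg N u i x) <= Rabs (Dg N v i x) + eps / 2).
  { intros i. replace (Dg N u i x) with (Dg N v i x + (Dg N u i x - Dg N v i x)) by ring.
    eapply Rle_trans; [apply Rabs_triang|]. specialize (hD i); lra. }
  destruct (hreg S x hx hpure) as [ha hb].
  { intros i hi e. specialize (hS i hi e). specialize (hDu i). lra. }
  split.
  - intros j hj e. specialize (ha j hj e). specialize (hDu j). lra.
  - intros f j hj e hf1 hf0 hfb. destruct (hb f j hj e hf1 hf0 hfb) as [i [hi [hSi h]]].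
    exists i; repeat split; auto.
    assert (hH : Rabs (rsum N (fun l => Hs N u i l x * f l) - rsum N (fun l => Hs N v i l x * f l)) <= INR N * (4 * dm)).
    { rewrite <- rsum_minus. eapply Rle_trans; [apply rsum_abs|]. apply rsum_le_const; intros l hl.
      rewrite <- Rmult_minus_distr_r, Hs_minus_u, Rabs_mult.
      rewrite <- (Rmult_1_r (4 * dm)). apply Rmult_le_compat; try apply Rabs_pos; auto.
      now apply Hs_bound. }
    set (A := rsum N (fun l => Hs N u i l x * f l)) in *.
    set (B := rsum N (fun l => Hs N v i l x * f l)) in *.
    assert (Rabs A <= Rabs B + Rabs (A - B)).
    { replace A with (B + (A - B)) at 1 by ring. apply Rabs_triang. }
    lra.
Qed.

Lemma irregular_depends N : depends_on_first (2 ^ N) (irregular N).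
Proof.
  assert (h : forall u v, (forall k, (k < 2 ^ N)%nat -> u k = v k) -> irregular N u -> irregular N v).
  { intros u v e hu eps heps hv. apply (hu (eps / 2)); [lra|].
    apply (regular_perturb N eps v u hv).
    replace (umass N (fun k => v k - u k)) with 0; [lra|].
    symmetry; apply rsum_0; intros k hk. rewrite e by auto. rewrite Rminus_diag. apply Rabs_R0. }
  intros u v e; split; apply h; auto. intros; symmetry; auto.
Qed.

Lemma irregular_closed N : closed_in (2 ^ N) (irregular N).
Proof.
  intros u hu eps heps hreg.
  pose proof (pos_INR N) as hN0. pose proof (pos_INR (2 ^ N)) as hd0.
  set (c := (4 * INR N + 2) * (INR (2 ^ N) + 1)).
  assert (hc : 0 < c) by (unfold c; nra).
  destruct (hu (eps / 2 / c)) as [v [hv hclose]]; [apply Rdiv_lt_0_compat; lra|].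
  apply (hv (eps / 2)); [lra|]. apply (regular_perturb N eps u v hreg).
  apply Rle_trans with ((4 * INR N + 2) * ((INR (2 ^ N) + 1) * (eps / 2 / c))).
  - apply Rmult_le_compat_l; [lra|].
    apply Rle_trans with (INR (2 ^ N) * (eps / 2 / c)).
    + apply umass_le; intros k hk. now apply Rlt_le, hclose.
    + apply Rmult_le_compat_r; [|lra]. apply Rlt_le, Rdiv_lt_0_compat; lra.
  - right; unfold c; field. split; lra.
Qed.

(** * Covering by small boxes *)

Definition bwt (d : nat) (b : (nat -> R) * (nat -> R)) : R := box_vol d (fst b) (snd b).
Definition bmem (d : nat) (u : nat -> R) (b : (nat -> R) * (nat -> R)) : Prop :=
  forall k, (k < d)%nat -> fst b k <= u k <= snd b k.

Definition bcov (d : nat) (A : (nat -> R) -> Prop) (v : R) : Prop := covered (bwt d) (bmem d) A v.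

Lemma bwt_nonneg d b : 0 <= bwt d b.
Proof. apply rprod_nonneg; intros; apply Rmax_l. Qed.

Lemma bcov_empty d A : (forall u, ~ A u) -> bcov d A 0.
Proof.
  intros h; exists (fun _ => nil); split.
  - intros J. rewrite rsum_0; [lra|auto].
  - intros y hy; now destruct (h y).
Qed.

Lemma bcov_digit d (A : nat -> (nat -> R) -> Prop) b v : 0 <= v ->
  (forall g, (g < b)%nat -> bcov d (A g) v) ->
  bcov d (fun u => exists g, (g < b)%nat /\ A g u) (INR b * v).
Proof.
  intros hv h.
  apply (covered_Union (bwt d) (bmem d) (fun g u => (g < b)%nat /\ A g u)
           (fun g => if Nat.ltb g b then v else 0)).
  - intros g. destruct (Nat.ltb_spec g b) as [hg|hg].
    + eapply covered_mono; [| |apply (h g hg)]; [tauto|lra].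
    + apply bcov_empty. intros u [h' _]; lia.
  - intros J. rewrite <- rsum_const.
    destruct (Nat.le_ge_cases J b) as [hJ|hJ].
    + eapply Rle_trans; [|apply (rsum_le_mono J b (fun _ => v)); auto].
      apply rsum_le; intros i hi. destruct Nat.ltb; lra.
    + replace J with (b + (J - b))%nat by lia. rewrite rsum_split.
      rewrite (rsum_0 (J - b)).
      * rewrite Rplus_0_r. apply rsum_le; intros i hi. destruct Nat.ltb; lra.
      * intros i hi. destruct (Nat.ltb_spec (b + i) b); [lia|auto].
Qed.

(** The condition beyond [J] makes the multi-indices finitely many as functions, which the count in
    [bcov_grid] relies on. *)
Definition digits (J : nat) (b g : nat -> nat) : Prop :=
  (forall j, (j < J)%nat -> (g j < b j)%nat) /\ (forall j, (J <= j)%nat -> g j = O).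

Lemma bcov_grid d J (b : nat -> nat) v : 0 <= v -> forall A : (nat -> nat) -> (nat -> R) -> Prop,
  (forall g, digits J b g -> bcov d (A g) v) ->
  bcov d (fun u => exists g, digits J b g /\ A g u) (rprod J (fun j => INR (b j)) * v).
Proof.
  intros hv. induction J; intros A h.
  - eapply covered_mono; [| |apply (h (fun _ => O))].
    + intros u [g [[_ hg] hA]]. replace (fun _ : nat => O) with g; auto.
      extensionality j; apply hg; lia.
    + simpl; lra.
    + split; [intros; lia|auto].
  - eapply covered_mono; [| |apply (bcov_digit d (fun c u => exists g, digits J b g /\ A (setp g J c) u) (b J)
        (rprod J (fun j => INR (b j)) * v))].
    + intros u [g [[hg1 hg2] hA]]. exists (g J). split; [apply hg1; lia|].
      exists (setp g J O). split.
      * split; intros j hj.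
        -- rewrite setp_other by lia. apply hg1; lia.
        -- destruct (Nat.eq_dec j J) as [->|]; [apply setp_same|rewrite setp_other by auto; apply hg2; lia].
      * replace (setp (setp g J O) J (g J)) with g; auto.
        extensionality j. unfold setp. now destruct (Nat.eqb_spec j J) as [->|].
    + simpl. right; ring.
    + apply Rmult_le_pos; auto. apply rprod_nonneg; intros; apply pos_INR.
    + intros c hc. apply IHJ. intros g [hg1 hg2]. apply h. split; intros j hj.
      * destruct (Nat.eq_dec j J) as [->|]; [now rewrite setp_same|rewrite setp_other by auto; apply hg1; lia].
      * rewrite setp_other by lia. apply hg2; lia.
Qed.

Lemma digits_choice J (b : nat -> nat) (Q : nat -> nat -> Prop) :
  (forall j, (j < J)%nat -> exists c, (c < b j)%nat /\ Q j c) ->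
  exists g, digits J b g /\ forall j, (j < J)%nat -> Q j (g j).
Proof.
  induction J; intros h.
  - exists (fun _ => O). split; [split; [intros; lia|auto]|intros; lia].
  - destruct IHJ as [g [[hg1 hg2] hQ]]; [intros; apply h; lia|].
    destruct (h J) as [c [hc hQc]]; [lia|].
    exists (setp g J c). split; [split|].
    + intros j hj. destruct (Nat.eq_dec j J) as [->|]; [now rewrite setp_same|].
      rewrite setp_other by auto; apply hg1; lia.
    + intros j hj. rewrite setp_other by lia; apply hg2; lia.
    + intros j hj. destruct (Nat.eq_dec j J) as [->|]; [now rewrite setp_same|].
      rewrite setp_other by auto; apply hQ; lia.
Qed.

Definition cell (s : R) (g : nat) (y : R) : Prop := INR g * s <= y <= (INR g + 1) * s.

Lemma cell_close s g y y' : cell s g y -> cell s g y' -> Rabs (y - y') <= s.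
Proof. unfold cell; intros; apply Rabs_le; lra. Qed.

Lemma cell_exists s B y : (1 <= B)%nat -> 0 <= y <= INR B * s -> exists g, (g < B)%nat /\ cell s g y.
Proof.
  intros hB. induction B as [|B IH]; [lia|]. intros [h0 h1].
  destruct (Rle_dec (INR B * s) y) as [h|h].
  - exists B. split; [lia|]. unfold cell. rewrite S_INR in h1. lra.
  - destruct B as [|B]; [simpl in h; lra|].
    destruct IH as [g [hg hc]]; [lia|lra|]. exists g; split; auto; lia.
Qed.

Lemma bcov_diameter d (A : (nat -> R) -> Prop) c : 0 <= c ->
  (forall u v, A u -> A v -> forall k, (k < d)%nat -> Rabs (u k - v k) <= c) -> bcov d A ((2 * c) ^ d).
Proof.
  intros hc h. destruct (classic (exists v, A v)) as [[v hv]|hn].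
  - exists (fun j => match j with O => (fun k => v k - c, fun k => v k + c) :: nil | _ => nil end).
    split.
    + intros J. destruct J as [|J]; [simpl; apply pow_le; lra|].
      rewrite rsum_shift, (rsum_0 J) by auto. simpl. rewrite !Rplus_0_r.
      unfold bwt, box_vol; simpl. rewrite <- rprod_const. right. apply rprod_ext; intros k hk.
      rewrite Rmax_right; lra.
    + intros u hu. exists O, (fun k => v k - c, fun k => v k + c). split; [now left|].
      intros k hk; simpl. specialize (h u v hu hv k hk). apply Rabs_le_between in h. lra.
  - eapply covered_mono; [| |apply (bcov_empty d A)].
    + auto.
    + apply pow_le; lra.
    + intros u hu; apply hn; eauto.
Qed.

(** * Splitting off the linear part of a potential *)

(* The potential [k |-> bit i of k] has multilinear extension [1 - x i]: the coefficient
   [tcoef u i] translates the i-th partial derivative and leaves the Hessian unchanged. *)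
Definition tcoef (u : nat -> R) (i : nat) : R := u (2 ^ i)%nat.

(** Zero at the powers of two, so [tcoef] and [rest] together are linear coordinates on the
    potentials: [N] translations and [2 ^ N - N] others. *)
Definition rest (N : nat) (u : nat -> R) (k : nat) : R :=
  u k - rsum N (fun i => ind (Nat.testbit k i) * tcoef u i).

Lemma pow2_lt N i : (i < N)%nat -> (2 ^ i < 2 ^ N)%nat.
Proof. apply Nat.pow_lt_mono_r; lia. Qed.

Lemma rest_pow2 N u i : (i < N)%nat -> rest N u (2 ^ i) = 0.
Proof.
  intros hi. unfold rest.
  rewrite (rsum_ext N _ (fun j => if Nat.eqb j i then tcoef u i else 0)).
  - rewrite rsum_single by auto. unfold tcoef; ring.
  - intros j hj. rewrite Nat.pow2_bits_eqb, Nat.eqb_sym.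
    destruct (Nat.eqb_spec j i) as [->|]; simpl; ring.
Qed.

Lemma rest_bound N u B k : (k < 2 ^ N)%nat -> (forall k, (k < 2 ^ N)%nat -> Rabs (u k) <= B) ->
  Rabs (rest N u k) <= (INR N + 1) * B.
Proof.
  intros hk hB. unfold rest, Rminus. eapply Rle_trans; [apply Rabs_triang|]. rewrite Rabs_Ropp.
  assert (Rabs (rsum N (fun i => ind (Nat.testbit k i) * tcoef u i)) <= INR N * B).
  { eapply Rle_trans; [apply rsum_abs|]. apply rsum_le_const; intros i hi.
    rewrite Rabs_mult. pose proof (hB _ (pow2_lt N i hi)). unfold tcoef.
    pose proof (ind_bounds (Nat.testbit k i)). rewrite (Rabs_pos_eq (ind _)) by lra.
    pose proof (Rabs_pos (u (2 ^ i)%nat)). nra. }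
  specialize (hB k hk). lra.
Qed.

Lemma U_rest N u x : U N u x = U N (rest N u) x + rsum N (fun i => tcoef u i * (1 - x i)).
Proof.
  assert (h : forall M, (M <= N)%nat ->
    U N (fun k => rsum M (fun i => ind (Nat.testbit k i) * tcoef u i)) x =
    rsum M (fun i => tcoef u i * (1 - x i))).
  { induction M; intros hM; cbn [rsum].
    - rewrite (U_ext_u N _ (fun _ => 0 * 1)), U_scal by (intros; ring). ring.
    - rewrite U_plus, IHM by lia. f_equal.
      rewrite (U_ext_u N _ (fun k => tcoef u M * ind (Nat.testbit k M))), U_scal, U_bit by (intros; try ring; lia).
      reflexivity. }
  rewrite <- h, <- U_plus by lia. apply U_ext_u; intros k hk. unfold rest; ring.
Qed.

Lemma Dg_rest N u i x : (i < N)%nat -> Dg N u i x = Dg N (rest N u) i x - tcoef u i.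
Proof.
  intros hi. unfold Dg, pd. rewrite !(U_rest N u).
  assert (e : rsum N (fun j => tcoef u j * (1 - upd x i 1 j)) - rsum N (fun j => tcoef u j * (1 - upd x i 0 j)) = - tcoef u i).
  { rewrite <- rsum_minus, (rsum_ext N _ (fun j => if Nat.eqb j i then - tcoef u i else 0)).
    - now apply rsum_single.
    - intros j hj. unfold upd. destruct (Nat.eqb_spec j i) as [->|]; ring. }
  lra.
Qed.

Lemma umass_rest_close N u v c : (forall k, (k < 2 ^ N)%nat -> Rabs (rest N u k - rest N v k) <= c) ->
  umass N (fun k => rest N u k - rest N v k) <= INR (2 ^ N) * c.
Proof. intros h; now apply umass_le. Qed.

Section Cells.
Context (N : nat) (Bd c : R) (hc : 0 <= c).
Context (u u' x x' : nat -> R).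
Context (hu' : forall k, (k < 2 ^ N)%nat -> Rabs (u' k) <= Bd).
Context (hx : in_Delta N x) (hx' : in_Delta N x').
Context (hrest : forall k, (k < 2 ^ N)%nat -> Rabs (rest N u k - rest N u' k) <= c).

Let d : R := INR (2 ^ N).

(** As [Dg] of [u] is [Dg] of its rest minus the coefficient, a nearly vanishing derivative
    determines that coefficient from the point and the rest. *)
Lemma tcoef_difference i : (i < N)%nat -> Rabs (Dg N u i x) <= c -> Rabs (Dg N u' i x') <= c ->
  Rabs (tcoef u i - tcoef u' i - (Dg N u' i x - Dg N u' i x')) <= (2 * d + 2) * c.
Proof.
  intros hi h h'.
  assert (e : tcoef u i - tcoef u' i - (Dg N u' i x - Dg N u' i x') =
    (Dg N (rest N u) i x - Dg N (rest N u') i x) - Dg N u i x + Dg N u' i x').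
  { rewrite (Dg_rest N u i x hi), (Dg_rest N u' i x hi), (Dg_rest N u' i x' hi). ring. }
  rewrite e, Dg_minus_u.
  pose proof (Dg_bound N (fun k => rest N u k - rest N u' k) i x hx) as h1.
  pose proof (umass_rest_close N u u' c hrest) as h2. fold d in h2.
  unfold Rminus. eapply Rle_trans; [apply Rabs_triang|].
  pose proof (Rabs_triang (Dg N (fun k => rest N u k + - rest N u' k) i x) (- Dg N u i x)) as h3.
  rewrite Rabs_Ropp in h3. unfold Rminus in h1, h2. lra.
Qed.

Lemma u'_mass : umass N u' <= d * Bd.
Proof. now apply umass_le. Qed.

Lemma tcoef_close i del : (i < N)%nat -> Rabs (Dg N u i x) <= c -> Rabs (Dg N u' i x') <= c ->
  (forall l, (l < N)%nat -> Rabs (x l - x' l) <= del) ->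
  Rabs (tcoef u i - tcoef u' i) <= (2 * d + 2) * c + 4 * (d * Bd) * (INR N * del).
Proof.
  intros hi h h' hdel. pose proof (tcoef_difference i hi h h') as h1.
  pose proof (Dg_lip N u' i x' x hi hx' hx) as h2. pose proof u'_mass as h3.
  assert (hl1 : l1 N (fun l => x l - x' l) <= INR N * del) by (now apply rsum_le_const).
  pose proof (l1_nonneg N (fun l => x l - x' l)) as hl0. pose proof (umass_nonneg N u') as hm.
  assert (h4 : 4 * umass N u' * l1 N (fun l => x l - x' l) <= 4 * (d * Bd) * (INR N * del)).
  { apply Rmult_le_compat; lra. }
  replace (tcoef u i - tcoef u' i) with ((tcoef u i - tcoef u' i - (Dg N u' i x - Dg N u' i x')) +
    (Dg N u' i x - Dg N u' i x')) by ring.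
  eapply Rle_trans; [apply Rabs_triang|]. lra.
Qed.

(* The first order variation of [D] in [x] is orthogonal to a null vector [f] of the Hessian. *)
Lemma slab_estimate (S : nat -> bool) f del :
  (forall i, (i < N)%nat -> S i = true -> Rabs (Dg N u i x) <= c /\ Rabs (Dg N u' i x') <= c) ->
  (forall i, (i < N)%nat -> S i = false -> f i = 0 /\ x i = x' i) ->
  (forall i, (i < N)%nat -> Rabs (f i) <= 1) ->
  (forall i, (i < N)%nat -> S i = true -> Rabs (rsum N (fun l => Hs N u' i l x' * f l)) <= c) ->
  (forall l, (l < N)%nat -> Rabs (x l - x' l) <= del) -> del <= 1 ->
  Rabs (rsum N (fun i => f i * (tcoef u i - tcoef u' i))) <=
    INR N * ((2 * d + 2) * c + 8 * (d * Bd) * ((INR N * del) * (INR N * del))) + INR N * c.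
Proof.
  intros hD hS hf hH hdel hdel1.
  set (y := fun l => x l - x' l).
  assert (hl1 : 0 <= l1 N y <= INR N * del) by (split; [apply l1_nonneg|now apply rsum_le_const]).
  pose proof u'_mass as hm'. pose proof (umass_nonneg N u') as hm.
  assert (e : rsum N (fun i => f i * (tcoef u i - tcoef u' i)) =
    rsum N (fun i => f i * (tcoef u i - tcoef u' i - rsum N (fun l => Hs N u' i l x' * y l))) +
    rsum N (fun l => y l * rsum N (fun i => Hs N u' l i x' * f i))).
  { rewrite (rsum_ext N (fun l => y l * rsum N (fun i => Hs N u' l i x' * f i))
      (fun l => rsum N (fun i => f i * (Hs N u' i l x' * y l)))).
    2:{ intros l hl. rewrite <- rsum_scal. apply rsum_ext; intros i hi. rewrite (Hs_sym N u' l i). ring. }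
    rewrite rsum_swap, <- rsum_plus. apply rsum_ext; intros i hi. rewrite rsum_scal. ring. }
  rewrite e. eapply Rle_trans; [apply Rabs_triang|]. apply Rplus_le_compat.
  - eapply Rle_trans; [apply rsum_abs|]. apply rsum_le_const; intros i hi.
    assert (h0 : 0 <= (2 * d + 2) * c + 8 * (d * Bd) * (INR N * del * (INR N * del))).
    { assert (0 <= d) by apply pos_INR. assert (0 <= (2 * d + 2) * c) by nra.
      assert (0 <= 8 * (d * Bd) * (INR N * del * (INR N * del))).
      { apply Rmult_le_pos; [lra|]. apply Rmult_le_pos; lra. } lra. }
    destruct (S i) eqn:eS.
    + destruct (hD i hi eS) as [h h']. pose proof (tcoef_difference i hi h h') as h1.
      pose proof (Dg_taylor N u' i x' x hi hx' hx) as h2. change (fun i => x i - x' i) with y in h2.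
      rewrite Rabs_mult. set (t := tcoef u i - tcoef u' i) in *.
      set (q := rsum N (fun l => Hs N u' i l x' * y l)).
      change (rsum N (fun j => Hs N u' i j x' * (x j - x' j))) with q in h2.
      assert (h3 : Rabs (t - q) <= (2 * d + 2) * c + 8 * (d * Bd) * (INR N * del * (INR N * del))).
      { replace (t - q) with ((t - (Dg N u' i x - Dg N u' i x')) + (Dg N u' i x - Dg N u' i x' - q)) by ring.
        eapply Rle_trans; [apply Rabs_triang|]. apply Rplus_le_compat; auto.
        eapply Rle_trans; [apply h2|]. apply Rmult_le_compat; try lra.
        - apply Rmult_le_pos; lra.
        - apply Rmult_le_compat; lra. }
      specialize (hf i hi). pose proof (Rabs_pos (t - q)). pose proof (Rabs_pos (f i)). nra.
    + rewrite (proj1 (hS i hi eS)), Rmult_0_l, Rabs_R0. auto.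
  - eapply Rle_trans; [apply rsum_abs|]. apply rsum_le_const; intros l hl.
    rewrite Rabs_mult. destruct (S l) eqn:eS.
    + specialize (hH l hl eS). specialize (hdel l hl). fold (y l) in hdel.
      pose proof (Rabs_pos (y l)). pose proof (Rabs_pos (rsum N (fun i => Hs N u' l i x' * f i))).
      apply Rle_trans with (1 * c); [|lra]. apply Rmult_le_compat; lra.
    + unfold y. rewrite (proj2 (hS l hl eS)), Rminus_diag, Rabs_R0, Rmult_0_l. auto.
Qed.

End Cells.

Lemma u_close_of_parts N u v a b k : (k < 2 ^ N)%nat -> Rabs (rest N u k - rest N v k) <= a ->
  (forall i, (i < N)%nat -> Rabs (tcoef u i - tcoef v i) <= b) -> Rabs (u k - v k) <= a + INR N * b.
Proof.
  intros hk ha hb.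
  replace (u k - v k) with ((rest N u k - rest N v k) +
    rsum N (fun i => ind (Nat.testbit k i) * (tcoef u i - tcoef v i))).
  - eapply Rle_trans; [apply Rabs_triang|]. apply Rplus_le_compat; auto.
    eapply Rle_trans; [apply rsum_abs|]. apply rsum_le_const; intros i hi.
    rewrite Rabs_mult. pose proof (ind_bounds (Nat.testbit k i)). rewrite (Rabs_pos_eq (ind _)) by lra.
    specialize (hb i hi). pose proof (Rabs_pos (tcoef u i - tcoef v i)). nra.
  - rewrite (rsum_ext N _ (fun i => ind (Nat.testbit k i) * tcoef u i - ind (Nat.testbit k i) * tcoef v i))
      by (intros; ring).
    rewrite rsum_minus. unfold rest. ring.
Qed.

Definition is_pow2 (N k : nat) : bool := existsb (fun i => Nat.eqb k (2 ^ i)) (List.seq 0 N).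

Lemma is_pow2_spec N k : is_pow2 N k = true -> exists i, (i < N)%nat /\ k = (2 ^ i)%nat.
Proof.
  intros h. apply existsb_exists in h. destruct h as [i [hi e]].
  apply in_seq in hi. apply Nat.eqb_eq in e. exists i; split; auto; lia.
Qed.

(** Counts the [2 ^ N - N] indices that are not powers of two in product form, by inserting a factor
    [b] at each power. *)
Lemma count_pow2 N b : 0 < b ->
  rprod (2 ^ N) (fun k => if is_pow2 N k then 1 else b) * b ^ N <= b ^ (2 ^ N).
Proof.
  intros hb.
  assert (e : b ^ N = rprod (2 ^ N) (fun k => rprod N (fun i => if Nat.eqb k (2 ^ i) then b else 1))).
  { rewrite rprod_swap, <- rprod_const. apply rprod_ext; intros i hi.
    symmetry. apply rprod_single. now apply pow2_lt. }
  rewrite e, <- rprod_mult, <- rprod_const. right. apply rprod_ext; intros k hk.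
  destruct (is_pow2 N k) eqn:ek.
  - destruct (is_pow2_spec N k ek) as [i [hi ->]].
    rewrite Rmult_1_l. rewrite (rprod_ext N _ (fun j => if Nat.eqb j i then b else 1)).
    + now apply rprod_single.
    + intros j hj. destruct (Nat.eqb_spec (2 ^ i) (2 ^ j)) as [e'|e']; destruct (Nat.eqb_spec j i) as [e''|e'']; auto.
      * destruct e''. symmetry. apply (Nat.pow_inj_r 2); auto; lia.
      * subst; contradiction.
  - rewrite rprod_1; [ring|]. intros i hi.
    destruct (Nat.eqb_spec k (2 ^ i)) as [->|]; auto.
    assert (h : is_pow2 N (2 ^ i) = true).
    { apply existsb_exists. exists i. split; [apply in_seq; lia|apply Nat.eqb_refl]. }
    congruence.
Qed.

(** * Irregular potentials form a null set *)

Section Counting.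
Context (N : nat) (hN : (1 <= N)%nat) (Rb : nat) (hR : (1 <= Rb)%nat) (k : nat) (hk : (1 <= k)%nat).

Let d : nat := (2 ^ N)%nat.
Let n : R := INR N.
Let Bd : R := INR Rb.
(** Potentials are resolved at scale [1 / k^2]. In the Hessian case points are resolved at [1 / k]
    only, and their second order errors are again of order [eta]. *)
Let eta : R := / (INR k * INR k).
Let B1 : nat := (2 * S N * Rb * (k * k))%nat.

Lemma k_ge_1 : 1 <= INR k.
Proof. now apply INR_ge_1. Qed.

Lemma n_ge_1 : 1 <= n.
Proof. now apply INR_ge_1. Qed.

Lemma Bd_ge_1 : 1 <= Bd.
Proof. now apply INR_ge_1. Qed.

Lemma eta_pos : 0 < eta.
Proof. pose proof k_ge_1. apply Rinv_0_lt_compat. nra. Qed.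

Lemma B1_value : INR B1 = 2 * (n + 1) * Bd * (INR k * INR k).
Proof. unfold B1. rewrite !mult_INR, (S_INR N).
  replace (INR 2) with 2 by (simpl; ring). unfold n, Bd. ring. Qed.

Lemma B1_eta : INR B1 * eta = 2 * (n + 1) * Bd.
Proof. rewrite B1_value. unfold eta. pose proof k_ge_1. field. nra. Qed.

Lemma B1_ge_1 : (1 <= B1)%nat.
Proof. unfold B1. destruct k; [lia|]. destruct Rb; [lia|]. simpl; lia. Qed.

Definition inbox (u : nat -> R) : Prop := forall j, (j < d)%nat -> Rabs (u j) <= Bd.

Definition rcell (g : nat -> nat) (u : nat -> R) : Prop :=
  forall j, (j < d)%nat -> is_pow2 N j = false -> cell eta (g j) (rest N u j + (n + 1) * Bd).

Definition rbase (j : nat) : nat := if is_pow2 N j then 1%nat else B1.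

Lemma rcell_exists u : inbox u -> exists g, digits d rbase g /\ rcell g u.
Proof.
  intros hu. apply (digits_choice d rbase
    (fun j c => is_pow2 N j = false -> cell eta c (rest N u j + (n + 1) * Bd))).
  intros j hj. unfold rbase. destruct (is_pow2 N j) eqn:e; [exists O; split; [lia|congruence]|].
  destruct (cell_exists eta B1 (rest N u j + (n + 1) * Bd)) as [c [hc1 hc2]].
  - exact B1_ge_1.
  - rewrite B1_eta. pose proof (rest_bound N u Bd j hj hu) as h. fold n in h.
    apply Rabs_le_between in h. lra.
  - exists c; auto.
Qed.

Lemma rcell_close g u v : rcell g u -> rcell g v -> forall j, (j < d)%nat -> Rabs (rest N u j - rest N v j) <= eta.
Proof.
  intros hu hv j hj. destruct (is_pow2 N j) eqn:e.
  - destruct (is_pow2_spec N j e) as [i [hi ->]]. rewrite !rest_pow2, Rminus_diag, Rabs_R0 by auto.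
    apply Rlt_le, eta_pos.
  - replace (rest N u j - rest N v j) with
      ((rest N u j + (n + 1) * Bd) - (rest N v j + (n + 1) * Bd)) by ring.
    apply (cell_close eta (g j)); auto.
Qed.

Definition xcell (S : nat -> bool) (s : R) (g : nat -> nat) (x : nat -> R) : Prop :=
  forall i, (i < N)%nat -> if S i then cell s (g i) (x i) else x i = INR (g i).

Definition xbase (S : nat -> bool) (K : nat) (i : nat) : nat := if S i then K else 2%nat.

Definition pure_off (S : nat -> bool) (x : nat -> R) : Prop :=
  forall i, (i < N)%nat -> S i = false -> x i = 0 \/ x i = 1.

Lemma xcell_exists S K s x : (1 <= K)%nat -> INR K * s = 1 -> in_Delta N x -> pure_off S x ->
  exists g, digits N (xbase S K) g /\ xcell S s g x.
Proof.
  intros hK hs hx hp.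
  apply (digits_choice N (xbase S K) (fun i c => if S i then cell s c (x i) else x i = INR c)).
  intros i hi. unfold xbase. destruct (S i) eqn:e.
  - apply cell_exists; auto. rewrite hs. now apply hx.
  - destruct (hp i hi e) as [h|h]; [exists O|exists 1%nat]; split; try lia; rewrite h; reflexivity.
Qed.

Lemma xcell_close S s g x x' : 0 <= s -> xcell S s g x -> xcell S s g x' ->
  forall i, (i < N)%nat -> Rabs (x i - x' i) <= s.
Proof.
  intros hs h h' i hi. specialize (h i hi). specialize (h' i hi). destruct (S i).
  - now apply (cell_close s (g i)).
  - now rewrite h, h', Rminus_diag, Rabs_R0.
Qed.

Definition tcell (J : nat -> bool) (o : nat -> R) (g : nat -> nat) (u : nat -> R) : Prop :=
  forall i, (i < N)%nat -> J i = true -> cell eta (g i) (tcoef u i + o i).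

Lemma tcell_exists J o (b : nat -> nat) u : (forall i, (i < N)%nat -> (1 <= b i)%nat) ->
  (forall i, (i < N)%nat -> J i = true -> 0 <= tcoef u i + o i <= INR (b i) * eta) ->
  exists g, digits N b g /\ tcell J o g u.
Proof.
  intros hb h.
  apply (digits_choice N b (fun i c => J i = true -> cell eta c (tcoef u i + o i))).
  intros i hi. destruct (J i) eqn:e.
  - destruct (cell_exists eta (b i) (tcoef u i + o i)) as [c [hc1 hc2]]; auto. exists c; auto.
  - exists O; split; [specialize (hb i hi); lia|congruence].
Qed.

Lemma tcell_close J o g u v : tcell J o g u -> tcell J o g v ->
  forall i, (i < N)%nat -> J i = true -> Rabs (tcoef u i - tcoef v i) <= eta.
Proof.
  intros hu hv i hi e.
  replace (tcoef u i - tcoef v i) with ((tcoef u i + o i) - (tcoef v i + o i)) by ring.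
  apply (cell_close eta (g i)); auto.
Qed.

Lemma tcoef_box u i : inbox u -> (i < N)%nat -> 0 <= tcoef u i + Bd <= INR B1 * eta.
Proof.
  intros hu hi. rewrite B1_eta. pose proof (hu _ (pow2_lt N i hi)) as h. apply Rabs_le_between in h.
  pose proof n_ge_1. pose proof Bd_ge_1. unfold tcoef. split; [lra|]. nra.
Qed.

Let dd : R := INR d.
(** In units of [eta], within a cell: [CA] bounds the variation of a coefficient determined by
    criticality, [CB] that of the coefficient solved from the slab. Then [diam] bounds the variation
    of the whole potential. *)
Let CA : R := 2 * dd + 2 + 4 * (dd * Bd) * n.
Let CB : R := 2 * (n * (2 * dd + 3 + 8 * (dd * Bd) * (n * n))) + n + 1.
Let CC : R := CA + CB.
Let diam : R := eta + n * (CC * eta).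

Lemma CA_nonneg : 0 <= CA.
Proof.
  pose proof n_ge_1. pose proof Bd_ge_1. assert (0 <= dd) by apply pos_INR.
  assert (0 <= 4 * (dd * Bd) * n) by (repeat apply Rmult_le_pos; lra). unfold CA. lra.
Qed.

Lemma CB_ge_1 : 1 <= CB.
Proof.
  pose proof n_ge_1. pose proof Bd_ge_1. assert (0 <= dd) by apply pos_INR.
  assert (0 <= 8 * (dd * Bd) * (n * n)) by (repeat apply Rmult_le_pos; lra).
  assert (0 <= n * (2 * dd + 3 + 8 * (dd * Bd) * (n * n))) by (apply Rmult_le_pos; lra).
  unfold CB. lra.
Qed.

Definition boundary_degenerate (S : nat -> bool) (j : nat) (u x : nat -> R) : Prop :=
  inbox u /\ in_Delta N x /\ pure_off S x /\
  forall i, (i < N)%nat -> S i = true \/ i = j -> Rabs (Dg N u i x) <= eta.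

Definition tbase1 (S : nat -> bool) (j i : nat) : nat := if (S i || Nat.eqb i j)%bool then 1%nat else B1.

(** One equation too many. Each mixed player costs [k^2] cells for its coordinate and saves the [B1]
    cells of its coefficient, now determined; the pure player [j] saves its [B1] cells too, at the
    cost of two values only. *)
Lemma cover_boundary_degenerate S j : (j < N)%nat -> S j = false ->
  bcov d (fun u => exists x, boundary_degenerate S j u x)
    (rprod N (fun i => INR (xbase S (k * k) i)) *
      (rprod d (fun i => INR (rbase i)) * (rprod N (fun i => INR (tbase1 S j i)) * (2 * diam) ^ d))).
Proof.
  intros hj hSj. pose proof eta_pos as he. pose proof n_ge_1 as hn.
  pose proof CA_nonneg as hCA. pose proof CB_ge_1 as hCB.
  assert (hdiam : 0 <= diam) by (unfold diam, CC; assert (0 <= n * ((CA + CB) * eta)) by (repeat apply Rmult_le_pos; lra); lra).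
  assert (hv0 : 0 <= (2 * diam) ^ d) by (apply pow_le; lra).
  assert (hv1 : 0 <= rprod N (fun i => INR (tbase1 S j i)) * (2 * diam) ^ d).
  { apply Rmult_le_pos; auto. apply rprod_nonneg; intros; apply pos_INR. }
  assert (hv2 : 0 <= rprod d (fun i => INR (rbase i)) * (rprod N (fun i => INR (tbase1 S j i)) * (2 * diam) ^ d)).
  { apply Rmult_le_pos; auto. apply rprod_nonneg; intros; apply pos_INR. }
  pose (J := fun i => negb (S i || Nat.eqb i j)).
  eapply covered_mono; [| |apply (bcov_grid d N (xbase S (k * k)) _ hv2 (fun gx u =>
    exists gr, digits d rbase gr /\ exists gt, digits N (tbase1 S j) gt /\
    exists x, boundary_degenerate S j u x /\ xcell S eta gx x /\ rcell gr u /\ tcell J (fun _ => Bd) gt u))].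
  - intros u [x hx]. pose proof hx as [hu [hxD [hxp hxd]]].
    destruct (xcell_exists S (k * k) eta x) as [gx [hgx1 hgx2]]; auto; [nia| |].
    { rewrite mult_INR. unfold eta. pose proof k_ge_1. field. lra. }
    exists gx; split; auto. destruct (rcell_exists u hu) as [gr [hgr1 hgr2]]. exists gr; split; auto.
    destruct (tcell_exists J (fun _ => Bd) (tbase1 S j) u) as [gt [hgt1 hgt2]].
    + intros i hi. unfold tbase1. pose proof B1_ge_1. destruct (_ || _)%bool; lia.
    + intros i hi e. unfold tbase1, J in *. apply Bool.negb_true_iff in e. rewrite e. now apply tcoef_box.
    + exists gt; split; auto. exists x; auto.
  - lra.
  - intros gx _. apply (bcov_grid d d rbase _ hv1). intros gr _.
    apply (bcov_grid d N (tbase1 S j) _ hv0). intros gt _.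
    apply bcov_diameter; auto.
    intros u v [x [[hu [hxD [hxp hxd]]] [hcx [hcr hct]]]] [y [[hv [hyD [hyp hyd]]] [hcx' [hcr' hct']]]] l hl.
    assert (hrest : forall l, (l < 2 ^ N)%nat -> Rabs (rest N u l - rest N v l) <= eta) by (apply (rcell_close gr); auto).
    apply u_close_of_parts; auto. fold n. intros i hi.
    destruct (S i || Nat.eqb i j)%bool eqn:e.
    + assert (hi' : S i = true \/ i = j).
      { apply Bool.orb_true_iff in e. destruct e as [e|e]; [now left|right; now apply Nat.eqb_eq]. }
      eapply Rle_trans; [apply (tcoef_close N Bd eta u v x y hv hxD hyD hrest i eta); auto|].
      * apply (xcell_close S eta gx); auto; lra.
      * fold d. fold dd n. apply Rle_trans with (CA * eta); [unfold CA; right; ring|].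
        apply Rmult_le_compat_r; [lra|unfold CC; lra].
    + eapply Rle_trans; [apply (tcell_close J (fun _ => Bd) gt); auto; unfold J; now rewrite e|].
      rewrite <- (Rmult_1_l eta) at 1. apply Rmult_le_compat_r; [lra|unfold CC; lra].
Qed.

Definition hessian_degenerate (S : nat -> bool) (j : nat) (u x f : nat -> R) : Prop :=
  inbox u /\ in_Delta N x /\ pure_off S x /\
  (forall i, (i < N)%nat -> S i = true -> Rabs (Dg N u i x) <= eta) /\
  f j = 1 /\ (forall i, (i < N)%nat -> S i = false -> f i = 0) /\
  (forall i, (i < N)%nat -> Rabs (f i) <= 1) /\
  (forall i, (i < N)%nat -> S i = true -> Rabs (rsum N (fun l => Hs N u i l x * f l)) <= eta).

(** While [x] stays in a cell of side [1 / k], the coefficient of a mixed player varies by at most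
    [W], of order [1 / k]; this counts the cells of side [eta] in an interval of length [2 * W].
    Together with the [k] cells for [x], such a player costs of order [k^2], as does [B1]. *)
Let B2 : nat := (4 * d + 4 + 8 * d * Rb * N * k)%nat.
Let W : R := (2 * dd + 2) * eta + 4 * (dd * Bd) * (n * / INR k).

Lemma B2_eta : INR B2 * eta = 2 * W.
Proof.
  unfold B2. rewrite !plus_INR, !mult_INR. fold dd n Bd.
  replace (INR 4) with 4 by (simpl; ring). replace (INR 8) with 8 by (simpl; ring).
  unfold W, eta. pose proof k_ge_1. field. lra.
Qed.

Definition tbase2 (S : nat -> bool) (j i : nat) : nat :=
  if Nat.eqb i j then 1%nat else if S i then B2 else B1.

(* Sard's argument: in a cell of side [1 / k] the coefficients [t] of the potentials
   with a degenerate zero fill a slab of thickness [O(1 / k^2)]. *)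
Lemma cover_hessian_degenerate S j : (j < N)%nat -> S j = true ->
  bcov d (fun u => exists x f, hessian_degenerate S j u x f)
    (rprod N (fun i => INR (xbase S k i)) *
      (rprod d (fun i => INR (rbase i)) * (rprod N (fun i => INR (tbase2 S j i)) * (2 * diam) ^ d))).
Proof.
  intros hj hSj. pose proof eta_pos as he. pose proof n_ge_1 as hn. pose proof k_ge_1 as hk1.
  pose proof CA_nonneg as hCA. pose proof CB_ge_1 as hCB. pose proof Bd_ge_1 as hBd.
  assert (hdd : 0 <= dd) by apply pos_INR.
  assert (hdiam : 0 <= diam) by (unfold diam, CC; assert (0 <= n * ((CA + CB) * eta)) by (repeat apply Rmult_le_pos; lra); lra).
  assert (hv0 : 0 <= (2 * diam) ^ d) by (apply pow_le; lra).
  assert (hv1 : 0 <= rprod N (fun i => INR (tbase2 S j i)) * (2 * diam) ^ d).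
  { apply Rmult_le_pos; auto. apply rprod_nonneg; intros; apply pos_INR. }
  assert (hv2 : 0 <= rprod d (fun i => INR (rbase i)) * (rprod N (fun i => INR (tbase2 S j i)) * (2 * diam) ^ d)).
  { apply Rmult_le_pos; auto. apply rprod_nonneg; intros; apply pos_INR. }
  assert (hik : 0 < / INR k <= 1).
  { split; [apply Rinv_0_lt_compat; lra|]. rewrite <- Rinv_1. apply Rinv_le_contravar; lra. }
  pose (J := fun i => negb (Nat.eqb i j)).
  eapply covered_mono; [| |apply (bcov_grid d N (xbase S k) _ hv2 (fun gx u =>
    exists gr, digits d rbase gr /\
    exists x f, hessian_degenerate S j u x f /\ xcell S (/ INR k) gx x /\ rcell gr u))].
  - intros u [x [f hx]]. pose proof hx as [hu [hxD [hxp hxd]]].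
    destruct (xcell_exists S k (/ INR k) x) as [gx [hgx1 hgx2]]; auto; [field; lra|].
    exists gx; split; auto. destruct (rcell_exists u hu) as [gr [hgr1 hgr2]]. exists gr; split; auto.
    exists x, f; auto.
  - lra.
  - intros gx _. apply (bcov_grid d d rbase _ hv1). intros gr _.
    set (X := fun u => exists x f, hessian_degenerate S j u x f /\ xcell S (/ INR k) gx x /\ rcell gr u).
    (* The approximate null vector [f] of one reference potential [v] serves for all potentials of
       the cell: the slab estimate uses the degenerate Hessian of [v] alone. *)
    destruct (classic (exists v, X v)) as [[v hv]|hnone].
    2:{ eapply covered_mono; [| |apply (bcov_empty d X)]; auto. intros u hu; apply hnone; eauto. }
    destruct hv as [y [f [[hv [hyD [hyp [hyd [hfj [hf0 [hf1 hfH]]]]]]] [hyc hyr]]]].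
    pose (o := fun i => if S i then W - tcoef v i else Bd).
    assert (hstep : forall u x, inbox u -> in_Delta N x ->
      (forall i, (i < N)%nat -> S i = true -> Rabs (Dg N u i x) <= eta) ->
      xcell S (/ INR k) gx x -> rcell gr u ->
      (forall i, (i < N)%nat -> S i = true -> Rabs (tcoef u i - tcoef v i) <= W) /\
      Rabs (rsum N (fun i => f i * (tcoef u i - tcoef v i))) <=
        n * (2 * dd + 3 + 8 * (dd * Bd) * (n * n)) * eta).
    { intros u x hu hxD hxd hcx hcr.
      assert (hrest : forall l, (l < 2 ^ N)%nat -> Rabs (rest N u l - rest N v l) <= eta) by (apply (rcell_close gr); auto).
      assert (hxy : forall l, (l < N)%nat -> Rabs (x l - y l) <= / INR k) by (apply (xcell_close S (/ INR k) gx); auto; lra).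
      split.
      - intros i hi e. apply (tcoef_close N Bd eta u v x y hv hxD hyD hrest i (/ INR k)); auto.
      - eapply Rle_trans; [apply (slab_estimate N Bd eta ltac:(lra) u v x y hv hxD hyD hrest S f (/ INR k)); auto|].
        + intros i hi e. split; auto. specialize (hcx i hi). specialize (hyc i hi).
          rewrite e in hcx, hyc. now rewrite hcx, hyc.
        + lra.
        + fold d. fold dd n. right. unfold eta. field. lra. }
    eapply covered_mono; [| |apply (bcov_grid d N (tbase2 S j) _ hv0 (fun gt u => X u /\ tcell J o gt u))].
    + intros u hu. destruct (tcell_exists J o (tbase2 S j) u) as [gt [hgt1 hgt2]].
      * intros i hi. unfold tbase2. pose proof B1_ge_1. destruct (Nat.eqb i j); [lia|].
        destruct (S i); unfold B2; lia.
      * destruct hu as [x [f' [[hu [hxD [hxp [hxd _]]]] [hcx hcr]]]].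
        destruct (hstep u x hu hxD hxd hcx hcr) as [h1 _].
        intros i hi e. unfold J in e. apply Bool.negb_true_iff in e. unfold tbase2, o. rewrite e.
        destruct (S i) eqn:eS; [|now apply tcoef_box].
        rewrite B2_eta. specialize (h1 i hi eS). apply Rabs_le_between in h1. lra.
      * exists gt; split; auto.
    + lra.
    + intros gt _. apply bcov_diameter; auto.
      intros u1 u2 [[x1 [f1 [[hu1 [hx1D [_ [hx1d _]]]] [hcx1 hcr1]]]] ht1]
                   [[x2 [f2 [[hu2 [hx2D [_ [hx2d _]]]] [hcx2 hcr2]]]] ht2] l hl.
      apply u_close_of_parts; [auto|apply (rcell_close gr); auto|]. fold n.
      assert (hne : forall i, (i < N)%nat -> i <> j -> Rabs (tcoef u1 i - tcoef u2 i) <= eta).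
      { intros i hi hij. apply (tcell_close J o gt); auto. unfold J.
        destruct (Nat.eqb_spec i j); auto. }
      destruct (hstep u1 x1 hu1 hx1D hx1d hcx1 hcr1) as [_ h1].
      destruct (hstep u2 x2 hu2 hx2D hx2d hcx2 hcr2) as [_ h2].
      intros i hi. destruct (Nat.eq_dec i j) as [->|hij].
      * set (E := n * (2 * dd + 3 + 8 * (dd * Bd) * (n * n)) * eta) in *.
        (* Because [f j = 1], the slab relation can be solved for coefficient [j], whose grid thus
           has a single cell: player [j] costs [k] cells instead of [k^2]. *)
        assert (e : tcoef u1 j - tcoef u2 j =
          rsum N (fun i => f i * (tcoef u1 i - tcoef v i)) - rsum N (fun i => f i * (tcoef u2 i - tcoef v i)) -
          rsum N (fun i => if Nat.eqb i j then 0 else f i * (tcoef u1 i - tcoef u2 i))).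
        { rewrite <- !rsum_minus.
          rewrite (rsum_ext N _ (fun i => if Nat.eqb i j then tcoef u1 j - tcoef u2 j else 0)).
          - now rewrite rsum_single.
          - intros a ha. destruct (Nat.eqb_spec a j) as [->|]; [rewrite hfj|]; ring. }
        assert (h3 : Rabs (rsum N (fun i => if Nat.eqb i j then 0 else f i * (tcoef u1 i - tcoef u2 i))) <= n * eta).
        { eapply Rle_trans; [apply rsum_abs|]. apply rsum_le_const; intros a ha.
          destruct (Nat.eqb_spec a j) as [->|hne']; [rewrite Rabs_R0; lra|].
          rewrite Rabs_mult. specialize (hf1 a ha). specialize (hne a ha hne').
          pose proof (Rabs_pos (f a)). pose proof (Rabs_pos (tcoef u1 a - tcoef u2 a)). nra. }
        apply Rle_trans with (CB * eta); [|apply Rmult_le_compat_r; unfold CC; lra].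
        rewrite e. apply Rabs_le_between in h1. apply Rabs_le_between in h2. apply Rabs_le_between in h3.
        assert (hE : CB * eta = 2 * E + n * eta + eta) by (unfold CB, E; ring).
        rewrite hE. apply Rabs_le. lra.
      * eapply Rle_trans; [apply hne; auto|].
        rewrite <- (Rmult_1_l eta) at 1. apply Rmult_le_compat_r; [lra|unfold CC; lra].
Qed.

Let c2 : R := 4 * dd + 4 + 8 * (dd * Bd) * n + 2.

Lemma c2_ge_2 : 2 <= c2.
Proof.
  pose proof n_ge_1. pose proof Bd_ge_1. assert (0 <= dd) by apply pos_INR.
  assert (0 <= 8 * (dd * Bd) * n) by (repeat apply Rmult_le_pos; lra). unfold c2. lra.
Qed.

(** The last factor carries all the dependence on [k], so the bound tends to 0 as the grid is
    refined. *)
Definition total : R := c2 ^ N * (2 * (n + 1) * Bd * (2 * (1 + n * CC))) ^ d * / INR k.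

(** A budget per player: at most [c2 * B1] cells for strategy and coefficient together, player [j]
    saving a factor [k]. With the other [2 ^ N - N] coordinates there are at most of order
    [B1 ^ d / k] boxes of side [2 * diam], and [B1 * diam] does not depend on [k]. *)
Lemma total_bound (bx bt : nat -> nat) j : (j < N)%nat ->
  (forall i, (i < N)%nat -> INR (bx i) * INR (bt i) <= c2 * INR B1 * (if Nat.eqb i j then / INR k else 1)) ->
  rprod N (fun i => INR (bx i)) * (rprod d (fun i => INR (rbase i)) *
    (rprod N (fun i => INR (bt i)) * (2 * diam) ^ d)) <= total.
Proof.
  intros hj h. pose proof eta_pos as he. pose proof k_ge_1 as hk1. pose proof c2_ge_2 as hc2.
  pose proof CA_nonneg as hCA. pose proof CB_ge_1 as hCB. pose proof n_ge_1 as hn.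
  assert (hdiam : 0 <= diam) by (unfold diam, CC; assert (0 <= n * ((CA + CB) * eta)) by (repeat apply Rmult_le_pos; lra); lra).
  assert (hv0 : 0 <= (2 * diam) ^ d) by (apply pow_le; lra).
  assert (hB1 : 1 <= INR B1) by (apply INR_ge_1, B1_ge_1).
  assert (hik : 0 < / INR k) by (apply Rinv_0_lt_compat; lra).
  assert (h1 : rprod N (fun i => INR (bx i)) * rprod N (fun i => INR (bt i)) <= (c2 * INR B1) ^ N * / INR k).
  { rewrite <- rprod_mult.
    replace ((c2 * INR B1) ^ N * / INR k) with
      (rprod N (fun i => c2 * INR B1 * (if Nat.eqb i j then / INR k else 1))).
    - apply rprod_le. intros i hi. split; [apply Rmult_le_pos; apply pos_INR|auto].
    - rewrite rprod_mult, rprod_const, rprod_single by auto. reflexivity. }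
  assert (h2 : rprod d (fun i => INR (rbase i)) * INR B1 ^ N <= INR B1 ^ d).
  { rewrite (rprod_ext d _ (fun j => if is_pow2 N j then 1 else INR B1)).
    - apply count_pow2. lra.
    - intros i hi. unfold rbase. destruct is_pow2; reflexivity. }
  assert (hr : 0 <= rprod d (fun i => INR (rbase i))) by (apply rprod_nonneg; intros; apply pos_INR).
  replace (rprod N (fun i => INR (bx i)) * (rprod d (fun i => INR (rbase i)) *
    (rprod N (fun i => INR (bt i)) * (2 * diam) ^ d))) with
    ((rprod N (fun i => INR (bx i)) * rprod N (fun i => INR (bt i))) *
     (rprod d (fun i => INR (rbase i)) * (2 * diam) ^ d)) by ring.
  apply Rle_trans with (((c2 * INR B1) ^ N * / INR k) * (rprod d (fun i => INR (rbase i)) * (2 * diam) ^ d)).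
  { apply Rmult_le_compat_r; auto. apply Rmult_le_pos; auto. }
  rewrite Rpow_mult_distr.
  replace (c2 ^ N * INR B1 ^ N * / INR k * (rprod d (fun i => INR (rbase i)) * (2 * diam) ^ d)) with
    (c2 ^ N * / INR k * ((rprod d (fun i => INR (rbase i)) * INR B1 ^ N) * (2 * diam) ^ d)) by ring.
  apply Rle_trans with (c2 ^ N * / INR k * (INR B1 ^ d * (2 * diam) ^ d)).
  { apply Rmult_le_compat_l.
    - apply Rmult_le_pos; [apply pow_le|]; lra.
    - apply Rmult_le_compat_r; auto. }
  rewrite <- Rpow_mult_distr. unfold total.
  replace (INR B1 * (2 * diam)) with (2 * (n + 1) * Bd * (2 * (1 + n * CC))).
  - right; ring.
  - rewrite <- B1_eta. unfold diam. ring.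
Qed.

Lemma B1_ge_kk : INR k * INR k <= INR B1.
Proof.
  rewrite B1_value. pose proof n_ge_1. pose proof Bd_ge_1. pose proof k_ge_1.
  assert (1 <= 2 * (n + 1) * Bd) by nra. assert (0 <= INR k * INR k) by nra. nra.
Qed.

Lemma cover_boundary_total S j : (j < N)%nat -> S j = false ->
  bcov d (fun u => exists x, boundary_degenerate S j u x) total.
Proof.
  intros hj hSj. eapply covered_mono; [| |apply (cover_boundary_degenerate S j hj hSj)]; auto.
  apply (total_bound (xbase S (k * k)) (tbase1 S j) j hj). intros i hi.
  pose proof B1_ge_kk as hB. pose proof c2_ge_2 as hc. pose proof k_ge_1 as hk1.
  unfold xbase, tbase1. destruct (Nat.eqb_spec i j) as [->|hij].
  - rewrite hSj. simpl.
    assert (INR k <= INR B1 * / INR k).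
    { apply Rmult_le_reg_r with (INR k); [lra|]. rewrite Rmult_assoc, Rinv_l by lra. lra. }
    rewrite Rmult_assoc. nra.
  - destruct (S i); simpl orb.
    + rewrite mult_INR. simpl. nra.
    + replace (INR 2) with 2 by (simpl; ring). nra.
Qed.

Lemma cover_hessian_total S j : (j < N)%nat -> S j = true ->
  bcov d (fun u => exists x f, hessian_degenerate S j u x f) total.
Proof.
  intros hj hSj. eapply covered_mono; [| |apply (cover_hessian_degenerate S j hj hSj)]; auto.
  apply (total_bound (xbase S k) (tbase2 S j) j hj). intros i hi.
  pose proof B1_ge_kk as hB. pose proof c2_ge_2 as hc. pose proof k_ge_1 as hk1.
  unfold xbase, tbase2. destruct (Nat.eqb_spec i j) as [->|hij].
  - rewrite hSj. simpl (INR 1).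
    assert (INR k <= INR B1 * / INR k).
    { apply Rmult_le_reg_r with (INR k); [lra|]. rewrite Rmult_assoc, Rinv_l by lra. lra. }
    rewrite Rmult_assoc. nra.
  - destruct (S i).
    + assert (hB2 : INR B2 <= c2 * INR k).
      { unfold B2. rewrite !plus_INR, !mult_INR. fold dd n Bd.
        replace (INR 4) with 4 by (simpl; ring). replace (INR 8) with 8 by (simpl; ring).
        assert (0 <= dd) by apply pos_INR. unfold c2. nra. }
      rewrite Rmult_1_r. nra.
    + replace (INR 2) with 2 by (simpl; ring). nra.
Qed.

Lemma cover_irregular :
  bcov d (fun u => inbox u /\ irregular N u) (2 ^ N * (n * (2 * total))).
Proof.
  assert (ht : 0 <= total).
  { unfold total. pose proof c2_ge_2. pose proof k_ge_1. pose proof n_ge_1. pose proof Bd_ge_1.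
    pose proof CA_nonneg. pose proof CB_ge_1.
    apply Rmult_le_pos; [|apply Rlt_le, Rinv_0_lt_compat; lra].
    apply Rmult_le_pos; apply pow_le; [lra|].
    assert (0 <= n * CC) by (apply Rmult_le_pos; unfold CC; lra).
    repeat apply Rmult_le_pos; lra. }
  (* Sets of players are coded by binary digits, so that their union is counted by [bcov_grid], with
     the factor [2 ^ N]. *)
  pose (Sg := fun (g : nat -> nat) i => Nat.eqb (g i) 1).
  pose (X := fun (g : nat -> nat) (j t : nat) u =>
    match t with
    | O => Sg g j = false /\ exists x, boundary_degenerate (Sg g) j u x
    | _ => Sg g j = true /\ exists x f, hessian_degenerate (Sg g) j u x f
    end).
  eapply covered_mono; [| |apply (bcov_grid d N (fun _ => 2%nat) (n * (2 * total)) ltac:(pose proof n_ge_1; nra)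
    (fun g u => exists j, (j < N)%nat /\ exists t, (t < 2)%nat /\ X g j t u))].
  - intros u [hu hirr]. pose proof (hirr eta eta_pos) as hr.
    apply not_all_ex_not in hr. destruct hr as [S hr]. apply not_all_ex_not in hr. destruct hr as [x hr].
    apply imply_to_and in hr. destruct hr as [hx hr]. apply imply_to_and in hr. destruct hr as [hp hr].
    apply imply_to_and in hr. destruct hr as [hD hr].
    assert (hg : exists g, digits N (fun _ => 2%nat) g /\ forall i, (i < N)%nat -> Nat.eqb (g i) 1 = S i).
    { apply (digits_choice N (fun _ => 2%nat) (fun i c => Nat.eqb c 1 = S i)). intros i hi.
      destruct (S i); [exists 1%nat|exists O]; split; auto. }
    destruct hg as [g [hg1 hg2]]. exists g; split; auto.
    fold (Sg g) in hg2. assert (hg3 : forall i, (i < N)%nat -> Sg g i = S i) by auto. clear hg2.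
    apply not_and_or in hr. destruct hr as [hr|hr].
    + apply not_all_ex_not in hr. destruct hr as [j hr]. apply imply_to_and in hr. destruct hr as [hj hr].
      apply imply_to_and in hr. destruct hr as [hSj hr].
      exists j; split; auto. exists O; split; [lia|]. split; [now rewrite hg3|]. exists x.
      repeat split; auto; try apply hx; auto.
      * intros i hi e. apply hp; auto. now rewrite <- hg3.
      * intros i hi [e| ->]; [apply hD; auto; now rewrite <- hg3|lra].
    + apply not_all_ex_not in hr. destruct hr as [f hr]. apply not_all_ex_not in hr. destruct hr as [j hr].
      apply imply_to_and in hr. destruct hr as [hj hr]. apply imply_to_and in hr. destruct hr as [hSj hr].
      apply imply_to_and in hr. destruct hr as [hfj hr]. apply imply_to_and in hr. destruct hr as [hf0 hr].
      apply imply_to_and in hr. destruct hr as [hf1 hr].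
      exists j; split; auto. exists 1%nat; split; [lia|]. split; [now rewrite hg3|]. exists x, f.
      split; [|split; [|split; [|split; [|split; [|split; [|split]]]]]]; auto.
      * intros i hi e. apply hp; auto. now rewrite <- hg3.
      * intros i hi e. apply hD; auto. now rewrite <- hg3.
      * intros i hi e. apply hf0; auto. now rewrite <- hg3.
      * intros i hi e. apply Rnot_lt_le. intros hlt. apply hr. exists i. rewrite <- hg3; auto.
  - rewrite rprod_const. replace (INR 2) with 2 by (simpl; ring). lra.
  - intros g _. apply (bcov_digit d (fun j u => exists t, (t < 2)%nat /\ X g j t u) N (2 * total)); [lra|].
    intros j hj. apply (bcov_digit d (X g j) 2 total ht).
    intros t _. destruct t as [|t]; simpl X.
    + destruct (Sg g j) eqn:e.
      * eapply covered_mono; [| |apply (bcov_empty d (fun _ => False))]; [|exact ht|tauto].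
        intros u [h _]; congruence.
      * eapply covered_mono; [| |apply (cover_boundary_total (Sg g) j hj e)]; [|lra]. intros u [_ h]; exact h.
    + destruct (Sg g j) eqn:e.
      * eapply covered_mono; [| |apply (cover_hessian_total (Sg g) j hj e)]; [|lra]. intros u [_ h]; exact h.
      * eapply covered_mono; [| |apply (bcov_empty d (fun _ => False))]; [|exact ht|tauto].
        intros u [h _]; congruence.
Qed.

End Counting.

Lemma irregular_null N : (1 <= N)%nat -> lebesgue_null (2 ^ N) (irregular N).
Proof.
  intros hN.
  assert (hneg : negligible (bwt (2 ^ N)) (bmem (2 ^ N)) (irregular N)).
  { apply negligible_mono with (fun u => exists Rb, inbox N (S Rb) u /\ irregular N u).
    - intros u hu. destruct (INR_unbounded (umass N u)) as [Rb hRb]. exists Rb. split; auto.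
      intros j hj. pose proof (abs_le_l1 (2 ^ N) u j hj) as h. fold (umass N u) in h. rewrite S_INR. lra.
    - apply negligible_Union. intros Rb eps heps.
      set (n := INR N).
      pose (T := 2 ^ N * (n * (2 * (total N (S Rb) 1)))).
      destruct (INR_unbounded (T / eps)) as [k hk].
      eapply covered_mono; [| |apply (cover_irregular N hN (S Rb) ltac:(lia) (S k) ltac:(lia))]; auto.
      assert (hp : 0 < INR (S k)) by (apply lt_0_INR; lia).
      assert (e : 2 ^ N * (INR N * (2 * total N (S Rb) (S k))) = T * / INR (S k)).
      { unfold T, total, n. replace (/ INR 1) with 1 by (simpl; field). ring. }
      rewrite e. apply Rmult_le_reg_r with (INR (S k)); auto.
      rewrite Rmult_assoc, Rinv_l, Rmult_1_r by lra.
      assert (T / eps * eps <= INR (S k) * eps) by (apply Rmult_le_compat_r; [lra|]; rewrite S_INR; lra).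
      replace (T / eps * eps) with T in H by (field; lra). lra. }
  intros eps heps.
  destruct (covered_sequence (bwt (2 ^ N)) (bmem (2 ^ N)) (bwt_nonneg _)) with (A := irregular N) (d := eps / 2) (e := eps / 2)
    as [s [h1 h2]].
  - intros e he. exists (fun _ => 0, fun _ => 0). unfold bwt, box_vol; simpl.
    assert (h : (1 <= 2 ^ N)%nat) by (assert (2 ^ N <> 0)%nat by (apply Nat.pow_nonzero; lia); lia).
    destruct (2 ^ N)%nat as [|d]; [lia|]. cbn [rprod]. rewrite Rminus_diag, Rmax_right by lra. lra.
  - lra.
  - apply hneg; lra.
  - exists (fun j => fst (s j)), (fun j => snd (s j)). split; auto.
    intros K. specialize (h1 K). unfold bwt in h1. lra.
Qed.

(** * Nash distributions of a regular potential at low temperature *)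

Lemma exp_neg_le t : 0 < t -> exp (- t) <= / t.
Proof.
  intros ht. rewrite exp_Ropp. apply Rinv_le_contravar; auto.
  pose proof (exp_ineq1_le t). lra.
Qed.

(** Fourth power, because [low_exp_small] compares the exponential with [lam^2]: a factor [lam^2] is
    left to absorb the constants. *)
Lemma exp_neg_le_4 t : 0 < t -> exp (- t) <= (4 / t) ^ 4.
Proof.
  intros ht. replace (exp (- t)) with (exp (- (t / 4)) ^ 4).
  - apply pow_incr. split; [apply Rlt_le, exp_pos|].
    eapply Rle_trans; [apply exp_neg_le; lra|]. right; field; lra.
  - simpl. rewrite Rmult_1_r, <- !exp_plus. f_equal. field.
Qed.

Section LowTemperature.
Context (N : nat) (hN : (1 <= N)%nat) (u : nat -> R) (eps : R) (heps : 0 < eps) (hreg : regular N eps u).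
Context (kap : R).

Let m : R := umass N u.
Let n : R := INR N.

Context (hkap : 0 < kap <= 1 / 4) (hkap' : 16 * (m + 1) * (n * n) * kap <= eps).

(** After positivity, in order: mixed players are nearly critical; best responses near a strict
    equilibrium are within [kap] of it; [lam^2 <= lam]; the exponential of [- eps / (2 lam)] is
    small against [lam^2]; [K] expands on the mixed players; the trace is positive. *)
Definition low (lam : R) : Prop :=
  0 < lam /\ 2 * lam <= eps * (kap * kap) /\ 2 * lam <= eps * kap /\ lam <= 1 /\
  1024 * (m + 1) * n * lam <= eps * eps /\ 8 * n * lam <= kap * eps /\
  24 * (n * n) * (m + 1) * lam < kap * kap * (eps * eps).

Lemma low_exists : exists l0, 0 < l0 /\ forall lam, 0 < lam < l0 -> low lam.
Proof.
  assert (hm : 0 <= m) by apply umass_nonneg.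
  pose proof (INR_ge_1 N hN : 1 <= n) as hn.
  assert (key : forall c d, 0 < c -> 0 < d -> exists l0, 0 < l0 /\ forall lam, 0 < lam < l0 -> c * lam < d).
  { intros c d hc hd. exists (d / c). split; [now apply Rdiv_lt_0_compat|].
    intros lam hlam. apply Rlt_le_trans with (c * (d / c)); [apply Rmult_lt_compat_l; lra|right; field; lra]. }
  assert (hnn : 1 <= n * n) by nra.
  destruct (key 2 (eps * (kap * kap))) as [l1 [h1 k1]]; [lra|repeat apply Rmult_lt_0_compat; lra|].
  destruct (key 2 (eps * kap)) as [l2 [h2 k2]]; [lra|repeat apply Rmult_lt_0_compat; lra|].
  destruct (key (1024 * (m + 1) * n) (eps * eps)) as [l3 [h3 k3]]; [repeat apply Rmult_lt_0_compat; lra|nra|].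
  destruct (key (8 * n) (kap * eps)) as [l4 [h4 k4]]; [lra|repeat apply Rmult_lt_0_compat; lra|].
  destruct (key (24 * (n * n) * (m + 1)) (kap * kap * (eps * eps))) as [l5 [h5 k5]];
    [repeat apply Rmult_lt_0_compat; lra|repeat apply Rmult_lt_0_compat; lra|].
  exists (Rmin 1 (Rmin l1 (Rmin l2 (Rmin l3 (Rmin l4 l5))))).
  split; [repeat apply Rmin_glb_lt; lra|].
  intros lam [hl hlam].
  apply Rmin_Rgt_l in hlam. destruct hlam as [a0 hlam]. apply Rmin_Rgt_l in hlam. destruct hlam as [a1 hlam].
  apply Rmin_Rgt_l in hlam. destruct hlam as [a2 hlam]. apply Rmin_Rgt_l in hlam. destruct hlam as [a3 hlam].
  apply Rmin_Rgt_l in hlam. destruct hlam as [a4 a5].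
  unfold low. specialize (k1 lam ltac:(lra)). specialize (k2 lam ltac:(lra)). specialize (k3 lam ltac:(lra)).
  specialize (k4 lam ltac:(lra)). specialize (k5 lam ltac:(lra)). repeat split; lra.
Qed.

Lemma low_le lam mu : low lam -> 0 < mu <= lam -> low mu.
Proof.
  intros [h1 [h2 [h3 [h4 [h5 [h6 h7]]]]]] hmu.
  assert (hm : 0 <= m) by apply umass_nonneg.
  pose proof (INR_ge_1 N hN : 1 <= n) as hn.
  assert (0 <= 1024 * (m + 1) * n) by (repeat apply Rmult_le_pos; lra).
  assert (0 <= 24 * (n * n) * (m + 1)) by (repeat apply Rmult_le_pos; lra).
  assert (1024 * (m + 1) * n * mu <= 1024 * (m + 1) * n * lam) by (apply Rmult_le_compat_l; lra).
  assert (24 * (n * n) * (m + 1) * mu <= 24 * (n * n) * (m + 1) * lam) by (apply Rmult_le_compat_l; lra).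
  assert (8 * n * mu <= 8 * n * lam) by (apply Rmult_le_compat_l; lra).
  unfold low; repeat split; lra.
Qed.

Lemma low_exp_kap lam : low lam -> exp (- (eps / 2 / lam)) <= kap.
Proof.
  intros [h1 [_ [h3 _]]].
  eapply Rle_trans; [apply exp_neg_le; apply Rdiv_lt_0_compat; lra|].
  replace (/ (eps / 2 / lam)) with (2 * lam / eps) by (field; lra).
  apply Rmult_le_reg_r with eps; auto. unfold Rdiv. rewrite Rmult_assoc, Rinv_l; lra.
Qed.

Lemma low_exp_small lam : low lam -> 128 * ((m + 1) * (m + 1)) * (n * n) * exp (- (eps / 2 / lam)) <= lam * lam.
Proof.
  intros [h1 [_ [_ [_ [h5 _]]]]].
  assert (hm : 0 <= m) by apply umass_nonneg.
  pose proof (INR_ge_1 N hN : 1 <= n) as hn.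
  apply Rle_trans with (128 * ((m + 1) * (m + 1)) * (n * n) * (4 / (eps / 2 / lam)) ^ 4).
  { apply Rmult_le_compat_l; [repeat apply Rmult_le_pos; lra|].
    apply exp_neg_le_4. apply Rdiv_lt_0_compat; lra. }
  set (y := 1024 * (m + 1) * n * lam) in *.
  assert (hy : 0 <= y) by (unfold y; repeat apply Rmult_le_pos; lra).
  assert (hyy : y * y <= (eps * eps) * (eps * eps)) by (apply Rmult_le_compat; lra).
  replace (128 * ((m + 1) * (m + 1)) * (n * n) * (4 / (eps / 2 / lam)) ^ 4) with
    ((lam * lam) * (y * y / (2 * ((eps * eps) * (eps * eps))))) by (unfold y; field; lra).
  rewrite <- (Rmult_1_r (lam * lam)) at 2. apply Rmult_le_compat_l; [nra|].
  assert (he : 0 < (eps * eps) * (eps * eps)) by (repeat apply Rmult_lt_0_compat; auto).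
  apply Rmult_le_reg_r with (2 * ((eps * eps) * (eps * eps))); [lra|].
  unfold Rdiv. rewrite Rmult_assoc, Rinv_l; lra.
Qed.

(** * Rounding a Nash distribution to a face, and its hyperbolicity *)

Definition mixed (z : nat -> R) (i : nat) : bool :=
  if Rle_dec kap (z i) then if Rle_dec (z i) (1 - kap) then true else false else false.

Definition round (z : nat -> R) (i : nat) : R :=
  if mixed z i then z i else if Rle_dec (z i) (1 / 2) then 0 else 1.

Lemma mixed_true z i : mixed z i = true -> kap <= z i <= 1 - kap.
Proof. unfold mixed; destruct Rle_dec; [destruct Rle_dec|]; intros; try discriminate; lra. Qed.

Lemma mixed_false z i : mixed z i = false -> z i < kap \/ 1 - kap < z i.
Proof. unfold mixed; destruct Rle_dec; [destruct Rle_dec|]; intros; try discriminate; lra. Qed.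

Lemma round_in_Delta z : in_Delta N z -> in_Delta N (round z).
Proof.
  intros hz i hi. specialize (hz i hi). unfold round. destruct (mixed z i); auto.
  destruct Rle_dec; lra.
Qed.

Lemma round_close z i : in_Delta N z -> (i < N)%nat -> Rabs (round z i - z i) <= kap.
Proof.
  intros hz hi. specialize (hz i hi). unfold round. destruct (mixed z i) eqn:e.
  - rewrite Rminus_diag, Rabs_R0. lra.
  - apply mixed_false in e. apply Rabs_le. destruct Rle_dec; lra.
Qed.

Lemma Dg_kap_close i x y : (i < N)%nat -> in_Delta N x -> in_Delta N y ->
  (forall l, (l < N)%nat -> Rabs (y l - x l) <= kap) -> Rabs (Dg N u i y - Dg N u i x) <= eps / 2.
Proof.
  intros hi hx hy h. pose proof (Dg_lip N u i x y hi hx hy) as h1. fold m in h1.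
  assert (hm : 0 <= m) by apply umass_nonneg.
  pose proof (INR_ge_1 N hN : 1 <= n) as hn.
  assert (h2 : l1 N (fun l => y l - x l) <= n * kap) by (now apply rsum_le_const).
  assert (h3 : 4 * m * l1 N (fun l => y l - x l) <= 4 * m * (n * kap)) by (apply Rmult_le_compat_l; lra).
  assert (h4 : m * n * kap <= (m + 1) * (n * n) * kap).
  { apply Rmult_le_compat_r; [lra|]. apply Rmult_le_compat; nra. }
  lra.
Qed.

Lemma ND_Dg lam z i : 0 < lam -> ND N u lam z -> (i < N)%nat -> Dg N u i z = lam * logit (z i).
Proof.
  intros hl hz hi. rewrite (proj2 hz i hi), BR_sigma, logit_sigma by lra. field. lra.
Qed.

Lemma ND_dsigma lam z i : 0 < lam -> ND N u lam z -> (i < N)%nat -> z i * (1 - z i) = dsigma (Dg N u i z / lam).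
Proof.
  intros hl hz hi. unfold dsigma. rewrite <- BR_sigma by lra. now rewrite <- (proj2 hz i hi).
Qed.

(** At a Nash distribution the payoff slope is [lam * logit (z i)], and the logit of a mixed player
    is at most [/ (kap * kap)] in modulus. This leaves half of [eps] for the rounding. *)
Lemma round_critical lam z i : low lam -> ND N u lam z -> (i < N)%nat -> mixed z i = true ->
  Rabs (Dg N u i (round z)) <= eps.
Proof.
  intros hlow hz hi e. pose proof hlow as [hl [h2 _]]. apply mixed_true in e.
  pose proof (Dg_kap_close i z (round z) hi (proj1 hz) (round_in_Delta z (proj1 hz))) as h.
  assert (h' : Rabs (Dg N u i z) <= eps / 2).
  { rewrite (ND_Dg lam z i hl hz hi), Rabs_mult, (Rabs_pos_eq lam) by lra.
    destruct (logit_mvt kap hkap (1 / 2) (z i)) as [d [hd ed]]; try lra.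
    replace (logit (1 / 2)) with 0 in ed.
    2:{ unfold logit. replace (1 / 2 / (1 - 1 / 2)) with 1 by field. symmetry; apply ln_1. }
    rewrite Rminus_0_r in ed. rewrite ed, Rabs_mult, (Rabs_pos_eq d) by lra.
    assert (Rabs (z i - 1 / 2) <= 1) by (apply Rabs_le; lra).
    pose proof (Rabs_pos (z i - 1 / 2)).
    assert (d * Rabs (z i - 1 / 2) <= / (kap * kap)) by nra.
    apply Rle_trans with (lam * / (kap * kap)); [apply Rmult_le_compat_l; lra|].
    assert (0 < kap * kap) by nra.
    apply Rmult_le_reg_r with (kap * kap); auto. rewrite Rmult_assoc, Rinv_l; lra. }
  specialize (h (fun l hl' => round_close z l (proj1 hz) hl')).
  replace (Dg N u i (round z)) with ((Dg N u i (round z) - Dg N u i z) + Dg N u i z) by ring.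
  eapply Rle_trans; [apply Rabs_triang|]. lra.
Qed.

Lemma round_regular lam z : low lam -> ND N u lam z ->
  (forall j, (j < N)%nat -> mixed z j = false -> eps < Rabs (Dg N u j (round z))) /\
  (forall f j, (j < N)%nat -> mixed z j = true -> f j = 1 ->
    (forall i, (i < N)%nat -> mixed z i = false -> f i = 0) -> (forall i, (i < N)%nat -> Rabs (f i) <= 1) ->
    exists i, (i < N)%nat /\ mixed z i = true /\ eps < Rabs (rsum N (fun l => Hs N u i l (round z) * f l))).
Proof.
  intros hlow hz. apply (hreg (mixed z) (round z)).
  - now apply round_in_Delta, hz.
  - intros i hi e. unfold round. rewrite e. destruct Rle_dec; auto.
  - intros i hi e. now apply (round_critical lam).
Qed.

Lemma ND_hyperbolic lam z : low lam -> ND N u lam z ->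
  (forall a, / 4 * ip N lam z a a <= ip N lam z (shifted N u lam z a) (shifted N u lam z a)) /\
  ((exists j, (j < N)%nat /\ mixed z j = true) ->
    0 < rsum N (fun i => Bmat N u lam z i i * (z i * (1 - z i)))).
Proof.
  intros hlow hz. pose proof hlow as [hl [h2 [h3 [h4 [h5 [h6 h7]]]]]].
  assert (hm : 0 <= m) by apply umass_nonneg.
  pose proof (INR_ge_1 N hN : 1 <= n) as hn.
  destruct (round_regular lam z hlow hz) as [ha hb].
  assert (hzD := proj1 hz). assert (hrD := round_in_Delta z hzD).
  (* For mixed players [z (1 - z)] is at least [kap (1 - kap)], hence at least [kap / 2]. For the
     others the payoff gap at [z] exceeds [eps / 2], and [dsigma_le_exp] gives [q]. *)
  set (p := kap / (2 * lam)). set (q := exp (- (eps / 2 / lam)) / lam).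
  assert (hp : 0 < p) by (apply Rdiv_lt_0_compat; lra).
  assert (hq : 0 <= q) by (apply Rdiv_le_0_compat; auto; apply Rlt_le, exp_pos).
  assert (hS : forall i, (i < N)%nat -> mixed z i = true -> p <= z i * (1 - z i) / lam).
  { intros i hi e. apply mixed_true in e. unfold p.
    replace (kap / (2 * lam)) with (kap / 2 / lam) by (field; lra).
    apply Rmult_le_compat_r; [apply Rlt_le, Rinv_0_lt_compat; lra|].
    assert (kap * (1 - kap) <= z i * (1 - z i)).
    { assert (0 <= (z i - kap) * (1 - kap - z i)) by (apply Rmult_le_pos; lra). nra. }
    nra. }
  assert (hS' : forall i, (i < N)%nat -> mixed z i = false -> z i * (1 - z i) / lam <= q).
  { intros i hi e. apply Rmult_le_compat_r; [apply Rlt_le, Rinv_0_lt_compat; lra|].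
    rewrite (ND_dsigma lam z i hl hz hi). eapply Rle_trans; [apply dsigma_le_exp|].
    specialize (ha i hi e).
    pose proof (Dg_kap_close i z (round z) hi hzD hrD (fun l hl' => round_close z l hzD hl')) as hc.
    assert (hD : eps / 2 < Rabs (Dg N u i z)).
    { pose proof (Rabs_triang (Dg N u i (round z) - Dg N u i z) (Dg N u i z)) as ht.
      replace (Dg N u i (round z) - Dg N u i z + Dg N u i z) with (Dg N u i (round z)) in ht by ring. lra. }
    replace (Rabs (Dg N u i z / lam)) with (Rabs (Dg N u i z) * / lam).
    2:{ unfold Rdiv. rewrite Rabs_mult, (Rabs_pos_eq (/ lam)); auto. apply Rlt_le, Rinv_0_lt_compat; lra. }
    apply Rlt_le, exp_increasing, Ropp_lt_contravar.
    apply Rmult_lt_compat_r; [now apply Rinv_0_lt_compat|auto]. }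
  assert (hH : forall f j, (j < N)%nat -> mixed z j = true -> f j = 1 ->
    (forall i, (i < N)%nat -> mixed z i = false -> f i = 0) -> (forall i, (i < N)%nat -> Rabs (f i) <= 1) ->
    exists i, (i < N)%nat /\ mixed z i = true /\ eps / 2 < Rabs (rsum N (fun l => Hs N u i l z * f l))).
  { intros f j hj e hfj hf0 hf1. destruct (hb f j hj e hfj hf0 hf1) as [i [hi [hSi h]]].
    exists i; repeat split; auto.
    assert (hd : Rabs (rsum N (fun l => Hs N u i l (round z) * f l) - rsum N (fun l => Hs N u i l z * f l)) <= eps / 2).
    { rewrite <- rsum_minus. eapply Rle_trans; [apply rsum_abs|].
      apply Rle_trans with (n * (8 * m * (n * kap))).
      - apply rsum_le_const; intros l hl'. rewrite <- Rmult_minus_distr_r, Rabs_mult.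
        rewrite <- (Rmult_1_r (8 * m * (n * kap))). apply Rmult_le_compat; try apply Rabs_pos; auto.
        eapply Rle_trans; [apply (Hs_lip N u i l z (round z)); auto|]. fold m.
        apply Rmult_le_compat_l; [lra|]. apply rsum_le_const; intros; now apply round_close.
      - assert (m * (n * n) * kap <= (m + 1) * (n * n) * kap) by (apply Rmult_le_compat_r; nra). lra. }
    set (A := rsum N (fun l => Hs N u i l (round z) * f l)) in *.
    set (C := rsum N (fun l => Hs N u i l z * f l)) in *.
    pose proof (Rabs_triang (A - C) C) as ht. replace (A - C + C) with A in ht by ring. lra. }
  assert (hpe : p * (eps / 2) = kap * eps / (4 * lam)) by (unfold p; field; lra).
  split.
  - apply (hyperbolic_of_regular N u lam hl hN z hz (mixed z) p q (eps / 2)); auto; [lra| |].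
    + fold n. rewrite hpe.
      assert (h : 2 * n <= kap * eps / (4 * lam)).
      { apply Rmult_le_reg_r with (4 * lam); [lra|].
        replace (kap * eps / (4 * lam) * (4 * lam)) with (kap * eps) by (field; lra). lra. }
      apply Rle_trans with ((2 * n) * (2 * n)); [nra|]. apply Rmult_le_compat; lra.
    + fold m n. pose proof (low_exp_small lam hlow) as he. unfold q.
      apply Rmult_le_reg_r with lam; auto.
      replace (128 * (m * m) * (n * n) * (exp (- (eps / 2 / lam)) / lam) * lam) with
        (128 * (m * m) * (n * n) * exp (- (eps / 2 / lam))) by (field; lra).
      eapply Rle_trans; [|apply he]. apply Rmult_le_compat_r; [apply Rlt_le, exp_pos|].
      apply Rmult_le_compat_r; nra.
  - intros hj. apply (trace_pos_of_regular N u lam hl hN z hz (mixed z) p (eps / 2)); auto; [lra|].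
    fold m n. rewrite hpe.
    replace (2 * lam * (kap * eps / (4 * lam) * (kap * eps / (4 * lam)))) with
      (kap * kap * (eps * eps) / (8 * lam)) by (field; lra).
    apply Rmult_lt_reg_r with (8 * lam); [lra|].
    unfold Rdiv at 1. rewrite (Rmult_assoc _ (/ (8 * lam))), Rinv_l by lra. lra.
Qed.

(** * The branch of Nash distributions at a strict pure equilibrium *)

Section PureBranch.
Context (p : nat -> R) (hp : pure_point N p).
Context (hstrict : forall i, (i < N)%nat -> (p i = 1 -> eps < Dg N u i p) /\ (p i = 0 -> Dg N u i p < - eps)).

Lemma p_in_Delta : in_Delta N p.
Proof. intros i hi. destruct (hp i hi) as [-> | ->]; lra. Qed.

Definition pbox (x : nat -> R) : Prop := in_Delta N x /\ forall i, (i < N)%nat -> Rabs (x i - p i) <= kap.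

Lemma pbox_Dg x i : pbox x -> (i < N)%nat ->
  (p i = 1 /\ eps / 2 <= Dg N u i x) \/ (p i = 0 /\ Dg N u i x <= - (eps / 2)).
Proof.
  intros [hx hc] hi. pose proof (Dg_kap_close i p x hi p_in_Delta hx hc) as h.
  apply Rabs_le_between in h. destruct (hstrict i hi) as [h1 h0].
  destruct (hp i hi) as [e|e]; [right; specialize (h0 e)|left; specialize (h1 e)]; split; auto; lra.
Qed.

Lemma BR_near_pure mu x i : low mu -> pbox x -> (i < N)%nat ->
  Rabs (BR N u mu i x - p i) <= exp (- (eps / 2 / mu)).
Proof.
  intros hlow hx hi. pose proof hlow as [hmu _]. rewrite BR_sigma by lra.
  assert (him : 0 < / mu) by now apply Rinv_0_lt_compat.
  pose proof (sigma_bounds (Dg N u i x / mu)) as hs.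
  destruct (pbox_Dg x i hx hi) as [[-> h]|[-> h]].
  - rewrite Rabs_minus_sym, Rabs_pos_eq by lra. rewrite <- sigma_opp.
    eapply Rle_trans; [|apply sigma_le_exp]. apply sigma_incr. unfold Rdiv at 1 2.
    unfold Rdiv in *. nra.
  - rewrite Rminus_0_r, Rabs_pos_eq by lra.
    eapply Rle_trans; [|apply sigma_le_exp]. apply sigma_incr. unfold Rdiv in *. nra.
Qed.

(** The payoff gaps at [x] and [y] have the same sign and modulus at least [eps / 2], and so do all
    values in between; the logistic slope there is exponentially small and outweighs [1 / mu]. *)
Lemma BR_contraction mu x y i : low mu -> pbox x -> pbox y -> (i < N)%nat ->
  Rabs (BR N u mu i y - BR N u mu i x) <= / (2 * n) * l1 N (fun i => y i - x i).
Proof.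
  intros hlow hx hy hi. pose proof hlow as [hmu [_ [_ [hmu1 _]]]]. rewrite !BR_sigma by lra.
  assert (him : 0 < / mu) by now apply Rinv_0_lt_compat.
  assert (hm : 0 <= m) by apply umass_nonneg.
  pose proof (INR_ge_1 N hN : 1 <= n) as hn.
  set (E := exp (- (eps / 2 / mu))).
  assert (hE : 0 < E) by apply exp_pos.
  destruct (sigma_mvt (Dg N u i x / mu) (Dg N u i y / mu)) as [c [hc ->]].
  assert (hcE : dsigma c <= E).
  { eapply Rle_trans; [apply dsigma_le_exp|].
    assert (hca : eps / 2 / mu <= Rabs c).
    { destruct (pbox_Dg x i hx hi) as [[e h]|[e h]]; destruct (pbox_Dg y i hy hi) as [[e' h']|[e' h']]; try lra.
      - assert (eps / 2 / mu <= c).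
        { eapply Rle_trans; [|apply hc]. apply Rmin_glb; apply Rmult_le_compat_r; lra. }
        eapply Rle_trans; [apply H|apply Rle_abs].
      - assert (c <= - (eps / 2 / mu)).
        { eapply Rle_trans; [apply hc|]. unfold Rdiv. rewrite Ropp_mult_distr_l.
          apply Rmax_lub; apply Rmult_le_compat_r; lra. }
        rewrite <- Rabs_Ropp. eapply Rle_trans; [|apply Rle_abs]. lra. }
    unfold E. destruct hca as [hca|hca]; [apply Rlt_le, exp_increasing; lra|rewrite hca; lra]. }
  replace (Dg N u i y / mu - Dg N u i x / mu) with (/ mu * (Dg N u i y - Dg N u i x)) by (field; lra).
  rewrite !Rabs_mult, (Rabs_pos_eq (/ mu)) by lra.
  pose proof (dsigma_bounds c) as hd. rewrite (Rabs_pos_eq (dsigma c)) by lra.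
  pose proof (Dg_lip N u i x y hi (proj1 hx) (proj1 hy)) as hlip. fold m in hlip.
  set (l := l1 N (fun i => y i - x i)) in *. assert (hl0 : 0 <= l) by apply l1_nonneg.
  apply Rle_trans with (E * (/ mu * (4 * m * l))).
  { apply Rmult_le_compat; try lra.
    - apply Rmult_le_pos; [lra|apply Rabs_pos].
    - apply Rmult_le_compat_l; lra. }
  replace (E * (/ mu * (4 * m * l))) with ((E * (4 * m) / mu) * l) by (field; lra).
  apply Rmult_le_compat_r; auto.
  pose proof (low_exp_small mu hlow) as hs. fold E in hs.
  apply Rmult_le_reg_r with (mu * (2 * n)); [nra|].
  replace (E * (4 * m) / mu * (mu * (2 * n))) with (8 * (m * n * E)) by (field; lra).
  replace (/ (2 * n) * (mu * (2 * n))) with mu by (field; lra).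
  assert (h1 : m * n * E <= ((m + 1) * (m + 1)) * (n * n) * E).
  { apply Rmult_le_compat_r; [lra|]. apply Rmult_le_compat; nra. }
  nra.
Qed.

Lemma l1_ext e f : (forall i, (i < N)%nat -> e i = f i) -> l1 N e = l1 N f.
Proof. intros h; apply rsum_ext; intros i hi; now rewrite h. Qed.

Lemma BR_l1_contraction mu x y : low mu -> pbox x -> pbox y ->
  l1 N (fun i => BR N u mu i y - BR N u mu i x) <= / 2 * l1 N (fun i => y i - x i).
Proof.
  intros hlow hx hy.
  pose proof (INR_ge_1 N hN : 1 <= n) as hn.
  apply Rle_trans with (n * (/ (2 * n) * l1 N (fun i => y i - x i))).
  - apply rsum_le_const; intros i hi. now apply BR_contraction.
  - right; field; lra.
Qed.

Lemma BR_pbox mu x : low mu -> pbox x -> pbox (fun i => BR N u mu i x).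
Proof.
  intros hlow hx. split.
  - intros i hi. pose proof (BR_bounds N u mu i x); lra.
  - intros i hi. eapply Rle_trans; [now apply BR_near_pure|now apply low_exp_kap].
Qed.

Fixpoint iterBR (mu : R) (k : nat) : nat -> R :=
  match k with O => p | S k => fun i => BR N u mu i (iterBR mu k) end.

Lemma iterBR_pbox mu k : low mu -> pbox (iterBR mu k).
Proof.
  intros hlow. induction k; simpl; [|now apply BR_pbox].
  split; [apply p_in_Delta|]. intros i hi. rewrite Rminus_diag, Rabs_R0. lra.
Qed.

Lemma iterBR_increment mu k : low mu ->
  l1 N (fun i => iterBR mu (S k) i - iterBR mu k i) <= (/ 2) ^ k * l1 N (fun i => iterBR mu 1 i - iterBR mu 0 i).
Proof.
  intros hlow. induction k; [simpl; lra|].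
  eapply Rle_trans; [apply (BR_l1_contraction mu (iterBR mu k) (iterBR mu (S k)) hlow); now apply iterBR_pbox|].
  simpl pow. lra.
Qed.

(** Banach's fixed point argument with compactness in place of completeness: the increments of the
    iteration tend to 0, so any cluster point is fixed. *)
Lemma pure_branch_exists mu : low mu -> exists b, ND N u mu b /\ pbox b.
Proof.
  intros hlow. pose proof hlow as [hmu _].
  pose proof (INR_ge_1 N hN : 1 <= n) as hn.
  destruct (bolzano_weierstrass_cube N (iterBR mu) (fun k => proj1 (iterBR_pbox mu k hlow))) as [phi [b [hphi hb]]].
  assert (hbox : pbox b).
  { assert (hc : forall i, (i < N)%nat -> Rabs (b i - p i) <= kap).
    { intros i hi. apply le_epsilon; intros e he. destruct (hb e he) as [M hM].
      specialize (hM M (le_n M) i hi). pose proof (proj2 (iterBR_pbox mu (phi M) hlow) i hi) as h.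
      replace (b i - p i) with (- (iterBR mu (phi M) i - b i) + (iterBR mu (phi M) i - p i)) by ring.
      eapply Rle_trans; [apply Rabs_triang|]. rewrite Rabs_Ropp. lra. }
    split; auto. intros i hi. split; apply Rnot_lt_le; intros hlt.
    - destruct (hb (- b i)) as [M hM]; [lra|]. specialize (hM M (le_n M) i hi).
      pose proof (proj1 (iterBR_pbox mu (phi M) hlow) i hi). apply Rabs_lt_between in hM. lra.
    - destruct (hb (b i - 1)) as [M hM]; [lra|]. specialize (hM M (le_n M) i hi).
      pose proof (proj1 (iterBR_pbox mu (phi M) hlow) i hi). apply Rabs_lt_between in hM. lra. }
  exists b; split; auto. split; [apply hbox|]. intros i hi.
  assert (h0 : Rabs (b i - BR N u mu i b) <= 0).
  { apply le_epsilon; intros e he. rewrite Rplus_0_l.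
    destruct (hb (e / 4)) as [M hM]; [lra|].
    set (l0 := l1 N (fun i => iterBR mu 1 i - iterBR mu 0 i)).
    assert (hl0 : 0 <= l0) by apply l1_nonneg.
    destruct (pow_lt_1_zero (/ 2)) with (y := e / (4 * (l0 + 1))) as [K hK].
    { rewrite Rabs_pos_eq; lra. }
    { apply Rdiv_lt_0_compat; lra. }
    set (j := Nat.max M K). pose proof (hphi j) as hpj. set (y := iterBR mu (phi j)).
    assert (h1 : forall l, (l < N)%nat -> Rabs (y l - b l) <= e / 4) by (intros l hl; apply Rlt_le, hM; auto; unfold j; lia).
    assert (h2 : Rabs (BR N u mu i y - y i) <= e / 4).
    { pose proof (iterBR_increment mu (phi j) hlow) as h. fold l0 in h.
      pose proof (abs_le_l1 N (fun i => iterBR mu (S (phi j)) i - iterBR mu (phi j) i) i hi) as h'.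
      simpl in h'. fold y in h'.
      assert (hpow : (/ 2) ^ phi j * l0 <= e / 4).
      { specialize (hK (phi j) ltac:(unfold j in *; lia)).
        rewrite Rabs_pos_eq in hK by (apply pow_le; lra).
        apply Rle_trans with (e / (4 * (l0 + 1)) * l0); [apply Rmult_le_compat_r; lra|].
        apply Rmult_le_reg_r with (4 * (l0 + 1)); [lra|].
        replace (e / (4 * (l0 + 1)) * l0 * (4 * (l0 + 1))) with (e * l0) by (field; lra). nra. }
      eapply Rle_trans; [apply h'|]. eapply Rle_trans; [|apply hpow]. exact h. }
    assert (h3 : Rabs (BR N u mu i b - BR N u mu i y) <= e / 4).
    { eapply Rle_trans; [apply (BR_contraction mu y b i hlow (iterBR_pbox mu (phi j) hlow) hbox hi)|].
      apply Rle_trans with (/ (2 * n) * (n * (e / 4))).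
      - apply Rmult_le_compat_l; [apply Rlt_le, Rinv_0_lt_compat; lra|].
        apply rsum_le_const; intros l hl. rewrite Rabs_minus_sym. now apply h1.
      - replace (/ (2 * n) * (n * (e / 4))) with (e / 8) by (field; lra). lra. }
    replace (b i - BR N u mu i b) with (- (y i - b i) + - (BR N u mu i y - y i) + - (BR N u mu i b - BR N u mu i y)) by ring.
    eapply Rle_trans; [apply Rabs_triang|]. rewrite Rabs_Ropp.
    pose proof (Rabs_triang (- (y i - b i)) (- (BR N u mu i y - y i))) as h4. rewrite !Rabs_Ropp in h4.
    specialize (h1 i hi). lra. }
  destruct (Req_dec (b i - BR N u mu i b) 0) as [e|e]; [lra|].
  pose proof (Rabs_pos_lt _ e). lra.
Qed.

Lemma pure_branch_unique mu x y i : low mu -> ND N u mu x -> ND N u mu y -> pbox x -> pbox y -> (i < N)%nat ->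
  y i = x i.
Proof.
  intros hlow hx hy bx by' hi.
  pose proof (BR_l1_contraction mu x y hlow bx by') as h.
  rewrite (l1_ext (fun i => BR N u mu i y - BR N u mu i x) (fun i => y i - x i)) in h.
  2:{ intros j hj. now rewrite <- (proj2 hx j hj), <- (proj2 hy j hj). }
  pose proof (abs_le_l1 N (fun i => y i - x i) i hi) as h'. simpl in h'.
  destruct (Req_dec (y i - x i) 0) as [e|e]; [lra|]. pose proof (Rabs_pos_lt _ e). lra.
Qed.

Lemma pure_NE : NE N u p.
Proof.
  split; [apply p_in_Delta|]. intros i hi y hy. rewrite U_move by auto.
  destruct (hstrict i hi) as [h1 h0].
  destruct (hp i hi) as [e|e]; rewrite e; [specialize (h0 e)|specialize (h1 e)]; nra.
Qed.

(** The displacement is at most half of itself, by contraction, plus the change of the best response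
    at the fixed point [x]. The condition [mu / 2 <= nu] bounds the change of [1 / nu] by a multiple
    of [/ (mu * mu)]. *)
Lemma branch_continuity mu nu x y : low mu -> low nu -> mu / 2 <= nu -> ND N u mu x -> ND N u nu y -> pbox x -> pbox y ->
  l1 N (fun i => y i - x i) <= 8 * n * m / (mu * mu) * Rabs (nu - mu).
Proof.
  intros hlow hlow' hnu hx hy bx by'. pose proof hlow as [hmu _]. pose proof hlow' as [hnu' _].
  assert (hm : 0 <= m) by apply umass_nonneg.
  pose proof (INR_ge_1 N hN : 1 <= n) as hn.
  pose proof (BR_l1_contraction nu x y hlow' bx by') as h1.
  assert (h2 : l1 N (fun i => BR N u nu i x - BR N u mu i x) <= n * (2 * m * (2 * Rabs (nu - mu) / (mu * mu)))).
  { apply rsum_le_const; intros i hi. rewrite !BR_sigma by lra.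
    eapply Rle_trans; [apply sigma_lip|].
    replace (Dg N u i x / nu - Dg N u i x / mu) with (Dg N u i x * (- (nu - mu) / (nu * mu))) by (field; lra).
    rewrite Rabs_mult. apply Rmult_le_compat; try apply Rabs_pos; [apply Dg_bound, bx|].
    unfold Rdiv. rewrite Rabs_mult, Rabs_Ropp, (Rabs_pos_eq (/ (nu * mu)))
      by (apply Rlt_le, Rinv_0_lt_compat; nra).
    rewrite (Rmult_comm 2), Rmult_assoc. apply Rmult_le_compat_l; [apply Rabs_pos|].
    replace (2 * / (mu * mu)) with (/ (mu / 2 * mu)) by (field; lra).
    apply Rinv_le_contravar; [apply Rmult_lt_0_compat; lra|]. apply Rmult_le_compat_r; lra. }
  assert (h3 : l1 N (fun i => y i - x i) <= l1 N (fun i => BR N u nu i y - BR N u nu i x) +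
                                          l1 N (fun i => BR N u nu i x - BR N u mu i x)).
  { unfold l1. rewrite <- rsum_plus. apply rsum_le; intros i hi.
    rewrite (proj2 hx i hi), (proj2 hy i hi) at 1.
    replace (BR N u nu i y - BR N u mu i x) with
      ((BR N u nu i y - BR N u nu i x) + (BR N u nu i x - BR N u mu i x)) by ring. apply Rabs_triang. }
  replace (8 * n * m / (mu * mu) * Rabs (nu - mu)) with (2 * (n * (2 * m * (2 * Rabs (nu - mu) / (mu * mu)))))
    by (field; lra). lra.
Qed.

(** An arbitrary choice of a Nash distribution in the box at each temperature forms the branch:
    uniqueness makes it pass through [z], and the contraction estimates make it continuous. *)
Lemma pure_ND_of_box lam z : low lam -> ND N u lam z -> pbox z -> pure_ND N u lam z.
Proof.
  intros hlow hz bz. pose proof hlow as [hl _].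
  assert (hm : 0 <= m) by apply umass_nonneg.
  pose proof (INR_ge_1 N hN : 1 <= n) as hn.
  assert (hex : forall mu, exists b, 0 < mu <= lam -> ND N u mu b /\ pbox b).
  { intros mu. destruct (classic (0 < mu <= lam)) as [h|h].
    - destruct (pure_branch_exists mu (low_le lam mu hlow h)) as [b hb]. exists b; auto.
    - exists p. intros h'; contradiction. }
  pose (b := fun mu => proj1_sig (constructive_indefinite_description _ (hex mu))).
  assert (hb : forall mu, 0 < mu <= lam -> ND N u mu (b mu) /\ pbox (b mu)).
  { intros mu; unfold b; now destruct constructive_indefinite_description. }
  exists b, p. split; [|split; [|split; [|split; [|split]]]]; auto using pure_NE.
  - intros i hi. destruct (hb lam ltac:(lra)) as [h1 h2]. now apply (pure_branch_unique lam z (b lam) i).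
  - intros mu hmu. now apply hb.
  - intros mu hmu e he. destruct (hb mu hmu) as [h1 h2].
    set (C := 8 * n * m / (mu * mu)).
    assert (hC : 0 <= C) by (apply Rdiv_le_0_compat; [repeat apply Rmult_le_pos; lra|nra]).
    exists (Rmin (mu / 2) (e / (C + 1))). split; [apply Rmin_glb_lt; [lra|apply Rdiv_lt_0_compat; lra]|].
    intros nu hnu hd i hi. destruct (hb nu hnu) as [h1' h2'].
    apply Rmin_Rgt_l in hd. destruct hd as [hd1 hd2]. apply Rgt_lt in hd1, hd2.
    assert (hhalf : mu / 2 <= nu) by (apply Rabs_lt_between in hd1; lra).
    pose proof (branch_continuity mu nu (b mu) (b nu) (low_le lam mu hlow hmu) (low_le lam nu hlow hnu) hhalf h1 h1' h2 h2') as h.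
    fold C in h. pose proof (abs_le_l1 N (fun i => b nu i - b mu i) i hi) as h'. simpl in h'.
    apply Rle_lt_trans with (C * Rabs (nu - mu)); [lra|].
    apply Rle_lt_trans with (C * (e / (C + 1))); [apply Rmult_le_compat_l; lra|].
    apply Rmult_lt_reg_r with (C + 1); [lra|].
    replace (C * (e / (C + 1)) * (C + 1)) with (C * e) by (field; lra). nra.
  - intros e he. exists (e * eps / 2). split; [nra|]. intros nu hnu hd i hi.
    destruct (hb nu hnu) as [h1 h2]. rewrite (proj2 h1 i hi).
    eapply Rle_lt_trans; [apply (BR_near_pure nu (b nu) i (low_le lam nu hlow hnu) h2 hi)|].
    eapply Rle_lt_trans; [apply exp_neg_le; apply Rdiv_lt_0_compat; lra|].
    replace (/ (eps / 2 / nu)) with (2 * nu / eps) by (field; lra).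
    apply Rmult_lt_reg_r with eps; auto. unfold Rdiv at 1. rewrite Rmult_assoc, Rinv_l by lra. lra.
Qed.

End PureBranch.

(** A mixed player makes the trace positive and [z] unstable. Without one, [z] is within [kap] of
    the vertex [round z], which is a strict equilibrium: the side of [1 / 2] on which [z i] lies
    gives the sign of the payoff slope. *)
Lemma ND_dichotomy lam z a0 : low lam -> ND N u lam z ->
  pure_ND N u lam z \/
  negligible (cylwt N u lam a0) (cylmem N) (fun w => converges_to N (emp a0 w) z).
Proof.
  intros hlow hz. pose proof hlow as [hl _].
  destruct (ND_hyperbolic lam z hlow hz) as [hhyp htr].
  destruct (classic (exists j, (j < N)%nat /\ mixed z j = true)) as [hj|hj].
  - right. apply (unstable_not_limit N u lam a0 hl z hz (Bmat N u lam z) (Bmat_sym N u lam z) (Lam N u lam * lam)).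
    + apply Rmult_lt_0_compat; auto. now apply Lam_pos.
    + now apply hyperbolic_drift.
    + now apply hyperbolic_scaled_drift.
    + auto.
  - left. assert (hall : forall i, (i < N)%nat -> mixed z i = false).
    { intros i hi. destruct (mixed z i) eqn:e; auto. destruct hj; eauto. }
    assert (hzD := proj1 hz). assert (hrD := round_in_Delta z hzD).
    assert (hpure : pure_point N (round z)).
    { intros i hi. unfold round. rewrite (hall i hi). destruct Rle_dec; auto. }
    apply (pure_ND_of_box (round z) hpure); auto.
    + intros i hi. destruct (round_regular lam z hlow hz) as [ha _]. specialize (ha i hi (hall i hi)).
      pose proof (Dg_kap_close i z (round z) hi hzD hrD (fun l hl' => round_close z l hzD hl')) as hc.
      apply Rabs_le_between in hc.
      assert (hzi : z i = sigma (Dg N u i z / lam)) by (rewrite <- BR_sigma by lra; apply (proj2 hz i hi)).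
      assert (h12 : sigma 0 = 1 / 2) by (unfold sigma; rewrite Ropp_0, exp_0; field).
      assert (him : 0 < / lam) by now apply Rinv_0_lt_compat.
      unfold round at 1 3. rewrite (hall i hi). destruct Rle_dec as [h|h]; split; intros e; try lra.
      * assert (Dg N u i z <= 0).
        { apply Rnot_lt_le; intros hlt.
          pose proof (hall i hi) as hm. apply mixed_false in hm.
          assert (1 / 2 <= z i).
          { rewrite hzi, <- h12. apply sigma_incr. unfold Rdiv. nra. }
          lra. }
        unfold Rabs in ha. destruct Rcase_abs; lra.
      * assert (0 <= Dg N u i z).
        { apply Rnot_lt_le; intros hlt.
          assert (z i <= 1 / 2).
          { rewrite hzi, <- h12. apply sigma_incr. unfold Rdiv. nra. }
          lra. }
        unfold Rabs in ha. destruct Rcase_abs; lra.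
    + split; auto. intros i hi. rewrite Rabs_minus_sym. now apply round_close.
Qed.

End LowTemperature.

Lemma negligible_grid {X Y : Type} (wt : X -> R) (mem : Y -> X -> Prop) J : forall A : (nat -> nat) -> Y -> Prop,
  (forall g, negligible wt mem (A g)) ->
  negligible wt mem (fun y => exists g, (forall j, (J <= j)%nat -> g j = O) /\ A g y).
Proof.
  induction J; intros A h.
  - apply negligible_mono with (A (fun _ => O)); auto.
    intros y [g [hg hA]]. replace (fun _ : nat => O) with g; auto. extensionality j; apply hg; lia.
  - apply negligible_mono with (fun y => exists c g, (forall j, (J <= j)%nat -> g j = O) /\ A (setp g J c) y).
    + intros y [g [hg hA]]. exists (g J), (setp g J O). split.
      * intros j hj. destruct (Nat.eq_dec j J) as [->|]; [apply setp_same|rewrite setp_other by auto; apply hg; lia].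
      * replace (setp (setp g J O) J (g J)) with g; auto.
        extensionality j. unfold setp. now destruct (Nat.eqb_spec j J) as [->|].
    + apply negligible_Union. intros c. apply (IHJ (fun g => A (setp g J c))). auto.
Qed.

(* Isolated points are countably many: each one is alone in some cell of a rational grid. *)
Lemma negligible_isolated_limits N u lam a0 (T : (nat -> R) -> Prop) :
  (forall z, ND N u lam z -> isolated_zero N u lam z) ->
  (forall z, ND N u lam z -> T z -> negligible (cylwt N u lam a0) (cylmem N) (fun w => converges_to N (emp a0 w) z)) ->
  negligible (cylwt N u lam a0) (cylmem N)
    (fun w => exists z, ND N u lam z /\ T z /\ converges_to N (emp a0 w) z).
Proof.
  intros hiso hT.
  pose (In := fun k g z => ND N u lam z /\ T z /\ forall i, (i < N)%nat -> cell (/ INR (S k)) (g i) (z i)).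
  assert (hsel : forall k g, exists z, (exists z', In k g z') -> In k g z).
  { intros k g. destruct (classic (exists z', In k g z')) as [[z hz]|h]; [exists z; auto|exists (fun _ => 0); tauto]. }
  pose (sel := fun k g => proj1_sig (constructive_indefinite_description _ (hsel k g))).
  assert (hs : forall k g, (exists z', In k g z') -> In k g (sel k g)).
  { intros k g; unfold sel; now destruct constructive_indefinite_description. }
  apply negligible_mono with (fun w => exists k g, (forall j, (N <= j)%nat -> g j = O) /\
    ((exists z', In k g z') /\ converges_to N (emp a0 w) (sel k g))).
  - intros w [z [hz [hTz hw]]]. destruct (hiso z hz) as [r [c [hr [hc hloc]]]].
    destruct (INR_unbounded (/ r)) as [k hk].
    assert (hp : 0 < INR (S k)) by (apply lt_0_INR; lia).
    destruct (digits_choice N (fun _ => S k) (fun i g => cell (/ INR (S k)) g (z i))) as [g [[_ hg0] hg]].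
    { intros i hi. apply cell_exists; [lia|]. rewrite Rinv_r by lra. now apply hz. }
    exists k, g. split; auto.
    assert (hin : In k g z) by (split; [|split]; auto).
    split; [eauto|]. destruct (hs k g (ex_intro _ z hin)) as [hy [hTy hyc]]. set (y := sel k g) in *.
    (* The selected [y] shares with [z] a cell of side at most [r] and is itself a zero of the
       field, so the isolation of [z] forces [y = z]. *)
    assert (hd : c * sqn N (diff y z) <= 0).
    { replace 0 with (sqn N (field N u lam y)).
      - apply hloc; [apply hy|]. intros i hi.
        apply Rle_trans with (/ INR (S k)); [now apply (cell_close _ (g i)); auto|].
        rewrite <- (Rinv_inv r). apply Rinv_le_contravar; [now apply Rinv_0_lt_compat|].
        rewrite S_INR; lra.
      - apply rsum_0; intros i hi. rewrite (field_ND N u lam y hy i hi); ring. }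
    assert (heq : forall i, (i < N)%nat -> y i = z i).
    { intros i hi. pose proof (sqr_le_sqn N (diff y z) i hi) as h. unfold diff at 1 2 in h.
      assert (sqn N (diff y z) <= 0) by (apply Rmult_le_reg_l with c; lra).
      assert (h' : (y i - z i) * (y i - z i) = 0) by (pose proof (Rle_0_sqr (y i - z i)) as h'; unfold Rsqr in h'; lra).
      apply Rmult_integral in h'. lra. }
    intros e he. destruct (hw e he) as [M hM]. exists M. intros n hn i hi. rewrite heq by auto. now apply hM.
  - apply negligible_Union. intros k.
    apply (negligible_grid (cylwt N u lam a0) (cylmem N) N
      (fun g w => (exists z', In k g z') /\ converges_to N (emp a0 w) (sel k g))).
    intros g. destruct (classic (exists z', In k g z')) as [h|h].
    + destruct (hs k g h) as [h1 [h2 _]].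
      eapply negligible_mono; [|apply (hT (sel k g) h1 h2)]. intros w [_ hw]; exact hw.
    + apply negligible_empty. tauto.
Qed.

Theorem theorem4 : forall N : nat, (1 <= N)%nat ->
  exists E : (nat -> R) -> Prop,
    depends_on_first (2 ^ N)%nat E /\ closed_in (2 ^ N)%nat E /\
    lebesgue_null (2 ^ N)%nat E /\
    forall u : nat -> R, ~ E u ->
      exists lam0, 0 < lam0 /\
        forall lam, 0 < lam < lam0 -> forall a0 : nat -> bool,
          sfp_as N u lam a0 (fun w =>
            exists xs, pure_ND N u lam xs /\ converges_to N (emp a0 w) xs).
Proof.
  intros N hN. exists (irregular N).
  split; [apply irregular_depends|]. split; [apply irregular_closed|]. split; [now apply irregular_null|].
  intros u hu. apply not_all_ex_not in hu. destruct hu as [eps hu]. apply imply_to_and in hu.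
  destruct hu as [heps hreg]. apply NNPP in hreg.
  assert (hm : 0 <= umass N u) by apply umass_nonneg.
  assert (hn : 1 <= INR N) by now apply INR_ge_1.
  set (M := 16 * (umass N u + 1) * (INR N * INR N)).
  assert (hM : 0 < M) by (unfold M; repeat apply Rmult_lt_0_compat; lra).
  (* Displacing every coordinate by at most [kap] then changes a partial derivative, or a row of the
     Hessian applied to a vector with entries bounded by 1, by at most [eps / 2]. *)
  set (kap := Rmin (1 / 4) (eps / M)).
  assert (hkap : 0 < kap <= 1 / 4).
  { unfold kap; split; [apply Rmin_glb_lt; [lra|now apply Rdiv_lt_0_compat]|apply Rmin_l]. }
  assert (hkap' : 16 * (umass N u + 1) * (INR N * INR N) * kap <= eps).
  { fold M. apply Rle_trans with (M * (eps / M)); [apply Rmult_le_compat_l; [lra|apply Rmin_r]|right; field; lra]. }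
  destruct (low_exists N hN u eps heps kap hkap) as [l0 [hl0 hlow]].
  exists l0; split; auto. intros lam hlam a0. specialize (hlow lam hlam).
  apply negligible_sfp_null; [auto|lra|].
  assert (hiso : forall z, ND N u lam z -> isolated_zero N u lam z).
  { intros z hz. apply hyperbolic_isolated; auto; [lra|].
    now apply (ND_hyperbolic N hN u eps heps hreg kap hkap hkap' lam z). }
  apply negligible_mono with (fun w =>
    (~ exists z, ND N u lam z /\ converges_to N (emp a0 w) z) \/
    exists z, ND N u lam z /\ ~ pure_ND N u lam z /\ converges_to N (emp a0 w) z).
  - intros w hw. destruct (classic (exists z, ND N u lam z /\ converges_to N (emp a0 w) z)) as [[z [h1 h2]]|h]; auto.
    right. exists z. split; [auto|]. split; [|auto]. intros hp. apply hw. eauto.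
  - apply negligible_union; [apply convergence_almost_sure; auto; lra|].
    apply (negligible_isolated_limits N u lam a0 (fun z => ~ pure_ND N u lam z)); auto.
    intros z hz hnp.
    destruct (ND_dichotomy N hN u eps heps hreg kap hkap hkap' lam z a0 hlow hz); tauto.
Qed.
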